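(* Let $r \ge 2$ be an integer and let $\varepsilon > 0$. Then there exist a constant $\gamma > 0$ and a function $\omega$ with $\omega(n) \to \infty$ as $n \to \infty$ such that the following holds for all sufficiently small $\delta > 0$. For every $n$, if $m \ge (1+\varepsilon)m_r$, then \[ |\mathcal{F}_{n,m}^*(K_{r+1}; \delta, \gamma, \Pi)| \le \frac{1}{\omega(n)} \binom{e(\Pi)}{m} \quad \text{for every } \Pi \in \mathcal{P}_{n,r}(\gamma). \]
   Context: All graphs have vertex set $[n]=\{1,\dots,n\}$. $\mathcal{F}_{n,m}(K_{r+1})$ is the family of all $K_{r+1}$-free graphs on $[n]$ with exactly $m$ edges. For $\gamma>0$, $\mathcal{P}_{n,r}(\gamma)$ is the family of partitions $\Pi=\{V_1,\dots,V_r\}$ of $[n]$ into $r$ parts with $(\frac1r-\gamma)n \le |V_i| \le (\frac1r+\gamma)n$ for all $i$; a partition $\Pi$ is identified with the complete $r$-partite graph on $[n]$ with parts $V_1,\dots,V_r$, and $e(\Pi)$ is its number of edges. For a graph $G$ and a partition $\Pi=\{V_1,\dots,V_r\}$ of $[n]$ consider the conditions (A) $\sum_{i=1}^r e_G(V_i) \le \delta m$, where $e_G(V_i)$ is the number of edges of $G$ inside $V_i$; (B) $\deg_G(v,V_i) \le \min_{j \ne i} \deg_G(v,V_j)$ for all $i\in[r]$ and all $v \in V_i$, where $\deg_G(v,A)$ is the number of neighbours of $v$ in $A$. $\mathcal{F}_{n,m}(K_{r+1};\delta,\gamma)$ is the set of $G \in \mathcal{F}_{n,m}(K_{r+1})$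 such that (A) holds for some partition $\Pi \in \mathcal{P}_{n,r}(\gamma)$ and for no $r$-part partition $\Pi \notin \mathcal{P}_{n,r}(\gamma)$. For $\Pi \in \mathcal{P}_{n,r}(\gamma)$, $\mathcal{F}^*_{n,m}(K_{r+1};\delta,\gamma,\Pi)$ is the set of $G \in \mathcal{F}_{n,m}(K_{r+1};\delta,\gamma)$ such that $(G,\Pi)$ satisfy (A) and (B) and $\sum_{i=1}^r e_G(V_i) > 0$. Finally, \[ m_r = \theta_r n^{2-\frac{2}{r+2}} (\log n)^{\frac{1}{\binom{r+1}{2}-1}}, \quad \theta_r = \frac{r-1}{2r}\left[ r\left(\frac{2r+2}{r+2}\right)^{\frac{1}{r-1}}\right]^{\frac{2}{r+2}}, \] with $\log$ the natural logarithm. *)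

(* Defs.v *)
From HB Require Import structures.
From mathcomp Require Import all_boot all_order all_algebra.
From mathcomp Require Import all_classical all_reals all_analysis.
Unset Printing Implicit Defensive.
Import Order.TTheory GRing.Theory Num.Theory.
Local Open Scope ring_scope.

Definition graph (n : nat) := {set {set 'I_n}}.

Definition is_graph {n} (G : graph n) : bool := [forall e in G, #|e| == 2%N].

Definition is_clique {n} (G : graph n) (S : {set 'I_n}) : bool :=
  [forall u in S, forall v in S, (u != v) ==> ([set u; v] \in G)].

Definition Kfree {n} (r : nat) (G : graph n) : bool :=
  [forall S : {set 'I_n}, (#|S| == r.+1) ==> ~~ is_clique G S].

Definition Fnm (n m r : nat) : {set graph n} :=
  [set G : graph n | [&& is_graph G, Kfree r G & #|G| == m]].

(* A partition {V_1,...,V_r} of [n] is encoded by a labelling of the vertices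
   by 'I_r; the part V_i is the fibre of i. *)
Definition labelling (n r : nat) := {ffun 'I_n -> 'I_r}.

Definition part {n r} (P : labelling n r) (i : 'I_r) : {set 'I_n} :=
  [set v | P v == i].

Definition is_rpartition {n r} (P : labelling n r) : bool :=
  [forall i, #|part P i| != 0%N].

Definition inP {R : realType} {n r} (gamma : R) (P : labelling n r) : bool :=
  is_rpartition P &&
  [forall i, ((r%:R^-1 - gamma) * n%:R <= (#|part P i|)%:R) &&
             ((#|part P i|)%:R <= (r%:R^-1 + gamma) * n%:R)].

Definition ePi {n r} (P : labelling n r) : nat :=
  #|[set e : {set 'I_n} | (#|e| == 2%N) &&
      [forall u in e, forall v in e, (u != v) ==> (P u != P v)]]|.

Definition e_in {n} (G : graph n) (A : {set 'I_n}) : nat :=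
  #|[set e in G | e \subset A]|.

Definition internal {n r} (G : graph n) (P : labelling n r) : nat :=
  (\sum_(i < r) e_in G (part P i))%N.

Definition deg {n} (G : graph n) (v : 'I_n) (A : {set 'I_n}) : nat :=
  #|[set u in A | [set v; u] \in G]|.

Definition condA {R : realType} {n r} (delta : R) (m : nat) (G : graph n)
  (P : labelling n r) : bool :=
  (internal G P)%:R <= delta * m%:R.

Definition condB {n r} (G : graph n) (P : labelling n r) : bool :=
  [forall i, forall v in part P i, forall j,
     (j != i) ==> (deg G v (part P i) <= deg G v (part P j))%N].

Definition Fdg {R : realType} (n m r : nat) (delta gamma : R) : {set graph n} :=
  [set G in Fnm n m r |
     [exists P : labelling n r, inP gamma P && condA delta m G P] &&
     [forall P : labelling n r,
        (is_rpartition P && ~~ inP gamma P) ==> ~~ condA delta m G P]].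

Definition Fstar {R : realType} (n m r : nat) (delta gamma : R)
  (P : labelling n r) : {set graph n} :=
  [set G in Fdg n m r delta gamma |
     [&& condA delta m G P, condB G P & (0 < internal G P)%N]].

Definition theta (R : realType) (r : nat) : R :=
  ((r%:R - 1) / (2 * r%:R)) *
  (r%:R * (((2 * r%:R + 2) / (r%:R + 2)) `^ ((r%:R - 1)^-1)))
    `^ (2 / (r%:R + 2)).

Definition m_r (R : realType) (n r : nat) : R :=
  theta R r * (n%:R `^ (2 - 2 / (r%:R + 2))) *
  ((ln (n%:R : R)) `^ (((binomial r.+1 2)%:R - 1)^-1)).

(* Main.v *)
Require Import Defs.
From HB Require Import structures.
From mathcomp Require Import all_boot all_order all_algebra.
From mathcomp Require Import all_classical all_reals all_analysis.
From mathcomp Require Import ring lra zify.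
From mathcomp Require Import fintype finset.
Set Implicit Arguments. Unset Strict Implicit. Unset Printing Implicit Defensive.
Import Order.TTheory GRing.Theory Num.Theory.
Local Open Scope ring_scope.

(* Write [G] as the set [T] of its edges inside the parts together with the set [S] of its
   edges across the parts. For a given [T] the number of admissible [S] is, up to a
   constant, [C(N, m - |T|)] times the probability that a random set of cross pairs of density
   [p = m/N] contains no copy of [K_{r+1}] minus an edge of [T], and a Janson-type inequality
   bounds this probability. One edge of [T] closes [mu ~ (n/r)^(r-1) p^E] copies on average, with
   [E = C(r+1,2) - 1], and above the threshold [e^-mu] beats the factor [n^2 p] that one pays
   for choosing an edge of [T].

   Overlapping copies spoil the inequality at vertices of large degree, so [T] is replaced by
   a maximal subset of bounded degree and size, its core. All other edges of [T] meet a vertex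
   saturated by the core, and they are charged either to these vertices or to the heavy
   vertices, those with about [n p] neighbours inside their own part. By condition (B) a heavy vertex
   has as many neighbours in every other part, and no [r]-tuple taken from these
   neighbourhoods is a clique; this costs [e^(- K n p)] for each heavy vertex, with [K] as large as desired.

   If [m > (1 - beta) N], almost all cross pairs are present. Then an inner edge forces linearly
   many missing cross pairs at one of its ends, and the missing pairs at these ends
   outnumber the inner edges, so that exchanging the former for the latter loses an
   exponential factor. *)

(** The threshold is the point where [n^2 p e^(- mu)] passes through 1. As [p] is [n^(- 2/(r+2))] up
    to logarithms, this asks for [mu > (2 - 2/(r+2)) ln n]; solving for [m] yields the factor
    [(2r+2)/(r+2)] and both exponents of [m_r]. Far above the threshold the overlaps of copies would
    exceed what a Janson bound tolerates. Hence every copy counts only with an independent coin,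
    which cuts the effective mean to at most [16 ln n]; this is still enough. The tuples at heavy
    vertices are thinned in the same way. A core of maximal size says nothing about the other inner
    edges, and its own gain must pay for them all. For a smaller core there is a balance: few heavy
    vertices are paid for by the gain of the core, while many heavy vertices pay for themselves and
    for the core. The second half needs a gain at heavy vertices that beats constants depending on
    the heaviness threshold, so this threshold is fixed before [K], and [delta] only after [K]. The
    final loss is a constant over [ln n]. *)

Section SubsetSums.
Variables (R : realType) (E : finType).
Implicit Types (U S : {set E}) (x : R).

Lemma sum_subset_card U (f : nat -> R) :
  \sum_(S : {set E} | S \subset U) f #|S| =
  \sum_(k < #|U|.+1) 'C(#|U|, k)%:R * f k.
Proof.
rewrite (partition_big (fun S : {set E} => inord #|S| : 'I_#|U|.+1) xpredT) //=.
apply: eq_bigr => k _.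
have -> : 'C(#|U|, k)%:R * f k = \sum_(S in [set S : {set E} | S \subset U & #|S| == k]) f k.
  by rewrite sumr_const cards_draws mulr_natl.
rewrite [RHS](eq_bigl (fun S : {set E} => (S \subset U) && (inord #|S| == k))).
  by apply: eq_bigr => S /andP[sSU /eqP <-]; rewrite inordK // ltnS subset_leq_card.
move=> S; rewrite inE; case: (boolP (S \subset U)) => //= sSU.
by rewrite -val_eqE /= inordK // ltnS subset_leq_card.
Qed.

Lemma sum_subset_expr U x :
  \sum_(S : {set E} | S \subset U) x ^+ #|S| = (1 + x) ^+ #|U|.
Proof.
rewrite sum_subset_card exprDn; apply: eq_bigr => k _.
by rewrite expr1n mul1r mulr_natl.
Qed.

Lemma sum_subset_expr_le U x : 0 <= x ->
  \sum_(S : {set E} | S \subset U) x ^+ #|S| <= expR (x * #|U|%:R).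
Proof.
move=> x0; rewrite sum_subset_expr expRM_natr lerXn2r ?nnegrE ?expR_ge0 ?addr_ge0 //.
exact: expR_ge1Dx.
Qed.

End SubsetSums.

(** * Random subsets and a Janson inequality *)

Section ProductMeasure.
Variables (R : realType) (E : finType) (B : {set E}) (p : R).
Hypotheses (p0 : 0 <= p) (p1 : p <= 1).
Implicit Types (S x y : {set E}) (f g : {set E} -> R).

Definition bern S : R := p ^+ #|S| * (1 - p) ^+ (#|B| - #|S|).
Definition Ex f : R := \sum_(S : {set E} | S \subset B) bern S * f S.

Lemma bern_ge0 S : 0 <= bern S.
Proof. by rewrite mulr_ge0 ?exprn_ge0 // subr_ge0. Qed.

Lemma Ex_le f g : (forall S, S \subset B -> f S <= g S) -> Ex f <= Ex g.
Proof. by move=> h; apply: ler_sum => S sS; rewrite ler_wpM2l ?bern_ge0 ?h. Qed.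

Lemma Ex_ge0 f : (forall S, S \subset B -> 0 <= f S) -> 0 <= Ex f.
Proof. by move=> h; apply: sumr_ge0 => S sS; rewrite mulr_ge0 ?bern_ge0 ?h. Qed.

Lemma eq_Ex f g : (forall S, S \subset B -> f S = g S) -> Ex f = Ex g.
Proof. by move=> h; apply: eq_bigr => S /h ->. Qed.

Lemma ExD f g : Ex (fun S => f S + g S) = Ex f + Ex g.
Proof. by rewrite -big_split; apply: eq_bigr => S _; rewrite mulrDr. Qed.

Lemma ExZ c f : Ex (fun S => c * f S) = c * Ex f.
Proof. by rewrite mulr_sumr; apply: eq_bigr => S _; rewrite mulrCA. Qed.

Lemma ExB f g : Ex (fun S => f S - g S) = Ex f - Ex g.
Proof.
rewrite -[- Ex g]mulN1r -ExZ -ExD; apply: eq_Ex => S _; by rewrite mulN1r.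
Qed.

Lemma Ex_sum (I : Type) (s : seq I) (Q : pred I) (F : I -> {set E} -> R) :
  Ex (fun S => \sum_(i <- s | Q i) F i S) = \sum_(i <- s | Q i) Ex (F i).
Proof. by rewrite exchange_big; apply: eq_bigr => S _; rewrite mulr_sumr. Qed.

Lemma Ex1 : Ex (fun=> 1) = 1.
Proof.
rewrite /Ex (eq_bigr (fun S : {set E} => (fun k => p ^+ k * (1 - p) ^+ (#|B| - k)) #|S|)); last first.
  by move=> S _; rewrite mulr1.
rewrite (@sum_subset_card R E B (fun k => p ^+ k * (1 - p) ^+ (#|B| - k))).
transitivity ((1 - p + p) ^+ #|B|); last by rewrite subrK expr1n.
rewrite exprDn; apply: eq_bigr => k _; rewrite mulr_natl; congr (_ *+ _); exact: mulrC.
Qed.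

Lemma Ex_cond1 e f : e \in B ->
  Ex (fun S => (e \in S)%:R * f S) = p * Ex (fun S => f (e |: S)).
Proof.
move=> eB; rewrite /Ex mulr_sumr.
rewrite [RHS](bigID (fun S : {set E} => e \in S)) /=.
rewrite [LHS](bigID (fun S : {set E} => e \in S)) /= [X in _ + X]big1 ?addr0; last first.
  by move=> S /andP[_ /negPf->]; rewrite mul0r mulr0.
rewrite [X in _ = _ + X](reindex_onto (fun S => S :\ e) (fun S => e |: S)) /=; last first.
  by move=> S /andP[_ /setU1K].
rewrite [X in _ = _ + X](eq_bigl (fun S : {set E} => (S \subset B) && (e \in S))); last first.
  move=> S; rewrite setD11 andbT; case eS: (e \in S).
    rewrite setD1K // eqxx !andbT; apply/idP/idP => [h|]; last exact/subset_trans/subsetDl.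
    by rewrite -(setD1K eS) subUset sub1set eB.
  rewrite andbF; apply/negP => /andP[_ /eqP h]; by rewrite -h setU11 in eS.
rewrite -big_split /=; apply: eq_bigr => S /andP[sSB eS].
have -> : e |: S = S by apply/setUidPr; rewrite sub1set.
rewrite finset.setD1K // eS mul1r -mulrDr -mulrDl mulrA; congr (_ * _).
rewrite /bern (cardsD1 e S) eS /= add1n.
have h : (#|S :\ e| < #|B|)%N.
  by have := subset_leq_card sSB; rewrite (cardsD1 e S) eS.
rewrite -(subnSK h) !exprS; ring.
Qed.

Lemma Ex_cond x f : x \subset B ->
  Ex (fun S => (x \subset S)%:R * f S) = p ^+ #|x| * Ex (fun S => f (S :|: x)).
Proof.
move: {2}#|x| (erefl #|x|) => k; elim: k x f => [|k IH] x f xk xB.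
  have -> : x = set0 by apply/eqP; rewrite -cards_eq0 xk.
  rewrite cards0 expr0 mul1r; apply: eq_Ex => S _; by rewrite sub0set mul1r setU0.
have /card_gt0P [e ex] : (0 < #|x|)%N by rewrite xk.
have xk' : #|x :\ e| = k by have := cardsD1 e x; rewrite ex xk add1n => -[].
have eB : e \in B by move/subsetP: xB; apply.
transitivity (Ex (fun S => (e \in S)%:R * ((x :\ e \subset S)%:R * f S))).
  apply: eq_Ex => S _; rewrite mulrA -natrM mulnb; congr (_%:R * _).
  by rewrite -{1}(setD1K ex) subUset sub1set.
rewrite Ex_cond1 //.
transitivity (p * Ex (fun S => (x :\ e \subset S)%:R * f (e |: S))).
  congr (_ * _); apply: eq_Ex => S _; congr ((nat_of_bool _)%:R * _).
  apply/subsetP/subsetP => h z zx.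
    by have := h _ zx; rewrite !inE; move: zx; rewrite !inE => /andP[/negPf-> _].
  by rewrite !inE h // orbT.
rewrite IH //; last by apply: subset_trans xB; exact: subsetDl.
rewrite mulrA -exprS xk' xk; congr (_ * _); apply: eq_Ex => S _.
by rewrite setUCA setD1K.
Qed.

(** The case of Harris' inequality behind the Janson bound: conditioning on [x \subset S] amounts to
    adding [x] to [S], which can only lower a decreasing [f]. *)
Lemma Ex_cond_antitone x f : x \subset B ->
  (forall S S', S \subset S' -> f S' <= f S) ->
  Ex (fun S => (x \subset S)%:R * f S) <= p ^+ #|x| * Ex f.
Proof.
move=> xB fd; rewrite Ex_cond // ler_wpM2l ?exprn_ge0 //.
by apply: Ex_le => S _; apply: fd; exact: subsetUl.
Qed.

Lemma Ex_cond_indep x f : x \subset B -> (forall S, f (S :|: x) = f S) ->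
  Ex (fun S => (x \subset S)%:R * f S) = p ^+ #|x| * Ex f.
Proof. by move=> xB fx; rewrite Ex_cond //; congr (_ * _); apply: eq_Ex. Qed.

Section Janson.
Variable q : R.
Hypotheses (q0 : 0 <= q) (q1 : q <= 1).

(** Given [S], the probability that no member of [L] inside [S] is kept, each being kept by an
    independent coin of bias [q]. It dominates the indicator of avoiding [L] altogether; the mean
    scales with [q], the overlap term with [q ^+ 2]. *)
Definition avoid (L : seq {set E}) (S : {set E}) : R :=
  \prod_(x <- L) (1 - q * (x \subset S)%:R).

Lemma avoid_fac_ge0 x S : 0 <= 1 - q * (x \subset S)%:R.
Proof. by case: (x \subset S); rewrite ?mulr1 ?mulr0 ?subr0 ?subr_ge0. Qed.

Lemma avoid_fac_le1 x S : 1 - q * (x \subset S)%:R <= 1.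
Proof. by rewrite gerBl mulr_ge0. Qed.

Lemma avoid_ge0 L S : 0 <= avoid L S.
Proof. by apply: prodr_ge0 => x _; exact: avoid_fac_ge0. Qed.

Lemma avoid_le1 L S : avoid L S <= 1.
Proof. by apply: prodr_ile1 => x _; rewrite avoid_fac_ge0 avoid_fac_le1. Qed.

Lemma avoid_antitone L S S' : S \subset S' -> avoid L S' <= avoid L S.
Proof.
move=> sS; apply: ler_prod => x _; rewrite avoid_fac_ge0 /= lerD2l lerN2 ler_wpM2l //.
rewrite ler_nat; case xS: (x \subset S) => //.
by rewrite (subset_trans xS sS).
Qed.

Lemma prod1B_ge (s : seq {set E}) S :
  1 - q * \sum_(y <- s) (y \subset S)%:R <= avoid s S.
Proof.
elim: s => [|y s IH]; first by rewrite /avoid !big_nil mulr0 subr0.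
rewrite /avoid !big_cons -/(avoid s S).
have := avoid_le1 s S; have := avoid_ge0 s S; have := IH.
set a := avoid s S; set b := \sum_(_ <- _) _; case: (y \subset S) => /= h a0 a1.
  by rewrite mulrDr mulr1; have := mulr_ge0 q0 (_ : 0 <= 1 - a); rewrite subr_ge0 => /(_ a1); lra.
by rewrite add0r mulr0 subr0 mul1r.
Qed.

Definition Psi L := Ex (avoid L).

Lemma Psi_ge0 L : 0 <= Psi L.
Proof. by apply: Ex_ge0 => S _; exact: avoid_ge0. Qed.

(* The Boppana-Spencer step, applied to the events [x \subset S] each kept with
   an independent coin of bias [q]. *)
Lemma Psi_cons x L : x \subset B -> all (fun y : {set E} => y \subset B) L ->
  Psi (x :: L) <=
  (1 - q * p ^+ #|x| + q ^+ 2 * \sum_(y <- L | ~~ [disjoint x & y]) p ^+ #|x :|: y|) * Psi L.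
Proof.
move=> xB LB.
set D := [seq y : {set E} <- L | ~~ [disjoint x & y]].
set I := [seq y : {set E} <- L | [disjoint x & y]].
set f := avoid I.
have splitL S : avoid L S = avoid D S * f S.
  rewrite /avoid /f /avoid !big_filter (bigID (fun y : {set E} => [disjoint x & y])) /=.
  exact: mulrC.
have fx S : f (S :|: x) = f S.
  apply: eq_big_seq => y; rewrite mem_filter => /andP[dxy _].
  congr (1 - q * (nat_of_bool _)%:R); apply/subsetP/subsetP => h z zy.
    have := h _ zy; rewrite inE => /orP[//|zx].
    by rewrite (disjointFr dxy zx) in zy.
  by rewrite inE h.
have PsiLf : Psi L <= Ex f.
  apply: Ex_le => S _; rewrite splitL ler_piMl ?avoid_ge0 ?avoid_le1 //.
set sg := \sum_(y <- L | _) _.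
(* Conditioning on [x] does not affect the members disjoint from [x]; those meeting [x] are paid for
   by a union bound together with antitonicity. A negative bracket makes the claim trivial. *)
have key : (p ^+ #|x| - q * sg) * Psi L <= Ex (fun S => (x \subset S)%:R * avoid L S).
  have [neg|pos] := ltP (p ^+ #|x| - q * sg) 0.
    apply: (@le_trans _ _ 0); first by rewrite mulr_le0_ge0 ?Psi_ge0 // ltW.
    by apply: Ex_ge0 => S _; rewrite mulr_ge0 ?avoid_ge0.
  apply: (@le_trans _ _ ((p ^+ #|x| - q * sg) * Ex f)); first exact: ler_wpM2l.
  apply: (@le_trans _ _ (Ex (fun S => (x \subset S)%:R * f S
      - q * \sum_(y <- D) ((x :|: y) \subset S)%:R * f S))).
    rewrite ExB ExZ Ex_cond_indep // mulrBl lerB // -mulrA ler_wpM2l //.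
    rewrite Ex_sum /D big_filter /sg mulr_suml big_seq_cond [leRHS]big_seq_cond.
    apply: ler_sum => y /andP[yL _].
    apply: Ex_cond_antitone; first by rewrite subUset xB (allP LB).
    exact: avoid_antitone.
  apply: Ex_le => S _; rewrite splitL mulrA.
  rewrite (eq_bigr (fun y : {set E} => (x \subset S)%:R * ((y \subset S)%:R * f S))); last first.
    by move=> y _; rewrite subUset -mulnb natrM mulrA.
  rewrite -mulr_sumr -mulr_suml.
  case: (x \subset S); rewrite ?mul0r ?mul1r ?mulr0 ?subr0 //.
  rewrite mulrA -{1}[f S]mul1r -mulrBl ler_wpM2r ?avoid_ge0 //.
  exact: prod1B_ge.
have -> : Psi (x :: L) = Psi L - q * Ex (fun S => (x \subset S)%:R * avoid L S).
  rewrite /Psi -ExZ -ExB; apply: eq_Ex => S _.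
  by rewrite /avoid big_cons mulrBl mul1r mulrA.
have := ler_wpM2l q0 key; rewrite -subr_ge0 => h; rewrite -subr_ge0.
by apply: le_trans h _; rewrite le_eqVlt; apply/orP; left; apply/eqP; ring.
Qed.

(** Iterates [Psi_cons], starting from the end of [s]. Each index is charged for its overlaps with
    all others, although only those already added occur; this makes the exponent independent of the
    order. *)
Lemma Psi_cat (I : eqType) (A : I -> {set E}) (s : seq I) L :
  uniq s -> (forall i, i \in s -> A i \subset B) ->
  all (fun y : {set E} => y \subset B) L ->
  Psi (map A s ++ L) <= Psi L * expR (\sum_(i <- s) (- q * p ^+ #|A i| + q ^+ 2 *
    (\sum_(j <- s | (j != i) && ~~ [disjoint A i & A j]) p ^+ #|A i :|: A j| +
     \sum_(y <- L | ~~ [disjoint A i & y]) p ^+ #|A i :|: y|))).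
Proof.
move=> us AB LB.
pose G i := - q * p ^+ #|A i| + q ^+ 2 *
    (\sum_(j <- s | (j != i) && ~~ [disjoint A i & A j]) p ^+ #|A i :|: A j| +
     \sum_(y <- L | ~~ [disjoint A i & y]) p ^+ #|A i :|: y|).
suff: forall t, (exists u, s = u ++ t) ->
    Psi (map A t ++ L) <= Psi L * expR (\sum_(i <- t) G i).
  by apply; exists [::].
elim=> [|i t IH] [u su]; first by rewrite big_nil expR0 mulr1.
rewrite big_cons [G i + _]addrC expRD mulrA.
have ut : exists u, s = u ++ t by exists (rcons u i); rewrite cat_rcons.
apply: le_trans (ler_wpM2r (expR_ge0 _) (IH ut)).
rewrite mulrC /=; apply: le_trans (Psi_cons _ _) _.
- by apply: AB; rewrite su mem_cat inE eqxx orbT.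
- rewrite all_cat LB andbT; apply/allP => _ /mapP[j jt ->]; apply: AB.
  by rewrite su mem_cat inE jt !orbT.
rewrite mulrC [leRHS]mulrC ler_wpM2l ?Psi_ge0 //; apply: le_trans (expR_ge1Dx _).
rewrite -addrA lerD2l /G mulNr lerD2l ler_wpM2l ?exprn_ge0 //.
rewrite big_cat big_map /= lerD2r su big_cat big_cons eqxx /=.
apply: ler_wpDl; first by apply: sumr_ge0 => j _; rewrite exprn_ge0.
rewrite big_mkcond [leRHS]big_mkcond le_eqVlt; apply/orP; left; apply/eqP.
apply: eq_big_seq => j jt; have -> // : j != i.
apply: contraTneq us => ji; rewrite su cat_uniq /= -ji jt /= !andbF //.
Qed.
End Janson.

End ProductMeasure.

(** * From the binomial random set to sets of fixed size *)

Section Transfer.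
Variables (R : realType) (E : finType) (B : {set E}) (Q : pred {set E}).
Hypothesis Qdown : forall S S' : {set E}, S \subset S' -> Q S' -> Q S.

Definition level k := [set S : {set E} | [&& S \subset B, #|S| == k & Q S]].

(** Local LYM inequality: double count the pairs of a member of the upper level and an element
    removed from it; the remaining set still has the decreasing property. *)
Lemma level_shadow k : (#|level k.+1| * k.+1 <= #|level k| * (#|B| - k))%N.
Proof.
have -> : (#|level k.+1| * k.+1 =
    \sum_(S in level k.+1) \sum_(e in B | e \in S) 1)%N.
  rewrite -sum_nat_const; apply: eq_bigr => S.
  rewrite inE sum1_card => /and3P[sSB /eqP <- _].
  apply: eq_card => e; rewrite unfold_in /=; apply/idP/andP => [eS|[]//]; split=> //.
  exact: (subsetP sSB).
have -> : (#|level k| * (#|B| - k) =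
    \sum_(S in level k) \sum_(e in B | e \notin S) 1)%N.
  rewrite -sum_nat_const; apply: eq_bigr => S.
  rewrite inE sum1_card => /and3P[sSB /eqP <- _].
  rewrite -cardsDS //; apply: eq_card => e; rewrite !inE [RHS]unfold_in /= andbC //.
rewrite !(exchange_big_dep (mem B)) /=; try by move=> ? ? _ /andP[].
apply: leq_sum => e eB; rewrite !sum1_card.
rewrite -(card_in_imset (f := fun S : {set E} => S :\ e)); last first.
  move=> S S'; rewrite !unfold_in /= => /andP[_ /andP[_ eS]] /andP[_ /andP[_ eS']] h.
  by rewrite -(finset.setD1K eS) h finset.setD1K.
apply/subset_leq_card/subsetP => _ /imsetP[S + ->].
rewrite [S \in _]unfold_in => /and3P[+ _ eS].
rewrite inE => /and3P[sSB Sk QS].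
rewrite [S :\ e \in _]unfold_in eB inE setD11 andbT.
rewrite (Qdown _ QS) ?subsetDl // (subset_trans (subsetDl _ _) sSB) /=.
by move: Sk; rewrite (cardsD1 e S) eS add1n eqSS => ->.
Qed.

Lemma level_ratio j k : (j <= k)%N -> (k <= #|B|)%N ->
  (#|level k| * 'C(#|B|, j) <= #|level j| * 'C(#|B|, k))%N.
Proof.
move=> jk; elim: k jk => [|k IH]; first by rewrite leqn0 => /eqP->.
rewrite leq_eqVlt => /orP[/eqP->//|]; rewrite ltnS => jk kB.
have {}IH := IH jk (ltnW kB).
have h1 := level_shadow k.
have h2 := mul_bin_left #|B| k.
rewrite -(leq_pmul2l (ltn0Sn k)) mulnA [(k.+1 * _)%N]mulnC.
apply: leq_trans (leq_mul h1 (leqnn _)) _.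
rewrite mulnAC [leqRHS]mulnCA h2 [((#|B| - k) * _)%N]mulnC mulnA.
by rewrite leq_mul2r IH orbT.
Qed.

Variables (p zeta : R) (k : nat).
Hypotheses (p0 : 0 <= p) (p1 : p <= 1) (z1 : zeta <= 1) (kB : (k <= #|B|)%N)
  (kp : #|B|%:R * p <= (1 - zeta) * k%:R).

(** Markov's inequality suffices, because a loss by the constant factor [zeta^-1] is affordable. *)
Lemma bin_tail : zeta <= \sum_(S : {set E} | (S \subset B) && (#|S| <= k)%N) bern B p S.
Proof.
have h1 := Ex1 B p.
have hm : Ex B p (fun S => #|S|%:R) = #|B|%:R * p.
  transitivity (Ex B p (fun S => \sum_(e <- enum B) (e \in S)%:R * 1)).
    apply: eq_Ex => S sSB; rewrite big_enum_cond /= -sum1_card natr_sum.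
    rewrite [RHS](bigID (fun e => e \in S)) /= [X in _ = _ + X]big1 ?addr0; last first.
      by move=> e /andP[_ /negPf->]; rewrite mul0r.
    rewrite (eq_bigl (fun e => (e \in B) && (e \in S))); last first.
      by move=> e; case eS: (e \in S); rewrite ?andbF ?andbT // (subsetP sSB).
    by apply: eq_big => e; rewrite ?andbT // => /andP[_ ->]; rewrite mul1r.
  rewrite Ex_sum big_enum_cond /= (eq_bigr (fun=> p)); last first.
    by move=> e; rewrite andbT => eB; rewrite Ex_cond1 // Ex1 mulr1.
  by rewrite (eq_bigl (mem B)) ?sumr_const ?mulr_natl // => e; rewrite andbT.
have : (\sum_(S : {set E} | (S \subset B) && ~~ (#|S| <= k)%N) bern B p S) * k.+1%:R
    <= #|B|%:R * p.
  rewrite -hm /Ex [leRHS](bigID (fun S : {set E} => (#|S| <= k)%N)) /= mulr_suml.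
  apply: ler_wpDl; first by apply: sumr_ge0 => S _; rewrite mulr_ge0 ?bern_ge0.
  apply: ler_sum => S /andP[_]; rewrite -ltnNge => h.
  by rewrite ler_wpM2l ?bern_ge0 // ler_nat.
move: h1; rewrite /Ex (bigID (fun S : {set E} => (#|S| <= k)%N)) /=.
under eq_bigr do rewrite mulr1; under [X in _ + X]eq_bigr do rewrite mulr1.
set a := \sum_(_ | _) _; set b := \sum_(_ | _) _ => ab hb.
have {}hb : b * k.+1%:R <= (1 - zeta) * k.+1%:R.
  apply: le_trans hb _; apply: le_trans kp _; rewrite ler_wpM2l ?ler_nat //.
  by rewrite subr_ge0.
move: hb; rewrite ler_pM2r ?ltr0n // => hb; lra.
Qed.

(* Restates a probability as a count: below level [k] the density of a decreasing property
   only decreases, and the random set has at most [k] elements with probability [zeta]. *)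
Lemma level_transfer :
  zeta * #|level k|%:R <= 'C(#|B|, k)%:R * Ex B p (fun S => (Q S)%:R).
Proof.
have bk : 0 < 'C(#|B|, k)%:R :> R by rewrite ltr0n bin_gt0.
apply: le_trans (ler_wpM2r (ler0n _ _) bin_tail) _.
pose w j : R := p ^+ j * (1 - p) ^+ (#|B| - j).
have w0 j : 0 <= w j by rewrite mulr_ge0 ?exprn_ge0 // subr_ge0.
have -> : \sum_(S : {set E} | (S \subset B) && (#|S| <= k)%N) bern B p S =
   \sum_(j < #|B|.+1 | (j <= k)%N) 'C(#|B|, j)%:R * w j.
  rewrite big_mkcondr /= (@sum_subset_card R E B (fun j => if (j <= k)%N then w j else 0)).
  by rewrite [RHS]big_mkcond; apply: eq_bigr => j _; case: ifP => //; rewrite mulr0.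
have -> : Ex B p (fun S => (Q S)%:R) = \sum_(j < #|B|.+1) w j * #|level j|%:R.
  rewrite /Ex (partition_big (fun S : {set E} => inord #|S| : 'I_#|B|.+1) xpredT) //=.
  apply: eq_bigr => j _; rewrite -[#|level j|]sum1_card natr_sum mulr_sumr.
  rewrite [RHS](eq_bigl (fun S : {set E} => ((S \subset B) && (inord #|S| == j)) && Q S)); last first.
    move=> S; rewrite inE andbA; case: (boolP (S \subset B)) => //= sSB.
    by rewrite -val_eqE /= inordK // ltnS subset_leq_card.
  rewrite [RHS]big_mkcondr /=; apply: eq_bigr => S /andP[sSB /eqP <-].
  by rewrite inordK ?ltnS ?subset_leq_card // /w /bern; case: (Q S); rewrite ?mulr0.
rewrite mulr_suml mulr_sumr [leRHS](bigID (fun j : 'I__ => (j <= k)%N)) /=.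
apply: ler_wpDr; first by apply: sumr_ge0 => j _; rewrite mulr_ge0 // mulr_ge0.
apply: ler_sum => j jk; rewrite mulrAC [leRHS]mulrCA [leLHS]mulrC ler_wpM2l //.
by rewrite -!natrM ler_nat mulnC [leqRHS]mulnC level_ratio.
Qed.

End Transfer.

Lemma count_avoid (R : realType) (E : finType) (B : {set E}) (L : seq {set E})
    (p q zeta : R) (k : nat) :
  0 <= p -> p <= 1 -> 0 <= q -> q <= 1 -> 0 < zeta -> zeta <= 1 -> (k <= #|B|)%N ->
  #|B|%:R * p <= (1 - zeta) * k%:R ->
  #|[set S : {set E} | [&& S \subset B, #|S| == k &
      all (fun x : {set E} => ~~ (x \subset S)) L]]|%:R <=
  zeta^-1 * 'C(#|B|, k)%:R * Psi B p q L.
Proof.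
move=> p0 p1 q0 q1 z0 z1 kB kp.
rewrite -mulrA ler_pdivlMl //.
have dQ (S S' : {set E}) : S \subset S' -> all (fun x : {set E} => ~~ (x \subset S')) L ->
    all (fun x : {set E} => ~~ (x \subset S)) L.
  move=> sS /allP h; apply/allP => x /h; apply: contra => xS; exact: subset_trans sS.
apply: le_trans (level_transfer dQ p0 p1 z1 kB kp) _.
rewrite ler_wpM2l //; apply: Ex_le => // S _.
case: allP => [h|_]; last exact: avoid_ge0.
rewrite /avoid big_seq big1 // => x /h /negPf ->; by rewrite mulr0 subr0.
Qed.

Lemma card_ffun_hits (I A : finType) (D : {set I}) (g : I -> A) (B : I -> {set A}) (b k : nat) :
  (forall j, #|B j| <= b)%N ->
  (#|[set f : {ffun I -> A} | [forall j, (j \notin D) ==> (f j == g j)] &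
       #|[set j in D | f j \in B j]| == k]| <= 'C(#|D|, k) * (b ^ k * #|A| ^ (#|D| - k)))%N.
Proof.
move=> Bb; rewrite -sum1_card.
rewrite (partition_big (fun f : {ffun I -> A} => [set j in D | f j \in B j])
  (fun J => J \in [set J : {set I} | J \subset D & #|J| == k])); last first.
  by move=> f; rewrite !inE => /andP[_ ->]; rewrite andbT; apply/subsetP => j; rewrite inE => /andP[].
rewrite -cards_draws -sum_nat_const; apply: leq_sum => J; rewrite inE => /andP[JD /eqP Jk].
pose F j := if j \in D then if j \in J then B j else [set: A] else [set g j].
rewrite sum1_card; apply: (@leq_trans #|family (fun j => mem (F j))|).
  apply/subset_leq_card/subsetP => f; rewrite unfold_in inE => /andP[/andP[/forallP h _] /eqP fJ].
  apply/familyP => j; rewrite /F; case: ifP => jD; last first.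
    by have := h j; rewrite jD inE.
  by rewrite -fJ !inE jD /=; case: ifP => //; rewrite inE.
rewrite card_family foldrE big_map big_enum /=.
rewrite (bigID (mem J)) /=; apply: leq_mul.
  rewrite -Jk -prod_nat_const; apply: leq_prod => j jJ.
  by rewrite /F (subsetP JD) // jJ.
rewrite (bigID (mem D)) /= [X in (_ * X)%N]big1 ?muln1; last first.
  by move=> j /andP[_ /negPf jD]; rewrite /F jD cards1.
rewrite -Jk -cardsDS // -prod_nat_const.
rewrite (eq_bigl (fun j => j \in D :\: J)); last by move=> j; rewrite inE.
by apply: leq_prod => j; rewrite inE => /andP[/negPf jJ jD]; rewrite /F jD jJ cardsT.
Qed.

(** Prevents truncation of the exponents [Ee.*2 - x k] in [transv_sum_le]. *)
Lemma bin2_le_double r k : (0 < r)%N -> (k <= r)%N -> ('C(k, 2) <= ('C(r.+1, 2).-1).*2)%N.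
Proof.
move=> r0 kr; have := leq_bin2l 2 kr; rewrite binS bin1 => h.
by apply: leq_trans h _; move: 'C(r, 2) => c; lia.
Qed.

(** * Copies of a clique minus an inner edge *)

Section Cliques.
Variables (n r : nat) (P : labelling n r).
Implicit Types (e K : {set 'I_n}) (tau : {ffun 'I_r -> 'I_n}).

(* [EP] is the edge set of the complete multipartite graph of the partition, [IP] the set of
   pairs inside the parts; a [valid] tuple has its [j]-th entry in part [j]. *)
Definition EP : graph n := [set e : {set 'I_n} | (#|e| == 2%N) &&
      [forall u in e, forall v in e, (u != v) ==> (P u != P v)]].
Definition IP : graph n := [set e : {set 'I_n} | (#|e| == 2%N) && (e \notin EP)].
Definition EK K := [set e in EP | e \subset K].
Definition valid tau := [forall j, P (tau j) == j].
Definition im tau : {set 'I_n} := [set tau j | j : 'I_r].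

Lemma EK_sub K : EK K \subset EP.
Proof. by apply/subsetP => e; rewrite inE => /andP[]. Qed.

Lemma EKI K K' : EK K :&: EK K' = EK (K :&: K').
Proof. by apply/setP => e; rewrite in_setI ![e \in EK _]inE subsetI; case: (e \in EP). Qed.

Lemma card_EK_le K : (#|EK K| <= 'C(#|K|, 2))%N.
Proof.
rewrite -cards_draws; apply/subset_leq_card/subsetP => e.
by rewrite !inE => /andP[/andP[-> _] ->].
Qed.

Lemma card_EK_lt K e : e \in IP -> e \subset K -> (#|EK K| <= 'C(#|K|, 2).-1)%N.
Proof.
rewrite inE => /andP[e2 eN] eK.
have : (#|e |: EK K| <= 'C(#|K|, 2))%N.
  rewrite -cards_draws; apply/subset_leq_card/subsetP => f.
  by rewrite !inE => /orP[/eqP->|/andP[/andP[-> _] ->]//]; rewrite eK e2.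
by rewrite cardsU1 inE (negPf eN) /= add1n => h; rewrite -ltnS (leq_trans h) // leqSpred.
Qed.

Lemma IPP e : e \in IP -> forall u v, u \in e -> v \in e -> P u = P v.
Proof.
rewrite !inE => /andP[/[dup] /cards2P[a [b [ab ->]]] -> /=] /forall_inPn[x xe].
move=> /forall_inPn[y ye]; rewrite negb_imply negbK => /andP[xy /eqP xyP].
have : P a = P b.
  move: xe ye xy xyP; rewrite !inE => /orP[]/eqP-> /orP[]/eqP->; rewrite ?eqxx //.
by move=> h u v; rewrite !inE => /orP[]/eqP-> /orP[]/eqP->.
Qed.

Lemma valid_inj tau : valid tau -> injective tau.
Proof. by move=> /forallP h i j ij; rewrite -(eqP (h i)) -(eqP (h j)) ij. Qed.

Lemma validE tau j : valid tau -> P (tau j) = j.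
Proof. by move/forallP => /(_ j) /eqP. Qed.

Lemma card_im tau : valid tau -> #|im tau| = r.
Proof. by move=> transv; rewrite card_imset ?card_ord //; exact: valid_inj. Qed.

Lemma card_EK_im tau : valid tau -> #|EK (im tau)| = 'C(r, 2).
Proof.
move=> transv; rewrite -[in RHS](card_im transv) -cards_draws; apply: eq_card => e.
rewrite !inE andbC; case: (boolP (e \subset im tau)) => //= es.
case: (#|e| == 2%N) => //=; apply/forall_inP => u ue; apply/forall_inP => v ve.
move: (subsetP es _ ue) (subsetP es _ ve) => /imsetP[i _ ->] /imsetP[j _ ->].
by rewrite !validE //; apply/implyP; apply: contraNneq => ->.
Qed.

Definition Kf e tau := e :|: im tau.

Lemma card_Kf e tau j : e \in IP -> valid tau -> tau j \in e -> #|Kf e tau| = r.+1.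
Proof.
move=> eI transv te; rewrite /Kf cardsU card_im //.
have -> : e :&: im tau = [set tau j].
  apply/setP => v; rewrite !inE; apply/andP/eqP => [[ve /imsetP[i _ vi]]|->]; last first.
    by rewrite te imset_f.
  have : P v = P (tau j) by apply: (IPP eI).
  by rewrite vi !validE // => ->.
move: eI; rewrite inE => /andP[/eqP-> _]; rewrite cards1; lia.
Qed.

Lemma Kf_pair e tau j (f : {set 'I_n}) : e \in IP -> valid tau -> tau j \in e ->
  f \subset Kf e tau -> #|f| = 2 -> f != e -> f \in EP.
Proof.
move=> eI transv te fs f2 fe; rewrite inE f2 /=.
apply/forall_inP => u uf; apply/forall_inP => v vf.
apply/implyP => uv; apply/eqP => uvP.
have fE : f = [set u; v].
  by apply/esym/eqP; rewrite eqEcard subUset !sub1set uf vf /= f2 cards2 uv.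
move: (subsetP fs _ uf) (subsetP fs _ vf); rewrite !inE.
have h x y : x \in e -> y \in im tau -> P x = P y -> y \in e.
  move=> xe /imsetP[i _ ->]; rewrite validE // => xi.
  suff -> : i = j by [].
  by rewrite -xi (IPP eI xe te) validE.
have e2 : (#|e| <= #|f|)%N by move: eI; rewrite inE f2 => /andP[/eqP-> _].
have fe' : u \in e -> v \in e -> False.
  move=> ue ve; have : f == e by rewrite eqEcard e2 fE subUset !sub1set ue ve.
  by rewrite (negPf fe).
move=> /orP[ue|ui] /orP[ve|vi]; try by apply: fe'.
- by apply: fe' => //; apply: (h u).
- by apply: fe' => //; apply: (h v).
move: ui vi uvP uv => /imsetP[i _ ->] /imsetP[i' _ ->]; rewrite !validE // => ->.
by rewrite eqxx.
Qed.

Lemma card_EK_Kf e tau j : e \in IP -> valid tau -> tau j \in e ->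
  #|EK (Kf e tau)| = 'C(r.+1, 2).-1.
Proof.
move=> eI transv te; rewrite -(card_Kf eI transv te) -cards_draws.
set A := finset _; have eA : e \in A.
  by rewrite inE subsetUl; move: eI; rewrite inE => /andP[].
rewrite (cardsD1 e A) eA /=; apply: eq_card => f.
rewrite in_setD1 [f \in A]inE [f \in EK _]inE.
case: (altP (f =P e)) => [->|fe] /=; first by move: eI; rewrite inE => /andP[_ /negPf->].
rewrite andbC; case: (boolP (f \subset _)) => //= fs.
case: eqP => f2; first exact: Kf_pair te fs f2 fe.
by apply/negbTE; rewrite inE; case: eqP f2.
Qed.

Variables (R : realType) (p q : R).
Hypotheses (p0 : 0 < p) (p1 : p <= 1) (q0 : 0 <= q) (q1 : q <= 1).
Variable hd : {set 'I_n} -> 'I_n.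
Hypothesis hdP : forall e, e \in IP -> hd e \in e.

Local Notation Ee := ('C(r.+1, 2).-1).
Local Notation nR := (n%:R : R).

(* [hd e] is an end of [e]; a tuple of [transv e] has it as an entry, so that together with
   the other end it spans a clique minus [e]. *)
Definition transv e := [set tau | valid tau & tau (P (hd e)) == hd e].
Definition hits e K tau := #|[set j in [set~ P (hd e)] | tau j \in K]|.

Lemma Kf_transv e tau : e \in IP -> tau \in transv e -> tau (P (hd e)) \in e.
Proof. by move=> eI; rewrite inE => /andP[_ /eqP->]; exact: hdP. Qed.

(** The entry of [tau] in the part of the head is an end of [e] and is counted in [e :&: K];
    therefore [hits] leaves out this part. *)
Lemma card_KfI e tau K : e \in IP -> tau \in transv e ->
  #|K :&: Kf e tau| = (#|e :&: K| + hits e K tau)%N.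
Proof.
move=> eI te; have := Kf_transv eI te; move: te; rewrite inE => /andP[vt0 /eqP ht] hte.
rewrite /hits -(card_imset _ (valid_inj vt0)) -cardsUI.
set A := tau @: _.
have -> : K :&: Kf e tau = e :&: K :|: A.
  apply/setP => v; rewrite /Kf !inE.
  case vK: (v \in K); rewrite ?andbT ?andbF /=.
    case ve: (v \in e) => //=; apply/idP/idP => /imsetP[j]; last first.
      by rewrite !inE => /andP[_ _] ->; exact: imset_f.
    move=> _ vj; rewrite vj; apply: imset_f; rewrite !inE -vj vK andbT.
    by apply: contraFneq ve => jj; rewrite vj jj.
  by apply/esym/negbTE/imsetP => -[j]; rewrite !inE => /andP[_ jK] vj; rewrite vj jK in vK.
have -> : e :&: K :&: A = set0; last by rewrite cards0 addn0.
apply/setP => v; rewrite !inE; apply/negbTE/negP => /andP[/andP[ve _] /imsetP[j]].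
rewrite !inE => /andP[/eqP jh _] vj; apply: jh.
by rewrite -(IPP eI ve (hdP eI)) vj validE.
Qed.

Lemma card_transv_hits e K k : (#|K| <= r.+1)%N ->
  (#|[set tau in transv e | hits e K tau == k]| <= 'C(r.-1, k) * (r.+1 ^ k * n ^ (r.-1 - k)))%N.
Proof.
move=> Kr; have D1 : #|[set~ P (hd e)]| = r.-1 by rewrite cardsC1 card_ord.
have := @card_ffun_hits _ _ [set~ P (hd e)] (fun=> hd e) (fun=> K) r.+1 k (fun=> Kr).
rewrite D1 card_ord; apply: leq_trans; apply/subset_leq_card/subsetP => tau.
rewrite !inE => /andP[/andP[_ /eqP h] ->]; rewrite andbT; apply/forallP => j.
by rewrite !inE negbK; apply/implyP => /eqP->; rewrite h.
Qed.

(** The binomial sum of ['C(r.-1, k) * r.+1 ^ k]: the choices of the entries that hit a given copy,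
    and of the vertices hit. *)
Definition overlap_const : R := (r.+2%:R) ^+ r.-1.

(** Fixing [k] entries of the tuple saves a factor [n ^+ k], and sharing [x k] cross pairs gains
    [p ^- x k]. So the terms with [k] hits are smaller than the full sum [n ^+ r.-1 * p ^+ (2 Ee)]
    by the factor [n ^+ k * p ^+ x k], which is at least [Bd]. *)
Lemma transv_sum_le e K (S : pred nat) (x : nat -> nat) (Bd : R) :
  (#|K| <= r.+1)%N -> 0 < Bd ->
  (forall k, S k -> (k <= r.-1)%N -> (x k <= Ee.*2)%N /\ Bd <= nR ^+ k * p ^+ x k) ->
  \sum_(tau in transv e | S (hits e K tau)) p ^+ (Ee.*2 - x (hits e K tau)) <=
  p ^+ Ee * (nR ^+ r.-1 * p ^+ Ee) * overlap_const / Bd.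
Proof.
move=> Kr Bd0 H.
have hl tau : (hits e K tau < r.-1.+1)%N.
  rewrite ltnS; apply: leq_trans (_ : #|[set~ P (hd e)]| <= _)%N; last by rewrite cardsC1 card_ord.
  by apply/subset_leq_card/subsetP => j; rewrite inE => /andP[].
rewrite (partition_big (fun tau => Ordinal (hl tau)) (fun k : 'I_r.-1.+1 => S k)) /=; last first.
  by move=> tau /andP[].
apply: (@le_trans _ _ (\sum_(k < r.-1.+1 | S k) (p ^+ Ee * (nR ^+ r.-1 * p ^+ Ee)) / Bd *
   ('C(r.-1, k)%:R * r.+1%:R ^+ k))).
  apply: ler_sum => k Sk.
  have kr : (k <= r.-1)%N by rewrite -ltnS.
  have [xE xB] := H _ Sk kr.
  apply: (@le_trans _ _ (\sum_(tau in [set tau in transv e | hits e K tau == k]) p ^+ (Ee.*2 - x k))).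
    rewrite le_eqVlt; apply/orP; left; apply/eqP.
    rewrite [LHS](eq_bigl (fun tau => tau \in [set tau in transv e | hits e K tau == k])); last first.
      move=> tau; rewrite [in RHS]inE -andbA; case: (tau \in transv e) => //=.
      by rewrite -val_eqE /=; case: eqP => [->|]; rewrite ?andbF ?andbT //.
    by apply: eq_bigr => tau; rewrite inE => /andP[_ /eqP->].
  rewrite sumr_const -[leLHS]mulr_natr.
  apply: (@le_trans _ _ (p ^+ (Ee.*2 - x k) * ('C(r.-1, k) * (r.+1 ^ k * n ^ (r.-1 - k)))%:R)).
    by rewrite ler_wpM2l ?exprn_ge0 ?(ltW p0) // ler_nat card_transv_hits.
  have -> : p ^+ Ee * (nR ^+ r.-1 * p ^+ Ee) / Bd * ('C(r.-1, k)%:R * r.+1%:R ^+ k) =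
      p ^+ (Ee.*2 - x k) * ('C(r.-1, k) * (r.+1 ^ k * n ^ (r.-1 - k)))%:R *
      ((nR ^+ k * p ^+ x k) / Bd).
    rewrite !natrM !natrX.
    have -> : nR ^+ r.-1 = nR ^+ (r.-1 - k) * nR ^+ k by rewrite -exprD subnK.
    have : p ^+ Ee * p ^+ Ee = p ^+ (Ee.*2 - x k) * p ^+ x k.
      by rewrite -!exprD subnK // addnn.
    by move: (p ^+ Ee) => a h; rewrite [a * (_ * a)]mulrCA h; ring.
  rewrite ler_peMr ?mulr_ge0 ?exprn_ge0 ?(ltW p0) //.
  by rewrite ler_pdivlMr // mul1r.
rewrite -mulr_sumr [leRHS]mulrAC ler_wpM2l //.
  by rewrite divr_ge0 ?(ltW Bd0) // ?mulr_ge0 ?exprn_ge0 ?(ltW p0).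
rewrite /overlap_const -[r.+2%:R]natr1 addrC exprDn big_mkcond.
apply: ler_sum => k _; rewrite expr1n mul1r mulr_natl; case: ifP => // _.
Qed.

Lemma card_EKU e1 tau1 e2 tau2 : e1 \in IP -> e2 \in IP -> tau1 \in transv e1 -> tau2 \in transv e2 ->
  #|EK (Kf e1 tau1) :|: EK (Kf e2 tau2)| =
  (Ee.*2 - #|EK (Kf e1 tau1 :&: Kf e2 tau2)|)%N.
Proof.
move=> e1I e2I t1 t2; rewrite cardsU EKI -addnn.
rewrite !(card_EK_Kf _ _ (Kf_transv _ _)) //; [by move: t2; rewrite inE => /andP[]|].
by move: t1; rewrite inE => /andP[].
Qed.

Section U1.
Variables (T : graph n) (D : nat) (Q : R).
Hypotheses (inner : T \subset IP) (TD : forall v, (#|[set e in T | v \in e]| <= D)%N)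
  (n0 : (0 < n)%N) (Q0 : 0 < Q)
  (hQ : forall k, (0 < k)%N -> (k + 2 <= r)%N -> Q <= nR ^+ k * p ^+ ('C(k.+2, 2).-1))
  (h1 : forall k, (0 < k)%N -> (k + 1 <= r)%N -> nR * p <= nR ^+ k * p ^+ 'C(k.+1, 2))
  (h2 : forall k, (2 <= k)%N -> (k <= r)%N -> nR ^+ 2 * p <= nR ^+ k * p ^+ 'C(k, 2)).

Local Notation W := (p ^+ Ee * (nR ^+ r.-1 * p ^+ Ee) * overlap_const).

Definition clique_idx := [set i : {set 'I_n} * {ffun 'I_r -> 'I_n} | (i.1 \in T) && (i.2 \in transv i.1)].
Definition clique_list := [seq EK (Kf i.1 i.2) | i <- enum clique_idx].

Lemma W_ge0 : 0 <= W.
Proof. by rewrite !mulr_ge0 ?exprn_ge0 ?(ltW p0). Qed.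

(** The second inner edge has two, one or no ends in the first copy. With [k] hits the copies then
    share at most ['C(k.+2, 2) - 1], ['C(k.+1, 2)] or ['C(k, 2)] cross pairs, and the three terms on
    the right correspond to [hQ], [h1] and [h2]. *)
Lemma clique_overlap_sum e1 tau1 e2 : e1 \in T -> e2 \in T -> tau1 \in transv e1 ->
  \sum_(tau2 in transv e2 | ((e2, tau2) != (e1, tau1)) &&
     ~~ [disjoint EK (Kf e1 tau1) & EK (Kf e2 tau2)])
     p ^+ #|EK (Kf e1 tau1) :|: EK (Kf e2 tau2)| <=
  (e2 == e1)%:R * (W / Q) + #|e2 :&: Kf e1 tau1|%:R * (W / (nR * p)) + W / (nR ^+ 2 * p).
Proof.
move=> e1T e2T t1; have e1I := subsetP inner _ e1T; have e2I := subsetP inner _ e2T.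
have v1 : valid tau1 by move: t1; rewrite inE => /andP[].
set K1 := Kf e1 tau1; have K1r : #|K1| = r.+1 by apply: card_Kf (Kf_transv e1I t1).
have nR0 : 0 < nR by rewrite ltr0n.
have np0 : 0 < nR * p by rewrite mulr_gt0.
have n2p0 : 0 < nR ^+ 2 * p by rewrite mulr_gt0 // exprn_gt0.
have W0 := W_ge0.
have [a0 a1 a2] : [/\ 0 <= W / Q, 0 <= W / (nR * p) & 0 <= W / (nR ^+ 2 * p)].
  by rewrite !divr_ge0 // ltW.
have dep tau2 : tau2 \in transv e2 -> ~~ [disjoint EK K1 & EK (Kf e2 tau2)] ->
    exists2 f, f \in EP & f \subset K1 :&: Kf e2 tau2.
  move=> _; rewrite -setI_eq0 EKI => /set0Pn[f]; rewrite inE => /andP[fE fs]; by exists f.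
have depc tau2 : tau2 \in transv e2 -> ~~ [disjoint EK K1 & EK (Kf e2 tau2)] ->
    (2 <= #|e2 :&: K1| + hits e2 K1 tau2)%N.
  move=> t2 /(dep _ t2)[f fE /subset_leq_card]; rewrite card_KfI //.
  by move: fE; rewrite inE => /andP[/eqP-> _].
have wle (x : nat -> nat) (S : pred nat) :
   (forall tau2, tau2 \in transv e2 -> (e2, tau2) != (e1, tau1) ->
      ~~ [disjoint EK K1 & EK (Kf e2 tau2)] -> S (hits e2 K1 tau2) /\
      (#|EK (K1 :&: Kf e2 tau2)| <= x (hits e2 K1 tau2))%N) ->
   \sum_(tau2 in transv e2 | ((e2, tau2) != (e1, tau1)) &&
     ~~ [disjoint EK K1 & EK (Kf e2 tau2)]) p ^+ #|EK K1 :|: EK (Kf e2 tau2)| <=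
   \sum_(tau in transv e2 | S (hits e2 K1 tau)) p ^+ (Ee.*2 - x (hits e2 K1 tau)).
  move=> H; rewrite big_mkcondr [leRHS]big_mkcondr /=; apply: ler_sum => tau2 t2.
  case: ifP => [/andP[ne dp]|_]; last by case: ifP => // _; rewrite exprn_ge0 ?(ltW p0).
  have [-> hx] := H _ t2 ne dp; rewrite card_EKU // -/K1.
  by apply: ler_wiXn2l; rewrite ?(ltW p0) //; exact: leq_sub2l.
have a_le2 : (#|e2 :&: K1| <= 2)%N.
  apply: leq_trans (subset_leq_card (subsetIl _ _)) _.
  by move: e2I; rewrite inE => /andP[/eqP-> _].
have e22 : #|e2| = 2 by move: e2I; rewrite inE => /andP[/eqP-> _].
have Kl : (#|K1| <= r.+1)%N by rewrite K1r.
have r_gt0 : (0 < r)%N by apply: leq_ltn_trans (ltn_ord (P (hd e1))).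
have hr tau : (hits e2 K1 tau + 1 <= r)%N.
  rewrite -(prednK r_gt0) addn1 ltnS.
  apply: leq_trans (_ : #|[set~ P (hd e2)]| <= _)%N; last by rewrite cardsC1 card_ord.
  by apply/subset_leq_card/subsetP => j; rewrite inE => /andP[].
have EKle tau2 : tau2 \in transv e2 ->
    (#|EK (K1 :&: Kf e2 tau2)| <= 'C(#|e2 :&: K1| + hits e2 K1 tau2, 2))%N.
  by move=> t2; rewrite -card_KfI //; exact: card_EK_le.
have pr (k : nat) : (k <= r.-1)%N -> (k + 1 <= r)%N by move=> h; rewrite addn1 -(prednK r_gt0) ltnS.
move: a_le2; rewrite leq_eqVlt => /orP[/eqP a2E|].
  have e2K : e2 \subset K1.
    by apply/setIidPl/eqP; rewrite eqEcard subsetIl a2E e22.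
  (* The only pair inside a part that [K1] contains is [e1]. *)
  have e21 : e2 = e1.
    apply/eqP; apply: contraT => ne.
    have := Kf_pair e1I v1 (Kf_transv e1I t1) e2K e22 ne.
    by move: e2I; rewrite inE => /andP[_ /negPf->].
  have -> : (e2 == e1) = true by rewrite e21 eqxx.
  rewrite mul1r -addrA; apply: ler_wpDr; first by apply: addr_ge0 => //; apply: mulr_ge0.
  pose S k := (0 < k)%N && (k + 2 <= r)%N.
  apply: le_trans (wle (fun k => 'C(k.+2, 2).-1) S _) _ => [tau2 t2 ne dp|].
    have EKlt : (#|EK (K1 :&: Kf e2 tau2)| <= 'C((hits e2 K1 tau2).+2, 2).-1)%N.
      have -> : (hits e2 K1 tau2).+2 = #|K1 :&: Kf e2 tau2| by rewrite card_KfI // a2E add2n.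
      apply: (card_EK_lt e2I).
      by rewrite subsetI e2K subsetUl.
    split=> //; rewrite /S lt0n; apply/andP; split.
      (* Without a hit the common vertices are the ends of [e1], which span no cross pair. *)
      apply: contraNneq dp => h0; rewrite -setI_eq0 EKI -cards_eq0 -leqn0.
      by apply: leq_trans EKlt _; rewrite h0.
    rewrite leqNgt addn2 ltnS; apply: contraNN ne => rh.
    (* With [r - 1] hits the two copies have the same vertices; as the tuples also share the head,
       they coincide, and this pair is excluded. *)
    have K12 : K1 = Kf e2 tau2.
      have c2 : #|Kf e2 tau2| = r.+1.
        by apply: card_Kf (Kf_transv e2I t2) => //; move: t2; rewrite inE => /andP[].
      have cI : (r.+1 <= #|K1 :&: Kf e2 tau2|)%N by rewrite card_KfI // a2E add2n ltnS.
      have /eqP <- : K1 :&: Kf e2 tau2 == K1 by rewrite eqEcard subsetIl K1r.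
      by apply/eqP; rewrite eqEcard subsetIr c2.
    rewrite xpair_eqE e21 eqxx /=; apply/eqP/ffunP => j.
    have v2 : valid tau2 by move: t2; rewrite inE => /andP[].
    have : tau2 j \in K1 by rewrite K12 inE imset_f ?orbT.
    rewrite inE => /orP[je|/imsetP[i _ ji]]; last first.
      by rewrite ji; congr (tau1 _); rewrite -(validE j v2) ji validE.
    have jh : j = P (hd e1) by rewrite -(validE j v2) (IPP e1I je (hdP e1I)).
    move: t1 t2; rewrite e21 !inE => /andP[_ /eqP h3] /andP[_ /eqP h4].
    by rewrite jh h3 h4.
  apply: (@transv_sum_le e2 K1 S (fun k => 'C(k.+2, 2).-1)) => // k /andP[k0 k2] _; split; last exact: hQ.
  apply: leq_trans (leq_pred _) _; apply: bin2_le_double => //.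
  by rewrite addn2 in k2.
rewrite ltnS leq_eqVlt ltnS leqn0 => /orP[/eqP a1E|/eqP a0E].
  rewrite a1E mul1r addrAC; apply: ler_wpDl; first by apply: addr_ge0 => //; apply: mulr_ge0.
  apply: le_trans (wle (fun k => 'C(k.+1, 2)) (fun k => 0 < k)%N _) _ => [tau2 t2 ne dp|].
    by have := EKle _ t2; have := depc _ t2 dp; rewrite a1E add1n.
  apply: (@transv_sum_le e2 K1 (fun k => 0 < k)%N (fun k => 'C(k.+1, 2))) => // k k0 kr; have := pr _ kr =>
    kr1; split; last exact: h1.
  by apply: bin2_le_double => //; rewrite -addn1.
apply: ler_wpDl; first by apply: addr_ge0 => //; apply: mulr_ge0.
apply: le_trans (wle (fun k => 'C(k, 2)) (fun k => 1 < k)%N _) _ => [tau2 t2 ne dp|].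
  by have := EKle _ t2; have := depc _ t2 dp; rewrite a0E add0n.
apply: (@transv_sum_le e2 K1 (fun k => 1 < k)%N (fun k => 'C(k, 2))) => // k k0 kr; have := pr _ kr; rewrite
  addn1 => /ltnW kr1.
by split; [apply: bin2_le_double|apply: h2].
Qed.

(** Here the bounded degree of the core enters: few of its edges touch a given copy. *)
Lemma sum_deg_card (K : {set 'I_n}) :
  (\sum_(e in T) #|e :&: K| <= #|K| * D)%N.
Proof.
have -> : (\sum_(e in T) #|e :&: K| = \sum_(e in T) \sum_(v in K | v \in e) 1)%N.
  by apply: eq_bigr => e _; rewrite sum1_card; apply: eq_card => v; rewrite !inE andbC.
rewrite (exchange_big_dep (mem K)) /=; last by move=> ? ? _ /andP[].
rewrite -sum_nat_const; apply: leq_sum => v vK; rewrite sum1_card.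
apply: leq_trans (TD v); apply/subset_leq_card/subsetP => e.
by rewrite unfold_in inE => /and3P[-> _ ->].
Qed.

(** Without overlaps the exponent would be the mean number of kept copies, at least
    [#|T| * V * q * p ^+ Ee]; overlaps cost at most the fraction [eta1]. The bracket collects copies
    at the same edge, at edges touching the copy, and at all other edges of [T]. *)
Lemma Psi_clique_list_le (V eta1 : R) :
  (forall e, e \in T -> V <= #|transv e|%:R) -> eta1 <= 1 -> 0 <= V ->
  q * (nR ^+ r.-1 * p ^+ Ee) * overlap_const *
    (Q^-1 + r.+1%:R * D%:R / (nR * p) + #|T|%:R / (nR ^+ 2 * p)) <= eta1 ->
  Psi EP p q clique_list <= expR (- (#|T|%:R * (V * q * p ^+ Ee) * (1 - eta1))).
Proof.
move=> hV eta1_le1 V0 heta.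
have p0' := ltW p0.
have nR0 : 0 < nR by rewrite ltr0n.
have := @Psi_cat _ _ EP p p0' p1 q q0 q1 _ (fun i : {set 'I_n} * {ffun 'I_r -> 'I_n} => EK (Kf i.1 i.2)) (enum
  clique_idx) [::] (enum_uniq _).
rewrite cats0 => H; apply: le_trans (H _ _) _ => {H}; rewrite ?all_nil //.
  by move=> i _; exact: EK_sub.
have -> : Psi EP p q [::] = 1.
  rewrite -[RHS](Ex1 EP p); apply: eq_Ex => S _; by rewrite /avoid big_nil.
rewrite mul1r ler_expR big_enum /=.
apply: (@le_trans _ _ (\sum_(i in clique_idx) (- (q * p ^+ Ee * (1 - eta1))))).
  apply: ler_sum => -[e1 tau1]; rewrite inE /= => /andP[e1T t1].
  rewrite big_nil addr0 big_enum_cond /=.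
  have e1I := subsetP inner _ e1T.
  have v1 : valid tau1 by move: t1; rewrite inE => /andP[].
  rewrite (card_EK_Kf e1I v1 (Kf_transv e1I t1)).
  have -> : - (q * p ^+ Ee * (1 - eta1)) = - q * p ^+ Ee + q * p ^+ Ee * eta1 by ring.
  rewrite lerD2l.
  apply: (@le_trans _ _ (q ^+ 2 * \sum_(e2 in T) ((e2 == e1)%:R * (W / Q) + #|e2 :&: Kf e1 tau1|%:R * (W / (nR
    * p)) + W / (nR ^+ 2 * p)))).
    rewrite ler_wpM2l ?exprn_ge0 //.
    apply: (@le_trans _ _ (\sum_(e2 in T) \sum_(tau2 in transv e2 | ((e2, tau2) != (e1, tau1)) &&
     ~~ [disjoint EK (Kf e1 tau1) & EK (Kf e2 tau2)])
     p ^+ #|EK (Kf e1 tau1) :|: EK (Kf e2 tau2)|)); last first.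
      by apply: ler_sum => e2 e2T; exact: clique_overlap_sum.
    rewrite pair_big_dep /= le_eqVlt; apply/orP; left; apply/eqP.
    apply: eq_big => -[e2 tau2] //=; by rewrite inE /= -!andbA.
  rewrite !big_split /= sumr_const -!mulr_suml -[_ *+ #|T|]mulr_natl.
  have -> : \sum_(e2 in T) (e2 == e1)%:R = 1 :> R.
    rewrite (bigD1 e1) //= eqxx big1 ?addr0 // => e2 /andP[_ /negPf->] //.
  apply: (@le_trans _ _ (q ^+ 2 * (W / Q + r.+1%:R * D%:R * (W / (nR * p)) + #|T|%:R * (W / (nR ^+ 2 * p))))).
    rewrite ler_wpM2l ?exprn_ge0 // lerD2r mul1r lerD2l ler_wpM2r //.
      by rewrite divr_ge0 ?W_ge0 // ltW // mulr_gt0.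
    rewrite -natr_sum -natrM ler_nat -(card_Kf e1I v1 (Kf_transv e1I t1)).
    exact: sum_deg_card.
  apply: le_trans (ler_wpM2l (_ : 0 <= q * p ^+ Ee) heta); last by rewrite mulr_ge0 ?exprn_ge0.
  by rewrite le_eqVlt; apply/orP; left; apply/eqP; ring.
rewrite sumr_const -[leLHS]mulr_natl mulrN lerN2.
have -> : #|T|%:R * (V * q * p ^+ Ee) * (1 - eta1) = (#|T|%:R * V) * (q * p ^+ Ee * (1 - eta1)) by ring.
rewrite ler_wpM2r //; first by rewrite !mulr_ge0 ?exprn_ge0 // subr_ge0.
have -> : #|clique_idx|%:R = \sum_(e in T) (#|transv e|%:R : R).
  rewrite -natr_sum; congr (_%:R); rewrite -sum1_card.
  under [RHS]eq_bigr do rewrite -sum1_card.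
  rewrite pair_big_dep /=; apply: eq_bigl => -[e tau]; by rewrite inE.
by rewrite mulr_natl -sumr_const; apply: ler_sum.
Qed.
End U1.
End Cliques.

(** * Tuples with common entries *)

Section Agree.
Variables (R : realType) (r : nat) (A : finType) (p : R).
Hypotheses (p0 : 0 < p).

Definition agree (f g : {ffun 'I_r -> A}) := #|[set j | f j == g j]|.

Lemma card_agree (g : {ffun 'I_r -> A}) c :
  (#|[set f | agree f g == c]| <= 'C(r, c) * #|A| ^ (r - c))%N.
Proof.
have := @card_ffun_hits _ _ [set: 'I_r] g (fun j => [set g j]) 1 c.
rewrite cardsT card_ord exp1n mul1n => H; apply: leq_trans (H _); last by move=> j; rewrite cards1.
apply/subset_leq_card/subsetP => f; rewrite !inE => /eqP <-; apply/andP; split.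
  by apply/forallP => j; rewrite inE.
by apply/eqP; apply: eq_card => j; rewrite !inE.
Qed.

Lemma agree_le f g : (agree f g < r.+1)%N.
Proof. by rewrite ltnS -[leqRHS]card_ord max_card. Qed.

Lemma agree_sum (g : {ffun 'I_r -> A}) (S : pred nat) (Bd : R) : 0 < Bd ->
  (forall c, S c -> (c <= r)%N -> Bd <= #|A|%:R ^+ c * p ^+ 'C(c, 2)) ->
  \sum_(f | S (agree f g)) p ^+ ('C(r, 2) - 'C(agree f g, 2)) <=
  2 ^+ r * #|A|%:R ^+ r * p ^+ 'C(r, 2) / Bd.
Proof.
move=> Bd0 H.
rewrite (partition_big (fun f => Ordinal (agree_le f g)) (fun c : 'I_r.+1 => S c)) //=.
apply: (@le_trans _ _ (\sum_(c < r.+1 | S c) (#|A|%:R ^+ r * p ^+ 'C(r, 2) / Bd) * 'C(r, c)%:R)).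
  apply: ler_sum => c Sc; have cr : (c <= r)%N by rewrite -ltnS.
  apply: (@le_trans _ _ (\sum_(f in [set f | agree f g == c]) p ^+ ('C(r, 2) - 'C(c, 2)))).
    rewrite le_eqVlt; apply/orP; left; apply/eqP.
    rewrite [LHS](eq_bigl (fun f => f \in [set f | agree f g == c])); last first.
      by move=> f; rewrite [in RHS]inE -val_eqE /=; case: eqP => [->|]; rewrite ?andbF ?andbT.
    by apply: eq_bigr => f; rewrite inE => /eqP->.
  rewrite sumr_const -[leLHS]mulr_natr.
  apply: (@le_trans _ _ (p ^+ ('C(r, 2) - 'C(c, 2)) * ('C(r, c) * #|A| ^ (r - c))%:R)).
    by rewrite ler_wpM2l ?exprn_ge0 ?(ltW p0) // ler_nat card_agree.
  have xE : ('C(c, 2) <= 'C(r, 2))%N by exact: leq_bin2l.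
  have -> : #|A|%:R ^+ r * p ^+ 'C(r, 2) / Bd * 'C(r, c)%:R =
     p ^+ ('C(r, 2) - 'C(c, 2)) * ('C(r, c) * #|A| ^ (r - c))%:R *
      ((#|A|%:R ^+ c * p ^+ 'C(c, 2)) / Bd).
    rewrite !natrM !natrX.
    have -> : #|A|%:R ^+ r = #|A|%:R ^+ (r - c) * #|A|%:R ^+ c :> R by rewrite -exprD subnK.
    have -> : p ^+ 'C(r, 2) = p ^+ ('C(r, 2) - 'C(c, 2)) * p ^+ 'C(c, 2) by rewrite -exprD subnK.
    ring.
  rewrite ler_peMr ?mulr_ge0 ?exprn_ge0 ?(ltW p0) //.
  by rewrite ler_pdivlMr // mul1r H.
have -> : 2 ^+ r * #|A|%:R ^+ r * p ^+ 'C(r, 2) / Bd =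
  (#|A|%:R ^+ r * p ^+ 'C(r, 2) / Bd) * 2 ^+ r by ring.
rewrite -mulr_sumr ler_wpM2l ?divr_ge0 ?mulr_ge0 ?exprn_ge0 ?(ltW p0) ?(ltW Bd0) //.
rewrite (_ : 2 = 1 + 1) // exprDn big_mkcond.
by apply: ler_sum => c _; rewrite !expr1n mul1r; case: ifP.
Qed.

End Agree.

Lemma cardsE_sum (T : finType) (Q : pred T) : #|[set x | Q x]| = (\sum_x Q x)%N.
Proof. by rewrite -sum1dep_card big_mkcond; apply: eq_bigr => x _; case: (Q x). Qed.

(** * Tuples in large neighbourhoods *)

Section Shift.
Variables (R : realType) (r d' : nat) (V : finType).
Local Notation d := d'.+1.
Local Notation At := {ffun 'I_r -> {ffun 'I_d -> V}}.

Definition tup (a : At) (k : {ffun 'I_r -> 'I_d}) : {ffun 'I_r -> V} := [ffun j => a j (k j)].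

(** Addition is modulo [d], a successor so that ['I_d] is a cyclic group. For a fixed [s], the
    indices for all [l] use every entry of every row exactly once. *)
Definition shift_idx (s : {ffun 'I_r -> 'I_d}) (l : 'I_d) : {ffun 'I_r -> 'I_d} := [ffun j => s j + l].

Variable h : pred {ffun 'I_r -> V}.

Lemma sum_shift (a : At) :
  (\sum_(s : {ffun 'I_r -> 'I_d}) #|[set l | h (tup a (shift_idx s l))]| =
   d * #|[set k | h (tup a k)]|)%N.
Proof.
under eq_bigr do rewrite cardsE_sum.
rewrite exchange_big /= (eq_bigr (fun=> #|[set k | h (tup a k)]|)).
  by rewrite sum_nat_const card_ord.
move=> l _; rewrite cardsE_sum.
rewrite [RHS](reindex (fun s => shift_idx s l)) //=.
exists (fun s => [ffun j => s j - l]) => s _; apply/ffunP => j; rewrite !ffunE.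
  by rewrite addrK.
by rewrite subrK.
Qed.

(** For a fixed [s], an array is the same as [d] arbitrary tuples, one for each [l], so the
    exponential moment factorises. *)
Lemma shift_mgf (s : {ffun 'I_r -> 'I_d}) (lam : R) :
  \sum_(a : At) expR (lam * #|[set l | h (tup a (shift_idx s l))]|%:R) =
  (\sum_(t : {ffun 'I_r -> V}) expR (lam * (h t)%:R)) ^+ d.
Proof.
pose psi (b : {ffun 'I_d -> {ffun 'I_r -> V}}) : At := [ffun j => [ffun k => b (k - s j) j]].
pose phi (a : At) : {ffun 'I_d -> {ffun 'I_r -> V}} := [ffun l => tup a (shift_idx s l)].
have psiK : cancel psi phi.
  move=> b; apply/ffunP => l; apply/ffunP => j; rewrite !ffunE; congr (b _ j).
  by rewrite addrAC subrr add0r.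
have phiK : cancel phi psi.
  move=> a; apply/ffunP => j; apply/ffunP => k; rewrite !ffunE; congr (a j _).
  by rewrite addrCA subrr addr0.
rewrite (reindex psi) /=; last by exists phi => ? _.
have -> : (\sum_t expR (lam * (h t)%:R)) ^+ d =
    \prod_(l : 'I_d) (\sum_(t : {ffun 'I_r -> V}) expR (lam * (h t)%:R)).
  by rewrite prodr_const card_ord.
rewrite bigA_distr_bigA /=; apply: eq_bigr => b _.
rewrite -expR_sum -mulr_sumr; congr (expR (lam * _)).
rewrite cardsE_sum natr_sum; apply: eq_bigr => l _.
by have -> : tup (psi b) (shift_idx s l) = b l by rewrite -{2}(psiK b) ffunE.
Qed.

(* The tuples of an array [a] are split into the classes [shift_idx s], each consisting of [d] tuples
   without common entries, hence independent for a random array. *)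
Lemma shift_bad (lam kap : R) : 0 <= lam ->
  #|[set t | h t]|%:R <= kap * #|V|%:R ^+ r ->
  #|[set a : At | (d ^ r < 2 * #|[set k | h (tup a k)]|)%N]|%:R <=
  4 * (expR (- (lam / 4)) * (1 + kap * expR lam)) ^+ d * (#|V|%:R ^+ r) ^+ d.
Proof.
move=> lam0 hk.
pose X (a : At) s := #|[set l | h (tup a (shift_idx s l))]|.
have poor a s : (X a s <= d)%N by rewrite -[leqRHS]card_ord max_card.
have dr0 : 0 < (d ^ r)%:R :> R by rewrite ltr0n expn_gt0.
have cardS : #|{: {ffun 'I_r -> 'I_d}}| = (d ^ r)%N by rewrite card_ffun !card_ord.
(* Averaging: each index lies in [d] classes, so if more than half of all indices are bad, at least
   a quarter of the classes have at least [d / 4] bad members. The exponential moment counts such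
   classes. *)
have big_a (a : At) : (d ^ r < 2 * #|[set k | h (tup a k)]|)%N ->
    (d ^ r)%:R <= 4 * \sum_s expR (lam * ((X a s)%:R - d%:R / 4)).
  move=> ha; apply: (@le_trans _ _ (4 * #|[set s | (d <= 4 * X a s)%N]|%:R)).
    rewrite -natrM ler_nat -(leq_pmul2l (ltn0Sn d')).
    have : (\sum_s 4 * X a s <= \sum_(s : {ffun 'I_r -> 'I_d}) (4 * d * (d <= 4 * X a s) + d))%N.
      apply: leq_sum => s _; case: (leqP d (4 * X a s)) => h1; last by rewrite muln0 add0n ltnW.
      by rewrite muln1; have := poor a s; lia.
    rewrite -big_distrr /= sum_shift big_split /= -big_distrr /= -cardsE_sum.
    rewrite sum_nat_const cardS.
    move: ha; set c := #|[set k | _]|; set b := #|[set s | _]|; set D := (d ^ r)%N; nia.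
  rewrite ler_wpM2l // cardsE_sum natr_sum; apply: ler_sum => s _.
  case: (boolP (d <= 4 * X a s)%N) => h1; last exact: expR_ge0.
  have h2 : d%:R <= 4 * (X a s)%:R :> R by rewrite -natrM ler_nat.
  by rewrite -[true%:R]expR0 ler_expR mulr_ge0 // subr_ge0; lra.
rewrite -(ler_pM2l dr0).
apply: (@le_trans _ _ (\sum_(a : At) 4 * \sum_s expR (lam * ((X a s)%:R - d%:R / 4)))).
  rewrite cardsE_sum natr_sum mulr_sumr; apply: ler_sum => a _.
  case: ltnP => [/big_a|_]; first by rewrite mulr1.
  by rewrite mulr0 mulr_ge0 // sumr_ge0 // => s _; exact: expR_ge0.
rewrite -mulr_sumr exchange_big /=.
rewrite (eq_bigr (fun=> expR (- (lam / 4)) ^+ d *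
   (\sum_(t : {ffun 'I_r -> V}) expR (lam * (h t)%:R)) ^+ d)); last first.
  move=> s _; rewrite -(shift_mgf s) mulr_sumr; apply: eq_bigr => a _.
  rewrite -expRM_natr -expRD; congr expR; rewrite /X; by field.
rewrite sumr_const cardT -cardE cardS -[X in 4 * X]mulr_natl.
rewrite [leLHS]mulrCA ler_wpM2l ?(ltW dr0) //.
rewrite -mulrA ler_wpM2l // exprMn -!mulrA ler_wpM2l ?exprn_ge0 ?expR_ge0 // -exprMn.
have s0 : 0 <= \sum_(t : {ffun 'I_r -> V}) expR (lam * (h t)%:R).
  by apply: sumr_ge0 => t _; exact: expR_ge0.
suff le1 : \sum_(t : {ffun 'I_r -> V}) expR (lam * (h t)%:R) <= (1 + kap * expR lam) * #|V|%:R ^+ r.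
  by rewrite lerXn2r // nnegrE ?(le_trans s0).
apply: (@le_trans _ _ (\sum_(t : {ffun 'I_r -> V}) (1 + (h t)%:R * expR lam))).
  apply: ler_sum => t _; case: (h t); rewrite ?mulr1 ?mul1r ?mulr0 ?mul0r ?expR0 ?addr0 //.
  by rewrite lerDr.
rewrite big_split /= -mulr_suml sumr_const cardT -cardE card_ffun card_ord natrX.
rewrite mulrDl mul1r lerD2l -natr_sum -cardsE_sum mulrAC ler_wpM2r ?expR_ge0 //.
Qed.
End Shift.

Lemma compl_gt_half x y z : (x + y = z -> 2 * x < z -> z < 2 * y)%N.
Proof. lia. Qed.

Section U2.
Variables (R : realType) (n r d' : nat) (P : labelling n r) (p q : R).
Hypotheses (p0 : 0 < p) (p1 : p <= 1) (q0 : 0 <= q) (q1 : q <= 1).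
Local Notation d := d'.+1.
Local Notation nR := (n%:R : R).
Local Notation At := {ffun 'I_r -> {ffun 'I_d -> 'I_n}}.
Local Notation tT := {ffun 'I_r -> 'I_n}.
Local Notation C2 := ('C(r, 2)).
Implicit Types (L : seq tT) (a : At) (t : tT).

Definition cross_edges t := EK P (im t).
Definition valid_array a := [forall j, (injectiveb (a j)) && [forall k, P (a j k) == j]].
(** For valid tuples, the expected number of members of [L] with at least two entries in common with
    [t] that span cliques, given that [t] does. *)
Definition overlap L t : R := \sum_(t' <- L | (2 <= agree t t')%N) p ^+ (C2 - 'C(agree t t', 2)).

Variables (G0 O0 : R).

Definition good_idx a L := [set k | overlap L (tup a k) <= G0].
(* The tuples of an array are kept only if at least half of them overlap little with the tuples
   kept before; an array for which this fails is rare. *)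
Fixpoint greedy (s : seq At) : seq tT :=
  if s is a :: s' then
    if (d ^ r <= 2 * #|good_idx a (greedy s')|)%N
    then [seq tup a k | k <- enum (good_idx a (greedy s'))] ++ greedy s' else greedy s'
  else [::].

Lemma valid_tup a k : valid_array a -> valid P (tup a k).
Proof.
move=> /forallP h; apply/forallP => j; rewrite ffunE.
by have /andP[_ /forallP] := h j; apply.
Qed.

Lemma agree_tup a k k' : valid_array a -> agree (tup a k) (tup a k') = agree k k'.
Proof.
move=> /forallP h; apply: eq_card => j; rewrite !inE !ffunE.
by have /andP[/injectiveP inj _] := h j; rewrite (inj_eq inj).
Qed.

Lemma size_greedy s : (size (greedy s) <= size s * d ^ r)%N.
Proof.
elim: s => //= a s IH; case: ifP => _; last by apply: leq_trans IH _; rewrite mulSn leq_addl.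
rewrite size_cat size_map mulSn leq_add // -cardE.
by apply: leq_trans (max_card _) _; rewrite card_ffun !card_ord.
Qed.

Lemma greedyP s t : t \in greedy s -> exists2 a, a \in s & exists k, t = tup a k.
Proof.
elim: s => //= a s IH.
have H : t \in greedy s -> exists2 a0, a0 \in a :: s & exists k, t = tup a0 k.
  by move=> /IH[b bs hb]; exists b => //; rewrite inE bs orbT.
case: ifP => _ //; rewrite mem_cat => /orP[|//] /mapP[k _ ->].
by exists a; [rewrite inE eqxx|exists k].
Qed.

(** Valid tuples can share a vertex only in the same position, so common vertices are common
    entries. *)
Lemma cross_edges_overlap t t' : valid P t -> valid P t' -> ~~ [disjoint cross_edges t & cross_edges t'] ->
  (2 <= agree t t')%N /\ p ^+ #|cross_edges t :|: cross_edges t'| <= p ^+ C2 * p ^+ (C2 - 'C(agree t t', 2)).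
Proof.
move=> transv vt'; rewrite -setI_eq0 /cross_edges EKI => /set0Pn[e].
have cI : (#|im t :&: im t'| <= agree t t')%N.
  rewrite /agree -(card_imset _ (valid_inj transv)); apply/subset_leq_card/subsetP => v.
  rewrite inE => /andP[/imsetP[j _ ->] /imsetP[j' _ jj]]; apply: imset_f; rewrite inE.
  by rewrite {1}jj; have := congr1 P jj; rewrite !(validE _ transv) !(validE _ vt') => ->.
rewrite inE => /andP[eE /subset_leq_card es]; split.
  by apply: leq_trans cI; apply: leq_trans es; move: eE; rewrite inE => /andP[/eqP->].
rewrite -exprD; apply: ler_wiXn2l => //; first exact: ltW.
rewrite cardsU EKI !card_EK_im //.
have h1 := leq_trans (card_EK_le P _) (leq_bin2l 2 cI).
have h2 : ('C(agree t t', 2) <= C2)%N by apply: leq_bin2l; rewrite -ltnS agree_le.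
move: h1 h2; move: (#|EK P _|) ('C(_, 2)) ('C(_, 2)) => x y z; lia.
Qed.

Hypotheses (hO : forall k : {ffun 'I_r -> 'I_d},
   \sum_(k' | (k' != k) && (2 <= agree k k')%N) p ^+ (C2 - 'C(agree k k', 2)) <= O0)
  (hq : q * (O0 + G0) <= 2^-1) .

(** By [hq] overlaps eat at most half of the gain [q * p ^+ C2] of a kept tuple, and a good array
    keeps at least half of its [d ^ r] tuples; hence the quarter. *)
Lemma Psi_greedy_cons a s : valid_array a -> all valid_array s ->
  Psi (EP P) p q (map cross_edges (greedy (a :: s))) <=
  Psi (EP P) p q (map cross_edges (greedy s)) *
  (if (d ^ r <= 2 * #|good_idx a (greedy s)|)%N then expR (- (q * d%:R ^+ r * p ^+ C2 / 4)) else 1).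
Proof.
move=> oa os /=; case: ifP => [good|_]; last by rewrite mulr1.
have p0' := ltW p0.
have vacc t : t \in greedy s -> valid P t.
  by move=> /greedyP[b bs [k ->]]; apply: valid_tup; exact: (allP os).
set L := greedy s in good vacc *.
rewrite map_cat -map_comp.
apply: le_trans (Psi_cat p0' p1 q0 q1 (enum_uniq _) _ _) _.
- by move=> k _; exact: EK_sub.
- by apply/allP => _ /mapP[t _ ->]; exact: EK_sub.
rewrite ler_wpM2l ?Psi_ge0 // ler_expR big_enum /=.
apply: (@le_trans _ _ (\sum_(k in good_idx a L) (- (q * p ^+ C2 / 2)))).
  apply: ler_sum => k; rewrite inE => gk.
  rewrite /cross_edges card_EK_im ?valid_tup //.
  have b1 : \sum_(j <- enum (good_idx a L) | (j != k) && ~~ [disjoint cross_edges (tup a k) & cross_edges (tup a j)])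
      p ^+ #|cross_edges (tup a k) :|: cross_edges (tup a j)| <= p ^+ C2 * O0.
    apply: le_trans (ler_wpM2l (exprn_ge0 _ p0') (hO k)).
    rewrite big_enum_cond /= mulr_sumr big_mkcond [leRHS]big_mkcond /=; apply: ler_sum => k' _.
    case: ifP => [/and3P[_ -> dp]|_]; last by case: ifP => // _; rewrite mulr_ge0 ?exprn_ge0.
    have [h1 h2] := cross_edges_overlap (valid_tup k oa) (valid_tup k' oa) dp.
    by rewrite agree_tup // in h1 h2; rewrite h1.
  have b2 : \sum_(y <- [seq cross_edges t | t <- L] | ~~ [disjoint cross_edges (tup a k) & y])
      p ^+ #|cross_edges (tup a k) :|: y| <= p ^+ C2 * G0.
    apply: le_trans (ler_wpM2l (exprn_ge0 _ p0') gk).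
    rewrite big_map /overlap mulr_sumr big_mkcond [leRHS]big_mkcond /= big_seq [leRHS]big_seq.
    apply: ler_sum => t' /vacc vt'.
    case: ifP => [dp|_]; last by case: ifP => // _; rewrite mulr_ge0 ?exprn_ge0.
    by have [h1 h2] := cross_edges_overlap (valid_tup k oa) vt' dp; rewrite h1.
  apply: (@le_trans _ _ (- q * p ^+ C2 + q ^+ 2 * (p ^+ C2 * O0 + p ^+ C2 * G0))).
    by rewrite lerD2l ler_wpM2l ?exprn_ge0 // lerD.
  have := ler_wpM2l (mulr_ge0 q0 (exprn_ge0 C2 p0')) hq.
  set u := p ^+ C2; lra.
rewrite sumr_const -[leLHS]mulr_natl mulrN lerN2.
have : (d ^ r)%:R <= 2 * #|good_idx a L|%:R :> R by rewrite -natrM ler_nat.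
rewrite natrX => h; have := ler_wpM2l (mulr_ge0 q0 (exprn_ge0 C2 p0')) h.
set u := p ^+ C2; set v := _ ^+ r; lra.
Qed.

Variables (ymax : nat) (kap lam : R).
Hypotheses (G00 : 0 < G0) (lam0 : 0 <= lam) (kap0 : 0 <= kap) 
  (hG : forall t', \sum_(t | (2 <= agree t t')%N) p ^+ (C2 - 'C(agree t t', 2)) *
     (ymax * d ^ r)%:R <= kap * G0 * nR ^+ r).

(** First moment: by [hG] the overlap with [L], averaged over all tuples, is at most [kap * G0], so
    at most the proportion [kap] exceeds [G0]. *)
Lemma bad_density L : (size L <= ymax * d ^ r)%N ->
  #|[set t | ~~ (overlap L t <= G0)]|%:R <= kap * nR ^+ r.
Proof.
move=> sL; rewrite -(ler_pM2r G00) -[leRHS]mulrA [_ * G0]mulrC.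
apply: (@le_trans _ _ (\sum_t overlap L t)).
  rewrite cardsE_sum natr_sum mulr_sumr; apply: ler_sum => t _.
  have g0 : 0 <= overlap L t by apply: sumr_ge0 => t' _; rewrite exprn_ge0 ?ltW.
  by case: (boolP (overlap L t <= G0)); rewrite /= ?mulr0 // mulr1 -ltNge => /ltW.
rewrite /overlap; under eq_bigr do rewrite big_mkcond.
rewrite exchange_big /=.
have [Y0|Y0] := posnP (ymax * d ^ r).
  move: sL; rewrite Y0 leqn0 => /nilP->; rewrite big_nil.
  by rewrite !mulr_ge0 ?exprn_ge0 // ltW.
have Yp : 0 < (ymax * d ^ r)%:R :> R by rewrite ltr0n.
apply: (@le_trans _ _ (\sum_(t' <- L) (kap * G0 * nR ^+ r / (ymax * d ^ r)%:R))).
  apply: ler_sum => t' _; rewrite ler_pdivlMr // -big_mkcond /= mulr_suml; exact: hG.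
rewrite big_const_seq count_predT iter_addr_0 -[leLHS]mulr_natr.
rewrite -mulrA (_ : kap * (nR ^+ r * G0) = kap * G0 * nR ^+ r); last by ring.
rewrite ler_piMr ?mulr_ge0 ?exprn_ge0 ?(ltW G00) //.
by rewrite mulrC ler_pdivrMr // mul1r ler_nat.
Qed.

(** The number of arrays, times the factor gained from a good array plus the proportion of bad
    arrays, from which nothing is gained. *)
Definition greedy_factor : R := (nR ^+ r) ^+ d *
  (expR (- (q * d%:R ^+ r * p ^+ C2 / 4)) + 4 * (expR (- (lam / 4)) * (1 + kap * expR lam)) ^+ d).

Lemma greedy_factor_ge0 : 0 <= greedy_factor.
Proof.
rewrite mulr_ge0 ?exprn_ge0 // addr_ge0 ?expR_ge0 // mulr_ge0 // exprn_ge0 //.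
by rewrite mulr_ge0 ?expR_ge0 // addr_ge0 // mulr_ge0 // expR_ge0.
Qed.

Lemma greedy_step s : all valid_array s -> (size s <= ymax)%N ->
  \sum_(a | valid_array a) Psi (EP P) p q (map cross_edges (greedy (a :: s))) <=
  greedy_factor * Psi (EP P) p q (map cross_edges (greedy s)).
Proof.
move=> os sy; set psi := Psi _ _ _ (map cross_edges (greedy s)).
have psi0 : 0 <= psi by apply: Psi_ge0 => //; exact: ltW.
pose bad := [set a : At | (d ^ r < 2 * #|[set k | ~~ (overlap (greedy s) (tup a k) <= G0)%R]|)%N].
have nbad : #|bad|%:R <= 4 * (expR (- (lam / 4)) * (1 + kap * expR lam)) ^+ d * (nR ^+ r) ^+ d.
  have := @shift_bad R r d' 'I_n (fun t => ~~ (overlap (greedy s) t <= G0)) lam kap lam0.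
  rewrite card_ord; apply; apply: bad_density.
  by apply: leq_trans (size_greedy s) _; rewrite leq_mul2r sy orbT.
set E1 := expR (- (q * d%:R ^+ r * p ^+ C2 / 4)).
have E10 : 0 <= E1 by exact: expR_ge0.
apply: (@le_trans _ _ (\sum_(a : At) psi * (E1 + (a \in bad)%:R))).
  rewrite big_mkcond; apply: ler_sum => a _; case: ifP => [oa|_]; last first.
    by rewrite mulr_ge0 // addr_ge0.
  apply: le_trans (Psi_greedy_cons oa os) _; rewrite ler_wpM2l //.
  case: leqP => h; first by rewrite lerDl.
  rewrite (_ : a \in bad) ?lerDr //= inE.
  have : (#|good_idx a (greedy s)| + #|[set k | ~~ (overlap (greedy s) (tup a k) <= G0)%R]| = d ^ r)%N.
    have <- : #|{: {ffun 'I_r -> 'I_d}}| = (d ^ r)%N by rewrite card_ffun !card_ord.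
    rewrite -cardsT -(cardsID (good_idx a (greedy s)) [set: _]) setTI; congr (_ + _)%N.
    by apply: eq_card => k; rewrite !inE andbT.
  by move/compl_gt_half; apply.
rewrite -mulr_sumr mulrC ler_wpM2r // big_split /= sumr_const.
have -> : \sum_(i : At) (i \in bad)%:R = #|bad|%:R :> R.
  by rewrite -natr_sum -sum1_card [in RHS]big_mkcond; congr (_%:R); apply: eq_bigr => a _; case: (_ \in _).
rewrite /greedy_factor mulrDr lerD //; last by rewrite mulrC.
rewrite -/E1 -[leLHS]mulr_natl ler_wpM2r //.
have cA : #|{: At}| = ((n ^ d) ^ r)%N by rewrite !card_ffun !card_ord.
by rewrite (eq_card (B := {: At})) // cA !natrX exprAC.
Qed.

(** A new array is judged only against the tuples kept before it, so the sum over families is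
    bounded one array at a time. *)
Lemma greedy_sum y : (y <= ymax.+1)%N ->
  \sum_(t : y.-tuple At | all valid_array t) Psi (EP P) p q (map cross_edges (greedy t)) <= greedy_factor ^+ y.
Proof.
elim: y => [|y IH] yl.
  rewrite (big_pred1 [tuple]) /=; last by move=> t; rewrite tuple0.
  rewrite expr0 -(Ex1 (EP P) p); apply: Ex_le => //; first exact: ltW.
  by move=> S _; rewrite /avoid big_nil.
rewrite (reindex (fun x : At * y.-tuple At => cons_tuple x.1 x.2)) /=; last first.
  exists (fun t : y.+1.-tuple At => (thead t, behead_tuple t)) => [[a t] _|t _] /=.
    by congr (_, _); apply: val_inj.
  by rewrite [RHS]tuple_eta; apply: val_inj.
rewrite (eq_bigl (fun x : At * y.-tuple At => all valid_array x.2 && valid_array x.1)); last first.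
  by move=> x; rewrite andbC.
apply: (@le_trans _ _ (\sum_(t : y.-tuple At | all valid_array t) greedy_factor * Psi (EP P) p q (map
  cross_edges (greedy t)))); last first.
  rewrite -mulr_sumr exprS ler_wpM2l ?greedy_factor_ge0 //; apply: IH; exact: ltnW.
rewrite (eq_bigl (fun x : At * y.-tuple At => xpredT x.1 && (all valid_array x.2 && valid_array x.1))) //.
rewrite -(pair_big_dep xpredT (fun a (t : y.-tuple At) => all valid_array t && valid_array a)
   (fun a (t : y.-tuple At) => Psi (EP P) p q (map cross_edges (greedy (a :: t))))) /=.
rewrite (exchange_big_dep (fun t : y.-tuple At => all valid_array t)) /=; last by move=> ? ? _ /andP[].
apply: ler_sum => t ot.
rewrite (eq_bigl valid_array); last by move=> a; rewrite ot.
by apply: greedy_step => //; rewrite size_tuple.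
Qed.

End U2.

(** * Classes of graphs with a prescribed core *)

Section ClassBound.
Variables (R : realType) (n r m : nat) (P : labelling n r).
Variables (p q zeta rho theta K : R) (F0 U1 U2 : graph n) (L : seq {set {set 'I_n}}).
Local Notation EP := (EP P).
Local Notation N := (#|EP|).
Hypotheses (p0 : 0 <= p) (p1 : p <= 1) (q0 : 0 <= q) (q1 : q <= 1)
  (z0 : 0 < zeta) (z1 : zeta <= 1) (rho0 : 0 <= rho) (th0 : 0 <= theta) (mN : (m <= N)%N)
  (hrho : forall h, (h <= m)%N -> 'C(N, m - h)%:R <= rho ^+ h * 'C(N, m)%:R :> R).

Definition rest_inner (G : graph n) := (G :\: F0) :\: EP.
Definition rest_cross (G : graph n) := (G :\: F0) :&: EP.

(** Each prescribed edge costs a factor [rho], the ratio of consecutive binomials. The inner edges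
    outside [F0] are summed over: those in [U1] freely, those in [U2] under the constraint that
    there are at most [K]. That constraint enters through an exponential tilt: the factor
    [expR (theta * (K - #|R2|))] is at least 1 and shrinks the weight of an edge of [U2] to
    [expR (- theta) * rho]. The remaining cross edges avoid [L], which gives [Psi]. *)
Lemma class_bound (GG : {set graph n}) :
  (forall G, G \in GG -> [/\ #|G| = m, F0 \subset G, rest_inner G \subset U1 :|: U2,
     #|rest_inner G :\: U1|%:R <= K & all (fun x : {set {set 'I_n}} => ~~ (x \subset rest_cross G)) L]) ->
  (forall G, G \in GG -> N%:R * p <= (1 - zeta) * (m%:R - #|F0|%:R - #|rest_inner G|%:R)) ->
  #|GG|%:R <= zeta^-1 * 'C(N, m)%:R * rho ^+ #|F0| *
    expR (rho * #|U1|%:R + theta * K + expR (- theta) * rho * #|U2|%:R) * Psi EP p q L.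
Proof.
move=> H Hp.
pose f1 (G : graph n) := rest_inner G :&: U1; pose f2 (G : graph n) := rest_inner G :\: U1.
have cG G : G \in GG -> (#|G| = #|F0| + (#|f1 G| + #|f2 G|) + #|rest_cross G|)%N.
  move=> /H[_ sF _ _ _]; rewrite cardsID -addnA [(#|rest_inner G| + _)%N]addnC cardsID cardsDS //.
  by rewrite subnKC // subset_leq_card.
have Psi0 : 0 <= Psi EP p q L by exact: Psi_ge0.
pose c := zeta^-1 * 'C(N, m)%:R * rho ^+ #|F0| * Psi EP p q L.
have c0 : 0 <= c by rewrite !mulr_ge0 ?exprn_ge0 ?invr_ge0 ?(ltW z0).
apply: (@le_trans _ _ (\sum_(R1 : graph n | R1 \subset U1) \sum_(R2 : graph n | R2 \subset U2)
   c * rho ^+ #|R1| * (expR (theta * K) * (expR (- theta) * rho) ^+ #|R2|))); last first.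
  have -> : zeta^-1 * 'C(N, m)%:R * rho ^+ #|F0| *
    expR (rho * #|U1|%:R + theta * K + expR (- theta) * rho * #|U2|%:R) * Psi EP p q L =
    c * (expR (rho * #|U1|%:R) * (expR (theta * K) * expR (expR (- theta) * rho * #|U2|%:R))).
    rewrite !expRD /c; move: (zeta^-1) ('C(N, m)%:R : R) (rho ^+ _) (Psi _ _ _ _) (expR (rho * _)) (expR (theta
      * K)) (expR (_ * _ * _)).
    by clear => *; ring.
  under eq_bigr do rewrite -mulr_sumr -mulr_sumr.
  rewrite -mulr_suml -mulr_sumr -mulrA ler_wpM2l // ler_pM ?mulr_ge0 ?expR_ge0 //.
  - by apply: sumr_ge0 => *; rewrite exprn_ge0.
  - by apply: sumr_ge0 => *; rewrite exprn_ge0 // mulr_ge0 ?expR_ge0.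
  - exact: sum_subset_expr_le.
  - by rewrite ler_wpM2l ?expR_ge0 // sum_subset_expr_le // mulr_ge0 ?expR_ge0.
rewrite -sum1_card natr_sum.
rewrite (partition_big f1 (fun R1 : graph n => R1 \subset U1)) /=; last first.
  by move=> G _; exact: subsetIr.
apply: ler_sum => R1 R1U.
rewrite (partition_big f2 (fun R2 : graph n => R2 \subset U2)) /=; last first.
  move=> G /andP[/H[_ _ sU _ _] _]; apply/subsetP => e; rewrite inE => /andP[eU eR].
  by have := subsetP sU _ eR; rewrite inE (negPf eU).
apply: ler_sum => R2 R2U.
pose GR := [set G in GG | (f1 G == R1) && (f2 G == R2)].
have -> : \sum_(G | (G \in GG) && (f1 G == R1) && (f2 G == R2)) 1%:R = #|GR|%:R :> R.
  by rewrite -natr_sum sum1_card; congr (_%:R); apply: eq_card => G; rewrite inE unfold_in andbA.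
have [->|/set0Pn[G0]] := eqVneq GR set0.
  rewrite cards0; apply: mulr_ge0; first by apply: mulr_ge0 => //; exact: exprn_ge0.
  apply: mulr_ge0; first exact: expR_ge0.
  by apply: exprn_ge0; apply: mulr_ge0 => //; exact: expR_ge0.
rewrite inE => /and3P[G0G /eqP e1 /eqP e2].
have R2K : #|R2|%:R <= K by rewrite -e2; case: (H _ G0G).
pose h := (#|F0| + (#|R1| + #|R2|))%N.
have hm : (h <= m)%N.
  have := cG _ G0G; have [-> _ _ _ _] := H _ G0G; rewrite e1 e2 /h => ->; exact: leq_addr.
have Gm G : G \in GR -> #|rest_cross G| = (m - h)%N.
  rewrite inE => /and3P[GG0 /eqP E1 /eqP E2]; have := cG _ GG0.
  by have [-> _ _ _ _] := H _ GG0; rewrite E1 E2 -/h => ->; rewrite addKn.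
have inj : {in GR &, injective rest_cross}.
  move=> G G'; rewrite !inE => /and3P[GGi /eqP E1 /eqP E2] /and3P[GGi' /eqP E1' /eqP E2'] E3.
  have rec (G1 : graph n) : F0 \subset G1 -> G1 = F0 :|: (f1 G1 :|: f2 G1) :|: rest_cross G1.
    move=> /subsetP sF; apply/setP => e; rewrite /f1 /f2 /rest_inner /rest_cross !in_setU !in_setI !in_setD.
    have := sF e; case: (e \in F0); case: (e \in G1); case: (e \in EP); case: (e \in U1) => //= h1.
    - by have := h1 isT.
    - by have := h1 isT.
    - by have := h1 isT.
    - by have := h1 isT.
  have [_ sF _ _ _] := H _ GGi; have [_ sF' _ _ _] := H _ GGi'.
  by rewrite (rec G) // (rec G') // E1 E2 E1' E2' E3.
apply: (@le_trans _ _ (zeta^-1 * 'C(N, m - h)%:R * Psi EP p q L)).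
  have hk : N%:R * p <= (1 - zeta) * (m - h)%:R.
    apply: le_trans (Hp _ G0G) _; rewrite natrB // /h -e1 -e2 cardsID natrD opprD addrA //.
  apply: le_trans (count_avoid L p0 p1 q0 q1 z0 z1 (leq_trans (leq_subr _ _) mN) hk).
  rewrite ler_nat -(card_in_imset inj); apply/subset_leq_card/subsetP => _ /imsetP[G GGR ->].
  rewrite inE subsetIr Gm // eqxx /=.
  by move: GGR; rewrite inE => /andP[/H[]].
have hx : 1 <= expR (theta * K) * expR (- theta) ^+ #|R2|.
  rewrite -expRM_natr -expRD -[X in X <= _]expR0 ler_expR mulNr -mulrBr.
  by rewrite mulr_ge0 // subr_ge0.
have := hrho hm; rewrite /h !exprD => hC.
set Z := zeta^-1 * (rho ^+ #|F0| * (rho ^+ #|R1| * rho ^+ #|R2|) * 'C(N, m)%:R) * Psi EP p q L.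
have Z0 : 0 <= Z.
  apply: mulr_ge0 => //; apply: mulr_ge0; first by rewrite invr_ge0 ltW.
  by apply: mulr_ge0 => //; apply: mulr_ge0; last apply: mulr_ge0; exact: exprn_ge0.
apply: (@le_trans _ _ (Z * (expR (theta * K) * expR (- theta) ^+ #|R2|))).
  apply: (@le_trans _ _ Z); last by rewrite ler_peMr.
  by rewrite /Z ler_wpM2r // ler_wpM2l // invr_ge0 ltW.
rewrite exprMn /Z /c le_eqVlt; apply/orP; left; apply/eqP.
move: (zeta^-1) ('C(N, m)%:R : R) (rho ^+ #|F0|) (rho ^+ #|R1|) (rho ^+ #|R2|).
move: (Psi _ _ _ _) (expR (theta * K)) (expR (- theta) ^+ _) => x1 x2 x3 x4 x5 x6 x7 x8.
by clear; ring.
Qed.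

End ClassBound.

(** * Cores of bounded degree *)

Section Degrees.
Variables (n r : nat) (P : labelling n r).
Implicit Types (T G : graph n) (v : 'I_n) (X Y : {set 'I_n}).
Local Notation EP := (EP P).
Local Notation IP := (IP P).

Definition degT T v := #|[set e in T | v \in e]|.
Definition touch X : graph n := [set e in IP | ~~ [disjoint e & X]].

Lemma card_touch_gen (A : graph n) X : (forall e, e \in A -> #|e| = 2) ->
  (#|[set e in A | ~~ [disjoint e & X]]| <= #|X| * n)%N.
Proof.
move=> A2; have -> : (#|X| * n)%N = #|finset.setX X [set: 'I_n]| by rewrite cardsX cardsT card_ord.
apply: leq_trans (leq_imset_card (fun u : 'I_n * 'I_n => [set u.1; u.2]) _).
apply/subset_leq_card/subsetP => e; rewrite inE => /andP[/A2 /eqP/cards2P[a [b [ab ->]]]].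
rewrite -setI_eq0 => /set0Pn[v]; rewrite !inE => /andP[/orP[]/eqP-> vX].
  by apply/imsetP; exists (a, b); rewrite ?inE /= ?vX.
by apply/imsetP; exists (b, a); rewrite ?inE /= ?vX // setUC.
Qed.

Lemma card_touch X : (#|touch X| <= #|X| * n)%N.
Proof. by apply: card_touch_gen => e; rewrite inE => /andP[/eqP]. Qed.

Lemma card_IP : (#|IP| <= n * n)%N.
Proof.
have := card_touch [set: 'I_n]; rewrite cardsT card_ord; apply: leq_trans; apply/subset_leq_card/subsetP => e
  eI; rewrite inE eI /=.
move: eI; rewrite inE => /andP[/cards2P[a [b [_ ->]]] _].
by rewrite -setI_eq0; apply/set0Pn; exists a; rewrite !inE eqxx.
Qed.

Lemma sum_degT T X : (\sum_(v in X) degT T v = \sum_(e in T) #|e :&: X|)%N.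
Proof.
rewrite /degT; under eq_bigr do rewrite -sum1dep_card.
under [RHS]eq_bigr do rewrite -sum1_card.
rewrite (exchange_big_dep (mem T)) /=; last by move=> ? ? _ /andP[].
apply: eq_bigr => e eT; apply: eq_bigl => v; by rewrite inE eT andbC.
Qed.

Lemma sum_degT_le T X : T \subset IP -> (\sum_(v in X) degT T v <= 2 * #|T|)%N.
Proof.
move=> inner; rewrite sum_degT mulnC -sum_nat_const; apply: leq_sum => e eT.
have := subsetP inner _ eT; rewrite inE => /andP[/eqP <- _].
exact: subset_leq_card (subsetIl _ _).
Qed.

Lemma card_touching T X : (#|[set e in T | ~~ [disjoint e & X]]| <= \sum_(v in X) degT T v)%N.
Proof.
rewrite sum_degT -sum1_card big_mkcond [leqRHS]big_mkcond; apply: leq_sum => e _.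
rewrite inE; case: (e \in T) => //=; rewrite -setI_eq0 -cards_eq0 -lt0n; by case: #|_|.
Qed.

Variables (D M : nat).
Definition core_ok T T' := [&& T' \subset T, (#|T'| <= M)%N & [forall v, degT T' v <= D]%N].
Definition core T := [arg max_(T' > set0 | core_ok T T') #|T'|].
Definition saturated T' := [set v | D <= degT T' v]%N.

(** Below size [M], adding another edge of [T] to the core can violate only the degree bound, so one
    end of it has already degree [D]. *)
Lemma coreP T : core_ok T (core T) /\
  forall e, e \in T -> e \notin core T -> (#|core T| < M)%N -> ~~ [disjoint e & saturated (core T)].
Proof.
rewrite /core; case: arg_maxnP => [|T' ok mx].
  rewrite /core_ok sub0set cards0 /=; apply/forallP => v; rewrite /degT.
  by apply: leq_trans (_ : 0 <= D)%N => //; rewrite leqn0 cards_eq0; apply/eqP/setP => e; rewrite !inE.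
split=> // e eT eT' lM.
move: ok => /and3P[sT cT /forallP dT].
have : ~~ core_ok T (e |: T').
  by apply/negP => /mx /=; rewrite /geq /= cardsU1 eT' add1n ltnn.
rewrite /core_ok subUset sub1set eT sT cardsU1 eT' add1n lM /= => /forallPn[v].
rewrite -ltnNge => hv.
have ve : v \in e.
  apply: contraTT hv => ve; rewrite -leqNgt; apply: leq_trans (dT v).
  apply/subset_leq_card/subsetP => f; rewrite !inE => /andP[/orP[/eqP->|->//]].
  by rewrite (negPf ve).
rewrite -setI_eq0; apply/set0Pn; exists v; rewrite !inE ve /=.
rewrite -ltnS; apply: leq_trans hv _.
rewrite /degT (_ : [set f in e |: T' | v \in f] = e |: [set f in T' | v \in f]); last first.
  by apply/setP => f; rewrite !inE; case: eqP => //= ->; rewrite ve.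
by rewrite cardsU1 -add1n leq_add2r leq_b1.
Qed.

Lemma core_IP T : T \subset IP -> core T \subset IP.
Proof. by move=> inner; case: (coreP T) => /and3P[sT _ _] _; exact: subset_trans sT inner. Qed.

Lemma card_saturated T' : T' \subset IP -> (D * #|saturated T'| <= 2 * #|T'|)%N.
Proof.
move=> inner; apply: leq_trans (sum_degT_le (saturated T') inner); rewrite mulnC -sum_nat_const.
by apply: leq_sum => v; rewrite inE.
Qed.

Lemma core_neq0 T : (0 < D)%N -> (0 < M)%N -> T \subset IP -> T != set0 -> (0 < #|core T|)%N.
Proof.
move=> D0 M0 inner /set0Pn[e eT]; rewrite lt0n; apply/negP => s0.
have [_ /(_ e eT)] := coreP T.
have -> : core T = set0 by apply/eqP; rewrite -cards_eq0.
rewrite inE cards0 M0 => /(_ isT isT); rewrite -setI_eq0 => /set0Pn[v].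
rewrite !inE => /andP[_]; rewrite leqNgt /degT.
by rewrite (_ : [set _ in _ | _] = set0) ?cards0 ?D0 //; apply/setP => f; rewrite !inE.
Qed.

End Degrees.

Lemma card_le_cover (A X : finType) (S : {set A}) (C : pred X) (GG : X -> {set A}) :
  (forall G, G \in S -> exists2 x, C x & G \in GG x) ->
  (#|S| <= \sum_(x | C x) #|GG x|)%N.
Proof.
move=> h; under eq_bigr do rewrite -sum1_card.
rewrite (exchange_big_dep xpredT) //= -sum1_card big_mkcond.
apply: leq_sum => G _; case: ifP => // /h[x Cx Gx].
by rewrite (bigD1 x) ?Cx // leq_addr.
Qed.

Lemma not_two_halves a b c D d t : (a < d -> b < d -> c <= D -> t <= c + (a + b) -> ~ (d.*2 + D < t))%N.
Proof. lia. Qed.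

(** * Consequences of clique-freeness *)

Section GraphFacts.
Variables (n r : nat) (P : labelling n r).
Implicit Types (G T : graph n) (v u : 'I_n).
Local Notation EP := (EP P).
Local Notation IP := (IP P).

Definition inner G : graph n := G :\: EP.

Lemma inner_sub G : is_graph G -> inner G \subset IP.
Proof.
move=> /forall_inP gG; apply/subsetP => e; rewrite /inner in_setD [e \in IP]inE => /andP[-> eG].
by rewrite gG.
Qed.

Lemma pair_neq G u v : is_graph G -> [set u; v] \in G -> u != v.
Proof. by move=> /forall_inP gG /gG; rewrite cards2; case: (u != v). Qed.

Lemma pair_EP u v : ([set u; v] \in EP) = (P u != P v).
Proof.
rewrite inE cards2; case: (eqVneq (P u) (P v)) => [uv|uv].
  case: (eqVneq u v) => //= uv'; apply/negbTE/negP => /forall_inP /(_ u).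
  rewrite !inE eqxx => /(_ isT) /forall_inP /(_ v); rewrite !inE eqxx orbT => /(_ isT).
  by rewrite uv' uv eqxx.
have -> : u != v by apply: contraNneq uv => ->.
apply/forall_inP => x; rewrite !inE => hx; apply/forall_inP => y; rewrite !inE => hy.
by move: hx hy => /orP[]/eqP-> /orP[]/eqP->; rewrite ?eqxx //=; apply/implyP => _; rewrite ?uv // eq_sym.
Qed.

Lemma deg_inner G v : is_graph G -> degT (inner G) v = deg G v (part P (P v)).
Proof.
move=> gG; rewrite /degT /deg -(card_in_imset (f := fun u => [set v; u])); last first.
  move=> u u'; rewrite !inE => /andP[_ uG] /andP[_ uG'] h.
  have := pair_neq gG uG; have : u \in [set v; u'] by rewrite -h !inE eqxx orbT.
  by rewrite !inE => /orP[/eqP->|/eqP//]; rewrite eqxx.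
apply: eq_card => e; rewrite inE in_setD; apply/andP/imsetP.
  move=> [/andP[eE eG] ve]; move: (eG); have /cards2P[a [b [ab eab]]] : #|e| == 2%N by apply: (forall_inP gG).
  move: ve eE; rewrite eab in_set2 => /orP[]/eqP <- eE' eG'.
    by exists b; rewrite // !inE eG' andbT; move: eE'; rewrite pair_EP negbK eq_sym.
  by exists a; rewrite 1?setUC // !inE setUC eG' andbT; move: eE'; rewrite pair_EP negbK.
move=> [u]; rewrite in_set [_ \in part P _]in_set => /andP[/eqP uv uG] ->; rewrite uG pair_EP uv eqxx.
by rewrite !inE eqxx.
Qed.

Lemma Kfree_pairs G (K : {set 'I_n}) : Kfree r G -> #|K| = r.+1 ->
  ~ (forall f : {set 'I_n}, f \subset K -> #|f| = 2 -> f \in G).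
Proof.
move=> /forallP /(_ K) + Kr; rewrite Kr eqxx /= => /negP kf H; apply: kf.
apply/forall_inP => u uK; apply/forall_inP => v vK; apply/implyP => uv; apply: H.
  by rewrite subUset !sub1set uK vK.
by rewrite cards2 uv.
Qed.

Lemma Kfree_edge G e tau j : Kfree r G -> e \in IP -> e \in G -> valid P tau -> tau j \in e ->
  ~~ (EK P (Kf e tau) \subset G).
Proof.
move=> kf eI eG transv te; apply/negP => /subsetP s.
apply: (Kfree_pairs kf (card_Kf eI transv te)) => f fK f2.
have [->//|fe] := eqVneq f e.
by apply: s; rewrite inE fK (Kf_pair eI transv te fK f2 fe).
Qed.

Lemma Kfree_nbhd G v tau : is_graph G -> Kfree r G -> valid P tau ->
  (forall j, [set v; tau j] \in G) -> ~~ (EK P (im tau) \subset G).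
Proof.
move=> gG kf transv hv; apply/negP => /subsetP s.
have vN : v \notin im tau.
  by apply/negP => /imsetP[j _ vj]; have := pair_neq gG (hv j); rewrite -vj eqxx.
apply: (Kfree_pairs (K := v |: im tau) kf); first by rewrite cardsU1 vN (card_im transv).
move=> f fK /eqP/cards2P[a [b [ab fab]]].
have hx x : x \in im tau -> [set v; x] \in G by move=> /imsetP[j _ ->].
move: fK; rewrite fab subUset !sub1set !inE => /andP[/orP[/eqP av|aI] /orP[/eqP bv|bI]].
- by rewrite av bv eqxx in ab.
- by rewrite av hx.
- by rewrite bv setUC hx.
apply: s; rewrite inE pair_EP subUset !sub1set aI bI !andbT.
move: aI bI ab => /imsetP[i _ ->] /imsetP[i' _ ->]; rewrite !validE //.
by apply: contraNneq => ->.
Qed.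

Definition bad_graphs (R : realType) (m : nat) (dm : R) : {set graph n} :=
  [set G : graph n | [&& is_graph G, Kfree r G, #|G| == m, condB G P & inner G != set0] &&
    (#|inner G|%:R <= dm)].

End GraphFacts.

(** * Large cores, few heavy vertices, many heavy vertices *)

Section Cases.
Variables (R : realType) (n r m : nat) (P : labelling n r).
Local Notation EP := (EP P).
Local Notation IP := (IP P).
Local Notation N := (#|EP|).
Local Notation nR := (n%:R : R).
Variable hd : {set 'I_n} -> 'I_n.
Hypothesis hdP : forall e, e \in IP -> hd e \in e.
Variables (p q1 q2 zeta rho theta theta1 dm Yth w g : R) (D M ymax d' : nat).
Local Notation d := d'.+1.
Hypotheses (p0 : 0 < p) (p1 : p <= 1) (q10 : 0 <= q1) (q11 : q1 <= 1) (q20 : 0 <= q2) (q21 : q2 <= 1)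
  (z0 : 0 < zeta) (z1 : zeta <= 1) (rho0 : 0 <= rho) (th0 : 0 <= theta) (th10 : 0 <= theta1)
  (mN : (m <= N)%N)
  (hrho : forall h, (h <= m)%N -> 'C(N, m - h)%:R <= rho ^+ h * 'C(N, m)%:R :> R)
  (hNp : N%:R * p <= (1 - zeta) * (m%:R - dm - (ymax * r * d)%:R))
  (Yth0 : 0 < Yth) (hymax : 2 * dm <= ymax%:R * Yth) (D0 : (0 < D)%N) (M0 : (0 < M)%N) (w0 : 0 < w)
  (hU1 : forall T' : graph n, T' \subset IP -> (forall v, degT T' v <= D)%N -> (#|T'| <= M)%N ->
     Psi EP p q1 (clique_list P hd T') <= expR (- (g * #|T'|%:R))).

Local Notation gs := (bad_graphs P m dm).
Local Notation sl G := (core D M (inner P G)).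
Local Notation cst := (zeta^-1 * 'C(N, m)%:R).

Lemma bad_graphsP G : G \in gs -> [/\ is_graph G, Kfree r G, #|G| = m, condB G P & inner P G != set0].
Proof. by rewrite inE => /andP[/and5P[? ? /eqP ? ? ?] _]. Qed.

Lemma cst_ge0 : 0 <= cst :> R.
Proof. by rewrite mulr_ge0 // invr_ge0 ltW. Qed.

Lemma avoid_clique_list G (T' : graph n) : G \in gs -> T' \subset inner P G ->
  all (fun x : {set {set 'I_n}} => ~~ (x \subset rest_cross P T' G)) (clique_list P hd T').
Proof.
move=> /bad_graphsP[gG kf _ _ _] sT; apply/allP => x /mapP[[e tau] + ->]; rewrite mem_enum inE /= => /andP[eT t1].
have eTI := subsetP sT _ eT; have eI := subsetP (inner_sub P gG) _ eTI.
have eG : e \in G by move: eTI; rewrite in_setD => /andP[].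
have transv : valid P tau by move: t1; rewrite inE => /andP[].
apply: contraNN (Kfree_edge kf eI eG transv (Kf_transv hdP eI t1)) => s.
apply: subset_trans s _; apply: subset_trans (subsetIl _ _) _; exact: subsetDl.
Qed.

(** The transfer to [p] needs enough cross edges left over. All inner edges together with [F] number
    at most [dm + ymax * r * d], the margin left in [hNp]. *)
Lemma restI_bound G (T' F : graph n) : G \in gs -> T' \subset inner P G -> (#|F| <= ymax * r * d)%N ->
  N%:R * p <= (1 - zeta) * (m%:R - #|T' :|: F|%:R - #|rest_inner P (T' :|: F) G|%:R).
Proof.
move=> Gg sT cF; apply: le_trans hNp _; rewrite ler_wpM2l ?subr_ge0 // -!addrA lerD2l.
rewrite -!opprD lerN2 -natrD.
have : (#|T' :|: F| + #|rest_inner P (T' :|: F) G| <= #|inner P G| + #|F|)%N.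
  rewrite -cardsUI (_ : _ :&: _ = set0) ?cards0 ?addn0; last first.
    by apply/setP => e; rewrite /rest_inner !inE; case: (e \in T'); case: (e \in F); rewrite ?andbF.
  apply: leq_trans (_ : #|inner P G :|: F| <= _)%N; last by rewrite cardsU leq_subr.
  apply/subset_leq_card/subsetP => e; rewrite /rest_inner /inner !in_setU !in_setD !in_setU.
  have := subsetP sT e; rewrite /inner in_setD.
  by case: (e \in T') => /= [->//|_]; case: (e \in F); case: (e \in EP); case: (e \in G).
move=> h; apply: (@le_trans _ _ (#|inner P G| + #|F|)%:R); first by rewrite ler_nat.
rewrite natrD lerD ?ler_nat //.
by move: Gg; rewrite inE => /andP[].
Qed.

(** A core of size [M] gives no control over the other inner edges: all of [IP] is allowed, up to
    [dm] of them, with tilt [theta1]. The choice of the core is tilted likewise by [s]. The gain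
    [g * M] has to pay for everything. *)
Lemma large_core_bound (s : R) : 0 <= s ->
  #|[set G in gs | #|sl G| == M]|%:R <= cst *
   expR (s * M%:R + expR (- s) * rho * (n * n)%:R + theta1 * dm + expR (- theta1) * rho * (n * n)%:R - g * M%:R).
Proof.
move=> s0; rewrite -sum1_card natr_sum.
rewrite (partition_big (fun G => sl G) (fun T' : graph n => [&& T' \subset IP, [forall v, degT T' v <= D]%N &
  #|T'| == M])) /=; last first.
  move=> G; rewrite inE => /andP[/bad_graphsP[gG _ _ _ _] ->]; rewrite andbT.
  by rewrite core_IP ?inner_sub //=; have [/and3P[]] := coreP D M (inner P G).
apply: (@le_trans _ _ (\sum_(T' : graph n | T' \subset IP)
   (cst * expR (theta1 * dm + expR (- theta1) * rho * (n * n)%:R - g * M%:R) * expR (s * M%:R)) * (expR (- s) *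
     rho) ^+ #|T'|)).
  rewrite big_mkcondr [leRHS]big_mkcond big_mkcond /=.
  apply: ler_sum => T' _; case: ifP => TI'; last by [].
  case: ifP => [/andP[/forallP dT /eqP tM]|_]; last first.
    by do !apply: mulr_ge0; rewrite ?exprn_ge0 ?cst_ge0 ?expR_ge0 ?invr_ge0 ?(ltW z0) // mulr_ge0 ?expR_ge0.
  set GG := [set G in gs | (#|sl G| == M) && (sl G == T')].
  have -> : \sum_(G in [set G in gs | #|sl G| == M] | sl G == T') 1%:R = #|GG|%:R :> R.
    by rewrite -natr_sum sum1_card; congr (_%:R); apply: eq_card => G; rewrite !inE unfold_in !inE -!andbA.
  have Hg G : G \in GG -> G \in gs /\ sl G = T' by rewrite inE => /and3P[-> _ /eqP].
  have sT G : G \in GG -> T' \subset inner P G.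
    by move=> /Hg[_ <-]; have [/and3P[]] := coreP D M (inner P G).
  have := @class_bound R n r m P p q1 zeta rho theta1 dm T' set0 IP (clique_list P hd T') (ltW p0) p1 q10 q11
    z0 z1 rho0 th10 mN hrho GG.
  rewrite cards0 mulr0 add0r => H; apply: le_trans (H _ _) _ => {H}.
  - move=> G GGi; have [Gg _] := Hg _ GGi; have [gG _ Gm _ _] := bad_graphsP Gg; split=> //.
    + by apply: subset_trans (sT _ GGi) (subsetDl _ _).
    + rewrite set0U; apply: subset_trans (inner_sub P gG).
      by apply/subsetP => e; rewrite /rest_inner /inner !in_setD => /and3P[-> _ ->].
    + rewrite setD0; apply: (@le_trans _ _ #|inner P G|%:R).
        rewrite ler_nat; apply/subset_leq_card/subsetP => e; rewrite /rest_inner /inner !in_setD => /and3P[-> _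
          ->] //.
      by move: Gg; rewrite inE => /andP[].
    + exact: avoid_clique_list (sT _ GGi).
  - move=> G GGi; have [Gg _] := Hg _ GGi.
    by have := restI_bound (F := set0) Gg (sT _ GGi); rewrite cards0 setU0; apply.
  have hP := hU1 TI' dT (eq_leq tM); rewrite tM in hP *.
  apply: (@le_trans _ _ (cst * rho ^+ M * expR (theta1 * dm + expR (- theta1) * rho * (n * n)%:R) * expR (- (g
    * M%:R)))).
    apply: (@le_trans _ _ (cst * rho ^+ M * expR (theta1 * dm + expR (- theta1) * rho * #|IP|%:R) * expR (- (g
      * M%:R)))).
      by rewrite ler_wpM2l // mulr_ge0 ?expR_ge0 // mulr_ge0 ?cst_ge0 ?exprn_ge0.
    rewrite ler_wpM2r ?expR_ge0 //.
    apply: ler_wpM2l; first by rewrite mulr_ge0 ?exprn_ge0 ?cst_ge0.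
    rewrite ler_expR lerD2l ler_wpM2l ?mulr_ge0 ?expR_ge0 // ler_nat.
    exact: card_IP.
  rewrite le_eqVlt; apply/orP; left; apply/eqP; rewrite exprMn -expRM_natr.
  rewrite (_ : expR (theta1 * dm + expR (- theta1) * rho * (n * n)%:R - g * M%:R) =
     expR (theta1 * dm + expR (- theta1) * rho * (n * n)%:R) * expR (- (g * M%:R))); last by rewrite expRD.
  have e1 : expR (s * M%:R) * expR (- s * M%:R) = 1 by rewrite -expRD mulNr subrr expR0.
  move: (expR (theta1 * dm + _)) (expR (- (g * _))) (rho ^+ M) cst e1 => x1 x2 x3 x4 e1.
  transitivity (x4 * x1 * x2 * x3 * (expR (s * M%:R) * expR (- s * M%:R))); first by rewrite e1; ring.
  by move: (expR (s * M%:R)) (expR (- s * M%:R)) => y1 y2; ring.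
rewrite -mulr_sumr -mulrA -[leLHS]mulrA ler_wpM2l ?cst_ge0 //.
apply: (@le_trans _ _ (expR (theta1 * dm + expR (- theta1) * rho * (n * n)%:R - g * M%:R) *
   (expR (s * M%:R) * expR (expR (- s) * rho * (n * n)%:R)))).
  rewrite ler_wpM2l ?expR_ge0 // ler_wpM2l ?expR_ge0 //.
  apply: le_trans (sum_subset_expr_le _ _) _; first by rewrite mulr_ge0 ?expR_ge0.
  by rewrite ler_expR ler_wpM2l ?mulr_ge0 ?expR_ge0 // ler_nat card_IP.
by rewrite -!expRD ler_expR le_eqVlt; apply/orP; left; apply/eqP; ring.
Qed.

Definition heavy G : {set 'I_n} := [set v | Yth < (degT (inner P G) v)%:R].

Lemma card_heavy G : G \in gs -> (#|heavy G| <= ymax)%N.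
Proof.
move=> Gg; have [gG _ _ _ _] := bad_graphsP Gg; rewrite -(ler_nat R) -(ler_pM2r Yth0).
apply: le_trans hymax.
apply: (@le_trans _ _ (2 * #|inner P G|)%:R); last first.
  by rewrite natrM ler_wpM2l //; move: Gg; rewrite inE => /andP[].
apply: le_trans (_ : (\sum_(v in heavy G) degT (inner P G) v)%:R <= _); last first.
  by rewrite ler_nat; exact: sum_degT_le (inner_sub P gG).
rewrite natr_sum mulr_natl -sumr_const; apply: ler_sum => v; rewrite inE; exact: ltW.
Qed.

(** A saturated vertex that is not heavy carries at most [Yth] inner edges out of at most [n] pairs,
    hence the tilted cost in the bracket; there are at most [2 / D] saturated vertices per edge of
    the core. *)
Definition sat_cost : R := 2 * (theta * Yth + expR (- theta) * rho * nR) / D%:R.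

(** Every inner edge outside a core of size less than [M] meets a saturated vertex. If it also meets
    [Y] it belongs to the free set [U1], of at most [n] pairs for each vertex of [Y]; otherwise it
    is counted at a saturated vertex that is not heavy. *)
Lemma small_core_class_bound (T' F : graph n) (Y : {set 'I_n}) (L : seq {set {set 'I_n}}) (q : R) (GG : {set
  graph n}) :
  0 <= q -> q <= 1 -> T' \subset IP -> (#|F| <= ymax * r * d)%N ->
  (forall G, G \in GG -> [/\ G \in gs, sl G = T', (#|T'| < M)%N, heavy G = Y & F \subset G]) ->
  (forall G, G \in GG -> all (fun x : {set {set 'I_n}} => ~~ (x \subset rest_cross P (T' :|: F) G)) L) ->
  #|GG|%:R <= cst * rho ^+ #|T' :|: F| * expR (rho * nR * #|Y|%:R + sat_cost * #|T'|%:R) * Psi EP p q L.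
Proof.
move=> q0 q1' TI' cF H HL.
have sT G : G \in GG -> T' \subset inner P G.
  by move=> /H[_ <- _ _ _]; have [/and3P[]] := coreP D M (inner P G).
have := @class_bound R n r m P p q zeta rho theta (#|saturated D T'|%:R * Yth) (T' :|: F) (touch P Y) (touch P
  (saturated D T')) L (ltW p0) p1 q0 q1' z0 z1 rho0 th0 mN hrho GG.
move=> HH; apply: le_trans (HH _ _) _ => {HH}.
- move=> G GGi; have [Gg slG tM YG sF] := H _ GGi; have [gG _ Gm _ _] := bad_graphsP Gg.
  have TG := sT _ GGi.
  have Rsub e : e \in rest_inner P (T' :|: F) G -> e \in inner P G /\ e \notin T'.
    by rewrite /rest_inner /inner !in_setD in_setU negb_or => /and3P[-> /andP[-> _] ->].
  have RX e : e \in rest_inner P (T' :|: F) G -> ~~ [disjoint e & saturated D T'].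
    move=> /Rsub[eT eT']; have [_] := coreP D M (inner P G).
    by rewrite slG; apply.
  split=> //.
  + rewrite subUset sF andbT; apply: subset_trans TG (subsetDl _ _).
  + apply/subsetP => e eR; rewrite inE; apply/orP; right; rewrite inE (RX _ eR) andbT.
    by apply: (subsetP (inner_sub P gG)); case: (Rsub _ eR).
  + apply: (@le_trans _ _ (\sum_(v in saturated D T' :\: Y) degT (inner P G) v)%:R).
      rewrite ler_nat; apply: leq_trans (card_touching _ _).
      apply/subset_leq_card/subsetP => e; rewrite in_setD => /andP[eY eR].
      have [eT eT'] := Rsub _ eR; rewrite inE eT /= -setI_eq0; apply/set0Pn.
      have := RX _ eR; rewrite -setI_eq0 => /set0Pn[v]; rewrite in_setI => /andP[ve vX].
      exists v; rewrite in_setI ve in_setD vX andbT; apply: contra eY => vY.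
      rewrite inE (subsetP (inner_sub P gG)) //= -setI_eq0; apply/set0Pn; exists v.
      by rewrite in_setI ve.
    rewrite natr_sum; apply: (@le_trans _ _ (\sum_(v in saturated D T' :\: Y) Yth)).
      by apply: ler_sum => v; rewrite in_setD -YG => /andP[]; rewrite inE -leNgt.
    rewrite sumr_const -[leLHS]mulr_natl ler_wpM2r ?(ltW Yth0) // ler_nat.
    exact: subset_leq_card (subsetDl _ _).
  + exact: HL.
- move=> G GGi; have [Gg slG tM YG sF] := H _ GGi; exact: restI_bound (sT _ GGi) cF.
rewrite ler_wpM2r ?Psi_ge0 ?(ltW p0) //.
rewrite ler_wpM2l ?mulr_ge0 ?exprn_ge0 ?cst_ge0 ?invr_ge0 ?(ltW z0) // ler_expR -addrA lerD //.
  rewrite -mulrA ler_wpM2l // -natrM ler_nat mulnC; exact: card_touch.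
have Dp : 0 < D%:R :> R by rewrite ltr0n.
have hx : #|saturated D T'|%:R <= 2 * #|T'|%:R / D%:R :> R.
  by rewrite ler_pdivlMr // -!natrM ler_nat mulnC (card_saturated D TI').
apply: (@le_trans _ _ ((theta * Yth + expR (- theta) * rho * nR) * #|saturated D T'|%:R)).
  rewrite mulrDl lerD //; first by rewrite mulrCA mulrC.
  rewrite -[leRHS]mulrA ler_wpM2l ?mulr_ge0 ?expR_ge0 // -natrM ler_nat mulnC; exact: card_touch.
apply: le_trans (ler_wpM2l _ hx) _.
  by rewrite addr_ge0 // ?mulr_ge0 ?expR_ge0 // ltW.
by rewrite /sat_cost le_eqVlt; apply/orP; left; apply/eqP; ring.
Qed.

Variable a1 : R.
Hypothesis a10 : 0 <= a1.

Lemma sum_sets_exp (b : R) : \sum_(Y : {set 'I_n}) expR (- (b * #|Y|%:R)) <= expR (nR * expR (- b)).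
Proof.
rewrite (eq_bigl (fun Y : {set 'I_n} => Y \subset [set: 'I_n])); last by move=> Y; rewrite subsetT.
rewrite (eq_bigr (fun Y : {set 'I_n} => expR (- b) ^+ #|Y|)); last first.
  by move=> Y _; rewrite -expRM_natr mulNr.
by apply: le_trans (sum_subset_expr_le _ (expR_ge0 _)) _; rewrite cardsT card_ord mulrC.
Qed.

(** The cost [rho * n] of each heavy vertex, and a further [w] to make the sum over [Y] converge,
    are charged to the core through [w * #|Y| <= a1 * #|T'|]. What remains is a power of one factor
    per edge of the core. *)
Lemma few_heavy_bound :
  #|[set G in gs | (#|sl G| < M)%N && (w * #|heavy G|%:R <= a1 * #|sl G|%:R)]|%:R <= cst *
   (expR (nR * expR (- w)) *
    (expR (rho * expR (sat_cost + a1 * (rho * nR + w) / w - g) * (n * n)%:R) - 1)).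
Proof.
set z := rho * expR _.
have z_ge0 : 0 <= z by rewrite mulr_ge0 ?expR_ge0.
rewrite -sum1_card natr_sum.
rewrite (partition_big (fun G => sl G) (fun T' : graph n => (T' \subset IP) && ([forall v, degT T' v <= D]%N &&
  (#|T'| < M)%N && (T' != set0)))) /=; last first.
  move=> G; rewrite inE => /and3P[/bad_graphsP[gG _ _ _ T0] -> _]; rewrite andbT.
  rewrite core_IP ?inner_sub //=; have [/and3P[_ _ ->] _] := coreP D M (inner P G).
  by rewrite -cards_eq0 -lt0n; apply: core_neq0 => //; exact: inner_sub.
apply: (@le_trans _ _ (\sum_(T' : graph n | (T' \subset IP) && (T' != set0)) \sum_(Y : {set 'I_n})
   cst * expR (- (w * #|Y|%:R)) * z ^+ #|T'|)); last first.
  apply: (@le_trans _ _ (\sum_(T' : graph n | (T' \subset IP) && (T' != set0)) cst * expR (nR * expR (- w)) * z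
    ^+ #|T'|)).
    apply: ler_sum => T' _; rewrite -mulr_suml -mulr_sumr ler_wpM2r ?exprn_ge0 //.
    by rewrite ler_wpM2l ?cst_ge0 // sum_sets_exp.
  rewrite -mulr_sumr -mulrA ler_wpM2l ?cst_ge0 // ler_wpM2l ?expR_ge0 //.
  (* Graphs with an inner edge have a nonempty core; the missing empty term is the [- 1] that makes
     the bound small. *)
  rewrite lerBrDr; apply: le_trans (_ : \sum_(T' : graph n | T' \subset IP) z ^+ #|T'| <= _).
    rewrite [leRHS](bigD1 set0) ?sub0set //= cards0 expr0 addrC lerD2l.
    by [].
  apply: le_trans (sum_subset_expr_le _ z_ge0) _.
  by rewrite ler_expR ler_wpM2l // ler_nat card_IP.
rewrite big_mkcondr [leRHS]big_mkcondr /=; apply: ler_sum => T' TI'.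
case: (altP (T' =P set0)) => [->|T0]; first by rewrite !andbF.
rewrite andbT /=; case: ifP => [/andP[/forallP dT tM]|_]; last first.
  by apply: sumr_ge0 => Y _; rewrite mulr_ge0 ?exprn_ge0 // mulr_ge0 ?cst_ge0 ?expR_ge0.
rewrite (partition_big heavy xpredT) //=; apply: ler_sum => Y _.
set GG := [set G in gs | [&& (#|sl G| < M)%N, (w * #|heavy G|%:R <= a1 * #|sl G|%:R), sl G == T' & heavy G == Y]].
rewrite (_ : \sum_(_ | _) _ = #|GG|%:R); last first.
  by rewrite -natr_sum sum1_card; congr (_%:R); apply: eq_card => G; rewrite !inE unfold_in !inE -!andbA.
have [->|/set0Pn[G0]] := eqVneq GG set0.
  by rewrite cards0 mulr_ge0 ?exprn_ge0 // mulr_ge0 ?cst_ge0 ?expR_ge0.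
rewrite inE => /and5P[_ _ hY0 /eqP sl0 /eqP Y0]; rewrite sl0 Y0 in hY0.
have Hg G : G \in GG -> [/\ G \in gs, sl G = T', (#|T'| < M)%N, heavy G = Y & set0 \subset G].
  by rewrite inE => /and5P[-> _ _ /eqP-> /eqP->]; rewrite sub0set.
apply: le_trans (small_core_class_bound q10 q11 TI' _ Hg (L := clique_list P hd T') _) _; first by rewrite cards0.
  move=> G /[dup] GGi /Hg[Gg slG _ _ _]; rewrite setU0; apply: avoid_clique_list => //.
  by rewrite -slG; have [/and3P[]] := coreP D M (inner P G).
rewrite setU0; have hP := hU1 TI' dT (ltnW tM).
apply: (@le_trans _ _ (cst * rho ^+ #|T'| * expR (rho * nR * #|Y|%:R + sat_cost * #|T'|%:R) * expR (- (g *
  #|T'|%:R)))).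
  by rewrite ler_wpM2l // mulr_ge0 ?expR_ge0 // mulr_ge0 ?cst_ge0 ?exprn_ge0.
rewrite /z exprMn -expRM_natr.
have e1 : expR (rho * nR * #|Y|%:R + sat_cost * #|T'|%:R) * expR (- (g * #|T'|%:R)) <=
    expR (- (w * #|Y|%:R)) * expR ((sat_cost + a1 * (rho * nR + w) / w - g) * #|T'|%:R).
  rewrite -!expRD ler_expR.
  have rw0 : 0 <= (rho * nR + w) / w by rewrite divr_ge0 ?(ltW w0) // addr_ge0 ?mulr_ge0 // ltW.
  have := ler_wpM2l rw0 hY0.
  have -> : (rho * nR + w) / w * (w * #|Y|%:R) = rho * nR * #|Y|%:R + w * #|Y|%:R.
    by field; rewrite gt_eqF.
  have -> : (rho * nR + w) / w * (a1 * #|T'|%:R) = a1 * (rho * nR + w) / w * #|T'|%:R.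
    by field; rewrite gt_eqF.
  set u := a1 * _ / w; lra.
rewrite -mulrA [leRHS]mulrACA ler_wpM2l //.
by rewrite mulr_ge0 ?cst_ge0 ?exprn_ge0.
Qed.

(* An edge between two heavy vertices of [Y0] must be used only once: it is assigned to its
   smaller or to its larger end according to [sg], whichever is better for half of the vertices. *)
Definition oriented (Y0 : {set 'I_n}) (sg : bool) (v u : 'I_n) : bool :=
  (u \notin Y0) || (if sg then (v < u)%N else (u < v)%N).

Definition nbrs G (T' : graph n) Y0 sg v j :=
  [set u in part P j | ([set v; u] \in G :\: T') && oriented Y0 sg v u].

Lemma in_nbrs G (T' : graph n) Y0 sg v j u : (u \in nbrs G T' Y0 sg v j) =
  (P u == j) && (([set v; u] \notin T') && ([set v; u] \in G) && oriented Y0 sg v u).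
Proof. by rewrite in_set [u \in part _ _]in_set in_setD. Qed.

Local Notation At := {ffun 'I_r -> {ffun 'I_d -> 'I_n}}.

Definition array_in_nbrs G T' Y0 sg v (a : At) :=
  [forall j, (injectiveb (a j)) && [forall k, a j k \in nbrs G T' Y0 sg v j]].

Lemma array_in_nbrs_valid G T' Y0 sg v a : array_in_nbrs G T' Y0 sg v a -> valid_array P a.
Proof.
move=> /forallP h; apply/forallP => j; have /andP[-> /forallP h2] := h j.
by apply/forallP => k; have := h2 k; rewrite !inE => /andP[].
Qed.

(** Rows are ordered, so every neighbourhood is counted at least [d!] times per row. Dividing by
    this later reduces the number of arrays, weighted by the price of their edges, to a constant to
    the power [r * d]. *)
Lemma card_array_in_nbrs G T' Y0 sg v : (forall j, d <= #|nbrs G T' Y0 sg v j|)%N ->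
  (d`! ^ r <= #|[set a | array_in_nbrs G T' Y0 sg v a]|)%N.
Proof.
move=> h.
pose Fj j := [set f : {ffun 'I_d -> 'I_n} in ffun_on (mem (nbrs G T' Y0 sg v j)) | injectiveb f].
apply: (@leq_trans #|family (fun j => mem (Fj j))|); last first.
  apply/subset_leq_card/subsetP => a /familyP ha; rewrite inE; apply/forallP => j.
  have := ha j; rewrite inE => /andP[/ffun_onP h1 ->]; apply/forallP => k; exact: h1.
rewrite card_family foldrE big_map big_enum /= -[X in (_ ^ X)%N]card_ord -prod_nat_const.
apply: leq_prod => j _; rewrite card_inj_ffuns_on card_ord.
rewrite -bin_ffact leq_pmull // bin_gt0; exact: h.
Qed.

Definition array_edges (Y0 : {set 'I_n}) (t : #|Y0|.-tuple At) : graph n :=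
  [set [set enum_val x.1.1; (tnth t x.1.1) x.1.2 x.2] | x : 'I_#|Y0| * 'I_r * 'I_d].

(** Two vertices of [Y0] cannot both list each other, because of the orientation, so no edge is
    repeated and each contributes its own factor [rho]. *)
Lemma card_array_edges (Y0 : {set 'I_n}) (sg : bool) (t : #|Y0|.-tuple At) : (forall i, valid_array P (tnth t i)) ->
  (forall i j k, oriented Y0 sg (enum_val i) (tnth t i j k)) -> #|array_edges t| = (#|Y0| * r * d)%N.
Proof.
move=> hA hv; rewrite card_imset; first by rewrite !card_prod !card_ord.
move=> [[i j] k] [[i' j'] k'] /= h.
have vY (l : 'I_#|Y0|) : enum_val l \in Y0 by exact: enum_valP.
have ne (l : 'I_#|Y0|) jj kk : tnth t l jj kk != enum_val l.
  have := hv l jj kk; rewrite /oriented => /orP[|].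
    by apply: contraNneq => ->.
  by case: (sg) => hl; apply/eqP => e; rewrite e ltnn in hl.
have [ii|ii] := eqVneq (enum_val i) (enum_val i').
  have ei : i = i' by exact: enum_val_inj ii.
  subst i'.
  have : tnth t i j k \in [set enum_val i; tnth t i j' k'] by rewrite -h !inE eqxx orbT.
  rewrite !inE (negPf (ne _ _ _)) /= => /eqP e.
  have /forallP hAi := hA i.
  have pj : P (tnth t i j k) = j by have /andP[_ /forallP /(_ k) /eqP] := hAi j.
  have pj' : P (tnth t i j' k') = j' by have /andP[_ /forallP /(_ k') /eqP] := hAi j'.
  have ej : j = j' by rewrite -pj e pj'.
  subst j'; have /andP[/injectiveP inj _] := hAi j.
  by rewrite (inj _ _ e).
have e1 : enum_val i = tnth t i' j' k'.
  have : enum_val i \in [set enum_val i'; tnth t i' j' k'] by rewrite -h !inE eqxx.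
  by rewrite !inE (negPf ii) /= => /eqP.
have e2 : enum_val i' = tnth t i j k.
  have : enum_val i' \in [set enum_val i; tnth t i j k] by rewrite h !inE eqxx.
  by rewrite !inE eq_sym (negPf ii) /= => /eqP.
have := hv i j k; have := hv i' j' k'; rewrite /oriented -e1 -e2 !vY /=.
by case: (sg) => h1 h2; have := ltn_trans h1 h2; rewrite ltnn.
Qed.

Lemma tuple_count (Y0 : {set 'I_n}) (Q : 'I_n -> pred At) (c : nat) :
  (forall v, v \in Y0 -> c <= #|[set a | Q v a]|)%N ->
  (c ^ #|Y0| <= #|[set t : #|Y0|.-tuple At | [forall i, Q (enum_val i) (tnth t i)]]|)%N.
Proof.
move=> h.
pose fam := family (fun i : 'I_#|Y0| => mem [set a | Q (enum_val i) a]).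
apply: (@leq_trans #|fam|).
  rewrite card_family foldrE big_map big_enum /= -[X in (_ ^ X)%N]card_ord -prod_nat_const.
  by apply: leq_prod => i _; apply: h; exact: enum_valP.
pose tf (f : {ffun 'I_#|Y0| -> At}) := [tuple f i | i < #|Y0|].
have tinj : injective tf.
  move=> f f' e; apply/ffunP => i.
  by have h2 : tnth (tf f) i = tnth (tf f') i; [rewrite e|move: h2; rewrite !tnth_mktuple].
rewrite -(card_imset _ tinj); apply/subset_leq_card/subsetP => _ /imsetP[f /familyP hf ->].
rewrite inE; apply/forallP => i; rewrite tnth_mktuple; by have := hf i; rewrite inE.
Qed.

Definition rich_class (T' : graph n) (Y Y0 : {set 'I_n}) (sg : bool) : {set graph n} :=
  [set G in gs | [&& sl G == T', (#|T'| < M)%N, heavy G == Y &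
    [forall v in Y0, forall j, d <= #|nbrs G T' Y0 sg v j|]%N]].

Hypothesis hYD : (d.*2 + D)%:R <= Yth.
Hypothesis r0 : (0 < r)%N.

(** Pass to a part containing at least a proportion [1/r] of the heavy vertices, then to the half
    served by one orientation. Within a single part, neighbours in other parts are never in [Y0], so
    the orientation restricts only the inner neighbours. *)
Lemma exists_rich G : G \in gs -> exists2 x : {set 'I_n} * bool,
  (x.1 \subset heavy G) && (#|heavy G| <= 2 * r * #|x.1|)%N &
  forall v j, v \in x.1 -> (d <= #|nbrs G (sl G) x.1 x.2 v j|)%N.
Proof.
move=> Gg; have [gG _ _ cB _] := bad_graphsP Gg; set T' := sl G; set Y := heavy G.
have [/and3P[sT _ /forallP dT] _] := coreP D M (inner P G); rewrite -/T' in sT dT.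
have [i0 hi0] : exists i, (#|Y| <= r * #|Y :&: part P i|)%N.
  apply/existsP; apply: contraT => /existsPn h.
  have eY : (#|Y| = \sum_(i < r) #|Y :&: part P i|)%N.
    rewrite -sum1_card (partition_big P xpredT) //=; apply: eq_bigr => i _.
    by rewrite sum1_card; apply: eq_card => v; rewrite unfold_in in_setI [v \in part P i]inE.
  have : (\sum_(i < r) (r * #|Y :&: part P i| + 1) <= \sum_(i < r) #|Y|)%N.
    by apply: leq_sum => i _; rewrite addn1 ltnNge; exact: h.
  rewrite big_split /= -big_distrr /= -eY !sum_nat_const card_ord.
  by move: r0; set k := (r * #|Y|)%N; clear; lia.
pose Yi := Y :&: part P i0.
have YiP v : v \in Yi -> P v = i0 by rewrite in_setI [v \in part _ _]inE => /andP[_ /eqP].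
have YiY v : v \in Yi -> Yth < (degT (inner P G) v)%:R by rewrite in_setI inE => /andP[].
pose Ys sg := [set v in Yi | (d <= #|nbrs G T' Yi sg v i0|)%N].
have YsE sg v : (v \in Ys sg) = (v \in Yi) && (d <= #|nbrs G T' Yi sg v i0|)%N by rewrite /Ys in_set.
(* The inner degree exceeds [2 d + D] and the core uses at most [D] of it. The other inner edges at
   [v] are shared between the two orientations, so one of them keeps at least [d]. *)
have cov : (#|Yi| <= #|Ys true| + #|Ys false|)%N.
  apply: leq_trans (_ : #|Ys true :|: Ys false| <= _)%N; last by rewrite cardsU leq_subr.
  apply/subset_leq_card/subsetP => v vY; rewrite in_setU !YsE vY.
  rewrite /=; apply: contraT; rewrite negb_or -!ltnNge => /andP[h1 h2].
  have dv := YiY _ vY; have : (d.*2 + D < degT (inner P G) v)%N by rewrite -(ltr_nat R) (le_lt_trans hYD).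
  suff H : (degT (inner P G) v <= degT T' v + (#|nbrs G T' Yi true v i0| + #|nbrs G T' Yi false v i0|))%N.
    by move/(not_two_halves h1 h2 (dT v) H).
  apply: (@leq_trans (degT T' v + #|[set e in inner P G :\: T' | v \in e]|)).
    apply: leq_trans (_ : #|[set e in T' | v \in e] :|: [set e in inner P G :\: T' | v \in e]| <= _)%N; last by
      rewrite cardsU leq_subr.
    apply/subset_leq_card/subsetP => e; rewrite in_setU [e \in finset _]inE => /andP[eT ve].
    by rewrite 2!in_set ve in_setD eT; case: (e \in T').
  rewrite leq_add2l.
  apply: leq_trans (_ : #|nbrs G T' Yi true v i0 :|: nbrs G T' Yi false v i0| <= _)%N; last by rewrite cardsU
    leq_subr.
  apply: leq_trans (leq_imset_card (fun u => [set v; u]) _).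
  apply/subset_leq_card/subsetP => e; rewrite inE in_setD => /andP[/andP[eT' eT] ve].
  have eI := subsetP (inner_sub P gG) _ eT.
  have eG : e \in G by move: eT; rewrite /inner in_setD => /andP[].
  have [u eu] : exists u, e = [set v; u].
    have /cards2P[a [b [ab eab]]] : #|e| == 2%N by apply: (forall_inP gG).
    move: ve; rewrite eab in_set2 => /orP[]/eqP->; first by exists b.
    by exists a; rewrite setUC.
  apply/imsetP; exists u => //.
  have uv : v != u by apply: (pair_neq gG); rewrite -eu.
  have Pu : P u == i0.
    by rewrite -(YiP _ vY) (IPP eI (u := u) (v := v)) ?eqxx // eu !inE eqxx ?orbT.
  rewrite in_setU !in_nbrs Pu -eu eT' eG /= /oriented.
  by case: (u \in Yi) => //=; move: uv; rewrite -val_eqE /= neq_ltn.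
have [sg hsg] : exists sg, (#|Yi| <= 2 * #|Ys sg|)%N.
  case: (leqP #|Ys true| #|Ys false|) => h; [exists false|exists true]; move: h cov; clear; lia.
exists (Ys sg, sg) => /=.
  apply/andP; split.
    by apply/subsetP => v; rewrite inE in_setI => /andP[/andP[]].
  by apply: leq_trans hi0 _; rewrite [(2 * r)%N]mulnC -mulnA leq_mul2l hsg orbT.
move=> v j vY; have vYi : v \in Yi by move: vY; rewrite inE => /andP[].
have [->|ji] := eqVneq j i0.
  (* Shrinking [Yi] to [Ys sg] only weakens the orientation constraint. *)
  move: vY; rewrite inE => /andP[_ h]; apply: leq_trans h _.
  apply/subset_leq_card/subsetP => u; rewrite !in_set => /and3P[-> -> /=].
  move=> /orP[h|h]; rewrite /oriented ?h ?orbT // inE negb_and.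
  by move: h; rewrite in_setI => ->.
(* Condition (B) provides as many neighbours in every other part. *)
have h1 : (degT (inner P G) v <= deg G v (part P j))%N.
  rewrite (deg_inner _ _ gG).
  have /forall_inP := forallP cB (P v); move/(_ v).
  by rewrite inE eqxx => /(_ isT) /forallP /(_ j); rewrite (YiP _ vYi) ji.
have h2 : (d <= degT (inner P G) v)%N.
  rewrite -(ler_nat R); apply: le_trans (ltW (YiY _ vYi)); apply: le_trans hYD.
  by rewrite ler_nat -addnn -addnA leq_addr.
apply: leq_trans h2 (leq_trans h1 _).
apply/subset_leq_card/subsetP => u; rewrite !in_set => /andP[Pu uG].
rewrite Pu uG andbT /=; apply/andP; split.
  apply: contraTN Pu => uT; have uI := subsetP (inner_sub P gG) _ (subsetP sT _ uT).
  by rewrite -(IPP uI (u := v)) ?(YiP _ vYi) 1?eq_sym // !inE eqxx ?orbT.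
rewrite /oriented inE negb_and; apply/orP; left; apply/orP; left.
by rewrite in_setI negb_and [u \in part _ _]inE (eqP Pu) ji orbT.
Qed.

Variables (Lf : seq At -> seq {ffun 'I_r -> 'I_n}) (u2 b B : R).
Hypotheses (hL : forall s t, t \in Lf s -> exists2 a, a \in s & exists k, t = tup a k)
  (u20 : 0 <= u2)
  (hU2 : forall y, (y <= ymax)%N ->
    \sum_(t : y.-tuple At | all (valid_array P) t) Psi EP p q2 (map (cross_edges P) (Lf t)) <= u2 ^+ y)
  (hu2 : rho ^+ (r * d) * u2 <= expR (- b) * (d`! ^ r)%:R).

Lemma rich_class_bound (T' : graph n) (Y Y0 : {set 'I_n}) sg : T' \subset IP -> Y0 \subset Y ->
  #|rich_class T' Y Y0 sg|%:R <= cst * rho ^+ #|T'| * expR (rho * nR * #|Y|%:R + sat_cost * #|T'|%:R) * expR (-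
    (b * #|Y0|%:R)).
Proof.
move=> TI' YY; set GG := rich_class _ _ _ _.
set E := expR (rho * nR * #|Y|%:R + sat_cost * #|T'|%:R).
set C := cst * rho ^+ #|T'| * E.
have C0 : 0 <= C by rewrite mulr_ge0 ?expR_ge0 // mulr_ge0 ?exprn_ge0 // cst_ge0.
have GGP G : G \in GG -> [/\ G \in gs, sl G = T', (#|T'| < M)%N, heavy G = Y &
    forall v, v \in Y0 -> forall j, (d <= #|nbrs G T' Y0 sg v j|)%N].
  rewrite inE => /andP[-> /and4P[/eqP-> -> /eqP-> /forall_inP h]]; split=> // v vY j.
  by have /forallP := h v vY; apply.
have [->|/set0Pn[G0 GG0]] := eqVneq GG set0.
  by rewrite cards0 mulr_ge0 ?expR_ge0.
have Yl : (#|Y0| <= ymax)%N.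
  have [Gg _ _ YG _] := GGP _ GG0; apply: leq_trans (subset_leq_card YY) _.
  by rewrite -YG card_heavy.
have Dp : 0 < (d`! ^ r)%:R :> R by rewrite ltr0n expn_gt0 fact_gt0.
have Dpy : 0 < (d`! ^ r)%:R ^+ #|Y0| :> R by rewrite exprn_gt0.
rewrite -(ler_pM2r Dpy).
pose transv (t : #|Y0|.-tuple At) G := [forall i, array_in_nbrs G T' Y0 sg (enum_val i) (tnth t i)].
apply: (@le_trans _ _ (\sum_(G in GG) #|[set t | transv t G]|%:R)).
  rewrite -natrX -natrM mulnC -natr_sum ler_nat mulnC -sum_nat_const; apply: leq_sum => G /GGP[_ _ _ _ h].
  have H := @tuple_count Y0 (fun v => array_in_nbrs G T' Y0 sg v) (d`! ^ r)%N.
  by apply: H => v /h; exact: card_array_in_nbrs.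
apply: (@le_trans _ _ (\sum_(t : #|Y0|.-tuple At | all (valid_array P) t) #|[set G in GG | transv t G]|%:R)).
  rewrite -!natr_sum ler_nat.
  under eq_bigr do rewrite -sum1dep_card.
  rewrite (exchange_big_dep (fun t : #|Y0|.-tuple At => all (valid_array P) t)) /=.
    by apply: leq_sum => t _; rewrite sum1dep_card.
  move=> G t _ /forallP h; apply/all_tnthP => i; exact: array_in_nbrs_valid (h i).
apply: (@le_trans _ _ (\sum_(t : #|Y0|.-tuple At | all (valid_array P) t) C * (rho ^+ (r * d)) ^+ #|Y0| * Psi
  EP p q2 (map (cross_edges P) (Lf t)))).
  apply: ler_sum => t /all_tnthP ot; set Gt := [set G in GG | transv t G].
  have Psi0 : 0 <= Psi EP p q2 (map (cross_edges P) (Lf t)) by apply: Psi_ge0 => //; exact: ltW.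
  have [->|/set0Pn[G1]] := eqVneq Gt set0.
    by rewrite cards0 mulr_ge0 // mulr_ge0 // exprn_ge0 // exprn_ge0.
  rewrite inE => /andP[GG1 vt1].
  have vtP G : transv t G -> forall i j k, ([set enum_val i; tnth t i j k] \in G :\: T') /\ oriented Y0 sg
    (enum_val i) (tnth t i j k).
    move=> /forallP h i j k; have /forallP /(_ j) /andP[_ /forallP /(_ k)] := h i.
    by rewrite inE => /and3P[_ -> ->].
  have cF : #|array_edges t| = (#|Y0| * r * d)%N.
    by refine (@card_array_edges Y0 sg t ot _) => i j k; case: (vtP _ vt1 i j k).
  have sF G : transv t G -> array_edges t \subset G :\: T'.
    by move=> vG; apply/subsetP => _ /imsetP[[[i j] k] _ ->] /=; case: (vtP _ vG i j k).
  have cU : #|T' :|: array_edges t| = (#|T'| + #|Y0| * (r * d))%N.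
    rewrite cardsU cF (_ : T' :&: _ = set0) ?cards0 ?subn0 ?mulnA //.
    apply/setP => e; rewrite in_setI in_set0; apply/negbTE/negP => /andP[eT /(subsetP (sF _ vt1))].
    by rewrite in_setD eT.
  have HG G : G \in Gt -> [/\ G \in gs, sl G = T', (#|T'| < M)%N, heavy G = Y & array_edges t \subset G].
    rewrite inE => /andP[/GGP[-> -> -> -> _] /sF h]; split=> //; exact: subset_trans h (subsetDl _ _).
  apply: le_trans (small_core_class_bound q20 q21 TI' _ HG (L := map (cross_edges P) (Lf t)) _) _.
  - by rewrite cF -!mulnA leq_mul2r Yl orbT.
  - move=> G; rewrite inE => /andP[/GGP[Gg _ _ _ _] vG]; apply/allP => x /mapP[tau /hL[a /tnthP[i ai] [k tk]] ->].
    have [gG kf _ _ _] := bad_graphsP Gg.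
    have vtau : valid P tau by rewrite tk; apply: valid_tup; rewrite ai.
    have hv j : [set enum_val i; tau j] \in G.
      by rewrite tk ffunE ai; have [+ _] := vtP _ vG i j (k j); rewrite in_setD => /andP[].
    apply: contraNN (Kfree_nbhd gG kf vtau hv) => s; apply: subset_trans s _.
    exact: subset_trans (subsetIl _ _) (subsetDl _ _).
  rewrite ler_wpM2r // cU exprD [(#|Y0| * _)%N]mulnC exprM /C /E.
  rewrite le_eqVlt; apply/orP; left; apply/eqP.
  by move: cst (rho ^+ #|T'|) (_ ^+ #|Y0|) (expR _) => x1 x2 x3 x4; clear; ring.
rewrite -mulr_sumr; apply: le_trans (ler_wpM2l _ (hU2 Yl)) _.
  by rewrite mulr_ge0 // exprn_ge0 // exprn_ge0.
rewrite -[leLHS]mulrA -[leRHS]mulrA ler_wpM2l // -exprMn -mulNr expRM_natr -exprMn.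
by rewrite lerXn2r ?nnegrE ?mulr_ge0 ?expR_ge0 ?exprn_ge0.
Qed.

Hypotheses (B0 : 0 <= B) (hb : rho * nR + B * w + 1 + w <= b / (2 * r%:R)).

(** As [b / (2 r) * #|Y| <= b * #|Y0|], the gain covers four expenses per heavy vertex, the terms of
    [hb]: the edges at [Y], the factor [expR (B * a1)] lent to each edge of the core, the choice of
    [Y0], and a rest [w] for the sum over nonempty [Y]. *)
Lemma many_heavy_bound :
  #|[set G in gs | (#|sl G| < M)%N && ~~ (w * #|heavy G|%:R <= a1 * #|sl G|%:R)]|%:R <= cst *
   (2 * expR (rho * expR (sat_cost - B * a1) * (n * n)%:R) * (expR (nR * expR (- w)) - 1)).
Proof.
pose C (x : (graph n * {set 'I_n}) * ({set 'I_n} * bool)) :=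
  [&& x.1.1 \subset IP, x.1.2 != set0, ~~ (w * #|x.1.2|%:R <= a1 * #|x.1.1|%:R)%R,
    x.2.1 \subset x.1.2 & (#|x.1.2| <= 2 * r * #|x.2.1|)%N].
pose GGx (x : (graph n * {set 'I_n}) * ({set 'I_n} * bool)) := rich_class x.1.1 x.1.2 x.2.1 x.2.2.
apply: (@le_trans _ _ (\sum_(x | C x) #|GGx x|)%:R).
  rewrite ler_nat; apply: card_le_cover => G; rewrite inE => /and3P[Gg tM hY].
  have [gG _ _ _ _] := bad_graphsP Gg.
  have [[Y0 sg] /andP[h1 h2] h3] := exists_rich Gg.
  exists ((sl G, heavy G), (Y0, sg)); rewrite /C /GGx /=.
    rewrite core_IP ?inner_sub // hY h1 h2 !andbT.
    apply: contraNneq hY => ->; by rewrite cards0 mulr0 mulr_ge0.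
  rewrite inE Gg !eqxx tM /=; apply/forall_inP => v vY; apply/forallP => j; exact: h3.
rewrite natr_sum.
pose z := rho * expR (sat_cost - B * a1).
have z_ge0 : 0 <= z by rewrite mulr_ge0 ?expR_ge0.
have b0 : 0 <= b.
  have : 0 <= b / (2 * r%:R).
    by apply: le_trans hb; rewrite !addr_ge0 ?mulr_ge0 ?(ltW w0).
  by rewrite pmulr_lge0 // invr_gt0 mulr_gt0 // ltr0n.
pose S (x : (graph n * {set 'I_n}) * ({set 'I_n} * bool)) : R :=
  cst * z ^+ #|x.1.1| * expR (- ((w + 1) * #|x.1.2|%:R)).
apply: (@le_trans _ _ (\sum_(x : (graph n * {set 'I_n}) * ({set 'I_n} * bool) | (x.1.1 \subset IP) && (x.1.2 !=
  set0) && (x.2.1 \subset x.1.2)) S x)).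
  rewrite big_mkcond [leRHS]big_mkcond; apply: ler_sum => -[[T' Y] [Y0 sg]] _; rewrite /C /=.
  have S0 : 0 <= S ((T', Y), (Y0, sg)).
    by rewrite /S mulr_ge0 ?expR_ge0 // mulr_ge0 ?exprn_ge0 ?cst_ge0.
  case: ifP => [/and5P[TI' Yn hY YY hy]|_]; last by case: ifP.
  rewrite TI' Yn YY /=; apply: le_trans (rich_class_bound _ TI' YY) _.
  rewrite /S /= /z exprMn -expRM_natr [in leRHS]mulrA -[leLHS]mulrA -[leRHS]mulrA.
  apply: ler_wpM2l; first by rewrite mulr_ge0 ?cst_ge0 ?exprn_ge0.
  rewrite -!expRD ler_expR.
  move: hY; rewrite -ltNge => hY.
  have h1 := ler_wpM2l B0 (ltW hY).
  have yr : #|Y|%:R <= 2 * r%:R * #|Y0|%:R :> R by rewrite -!natrM ler_nat.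
  have h2 : b / (2 * r%:R) * #|Y|%:R <= b * #|Y0|%:R.
    rewrite mulrAC ler_pdivrMr ?mulr_gt0 ?ltr0n // -mulrA ler_wpM2l //.
    by rewrite [#|Y0|%:R * _]mulrC.
  have h3 := ler_wpM2r (ler0n _ #|Y|) hb.
  have -> : (sat_cost - B * a1) * #|T'|%:R = sat_cost * #|T'|%:R - B * (a1 * #|T'|%:R) by ring.
  move: h1 h2 h3; move: (sat_cost * _) (#|Y|%:R : R) (b * _) (b / _) (a1 * _) => cXt y by0 bb at1 h1 h2 h3.
  by lra.
rewrite (eq_bigl (fun x : (graph n * {set 'I_n}) * ({set 'I_n} * bool) =>
  ((x.1.1 \subset IP) && (x.1.2 != set0)) && (x.2.1 \subset x.1.2))) //.
rewrite -(pair_big_dep (fun x : graph n * {set 'I_n} => (x.1 \subset IP) && (x.2 != set0))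
   (fun x (y : {set 'I_n} * bool) => y.1 \subset x.2)
   (fun x y => cst * z ^+ #|x.1| * expR (- ((w + 1) * #|x.2|%:R)))) /=.
apply: (@le_trans _ _ (\sum_(x : graph n * {set 'I_n} | (x.1 \subset IP) && (x.2 != set0))
    (2 * cst) * z ^+ #|x.1| * expR (- (w * #|x.2|%:R)))).
  apply: ler_sum => -[T' Y] _ /=.
  rewrite sumr_const -[leLHS]mulr_natl.
  have -> : #|[pred y : {set 'I_n} * bool | y.1 \subset Y]| = (2 ^ #|Y| * 2)%N.
    rewrite -card_powerset -[X in (_ * X)%N]card_bool -cardsT -cardsX.
    by apply: eq_card => -[A s]; rewrite !inE andbT.
  have e2 : 2 ^+ #|Y| <= expR #|Y|%:R :> R.
    rewrite -[#|Y|%:R]mul1r expRM_natr lerXn2r ?nnegrE ?expR_ge0 //.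
    by have := expR_ge1Dx (1 : R).
  rewrite natrM natrX mulrDl mul1r opprD expRD.
  have e3 : expR #|Y|%:R * expR (- #|Y|%:R) = 1 :> R by rewrite -expRD subrr expR0.
  have e4 : 2 ^+ #|Y| * expR (- #|Y|%:R) <= 1 :> R by rewrite -[leRHS]e3 ler_wpM2r ?expR_ge0.
  have A0 : 0 <= 2 * cst * z ^+ #|T'| * expR (- (w * #|Y|%:R)).
    by rewrite mulr_ge0 ?expR_ge0 // mulr_ge0 ?exprn_ge0 // mulr_ge0 // cst_ge0.
  move: (ler_wpM2l A0 e4); rewrite mulr1; apply: le_trans.
  rewrite le_eqVlt; apply/orP; left; apply/eqP.
  by move: cst (z ^+ _) (expR _) (expR _) (2 ^+ _) => x1 x2 x3 x4 x5; ring.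
rewrite -(pair_big (fun T' : graph n => T' \subset IP) (fun Y : {set 'I_n} => Y != set0)
   (fun T' Y => 2 * cst * z ^+ #|T'| * expR (- (w * #|Y|%:R)))) /=.
have eY : \sum_(Y : {set 'I_n} | Y != set0) expR (- (w * #|Y|%:R)) <= expR (nR * expR (- w)) - 1.
  rewrite lerBrDr; apply: le_trans (sum_sets_exp w).
  by rewrite [leRHS](bigD1 set0) //= cards0 mulr0 oppr0 expR0 addrC.
have ET : \sum_(T' : graph n | T' \subset IP) z ^+ #|T'| <= expR (z * (n * n)%:R).
  apply: le_trans (sum_subset_expr_le _ z_ge0) _.
  by rewrite ler_expR ler_wpM2l // ler_nat card_IP.
have eY0 : 0 <= \sum_(Y : {set 'I_n} | Y != set0) expR (- (w * #|Y|%:R)).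
  by apply: sumr_ge0 => Y _; exact: expR_ge0.
have eT0 : 0 <= \sum_(T' : graph n | T' \subset IP) z ^+ #|T'|.
  by apply: sumr_ge0 => T' _; exact: exprn_ge0.
under eq_bigr do rewrite -mulr_sumr.
rewrite -mulr_suml -mulr_sumr.
set sY := \sum_(_ | _ != _) _ in eY eY0 *; set sT := \sum_(_ | _) _ in ET eT0 *.
apply: (@le_trans _ _ (cst * (2 * sT * sY))).
  rewrite le_eqVlt; apply/orP; left; apply/eqP.
  by move: cst sT sY {eY eY0 ET eT0} => x1 x2 x3; ring.
by rewrite ler_wpM2l ?cst_ge0 // -mulrA -[leRHS]mulrA ler_wpM2l // ler_pM.
Qed.

End Cases.

Lemma bin_ratio (R : realType) (N i j : nat) (s : R) : (j <= i)%N -> (i <= N)%N ->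
  0 <= s -> i%:R <= s * (N - i)%:R -> 'C(N, j)%:R <= s ^+ (i - j) * 'C(N, i)%:R.
Proof.
move=> ji iN s0 hi; rewrite -{1}(subKn ji); move: (leq_subr j i); move: (i - j)%N => h.
elim: h => [|h IH] hl; first by rewrite subn0 expr0 mul1r.
have kE : (i - h = (i - h.+1).+1)%N by rewrite subnSK.
set k := (i - h.+1)%N in kE *.
have hb := mul_bin_left N k.
have kN : (k < N)%N by apply: leq_trans iN; rewrite -kE leq_subr.
have {}IH := IH (ltnW hl); rewrite kE in IH.
rewrite exprS -mulrA; apply: le_trans (ler_wpM2l s0 IH).
have Nk : 0 < (N - k)%:R :> R by rewrite ltr0n subn_gt0.
rewrite -(ler_pM2l Nk) -natrM -hb natrM mulrA ler_wpM2r //.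
apply: (@le_trans _ _ i%:R); first by rewrite ler_nat -kE leq_subr.
apply: le_trans hi _; rewrite mulrC ler_wpM2r // ler_nat leq_sub2l //.
by rewrite ltnW // -kE leq_subr.
Qed.

Lemma card_ffun_fixed (I A : finType) (D : {set I}) (g : I -> A) :
  (#|[set f : {ffun I -> A} | [forall j, (j \notin D) ==> (f j == g j)]]| <= #|A| ^ #|D|)%N.
Proof.
pose F j : {set A} := if j \in D then [set: A] else [set g j].
apply: (@leq_trans #|family (fun j => mem (F j))|).
  apply/subset_leq_card/subsetP => f; rewrite inE => /forallP h; apply/familyP => j.
  by rewrite /F; have := h j; case: (j \in D); rewrite ?inE.
rewrite card_family foldrE big_map big_enum /= (bigID (mem D)) /= [X in (_ * X)%N]big1 ?muln1.
  by rewrite -prod_nat_const; apply: leq_prod => j jD; rewrite /F jD cardsT.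
by move=> j /negPf jD; rewrite /F jD cards1.
Qed.

(** * Almost complete cross graphs *)

Section Dense.
Variables (R : realType) (n r m : nat) (P : labelling n r).
Local Notation EP := (EP P).
Local Notation IP := (IP P).
Local Notation N := (#|EP|).
Local Notation nR := (n%:R : R).
Variables (dm bb c ell : R).
Local Notation gs := (bad_graphs P m dm).
Local Notation c1 := (c ^+ r.-1 / 4).

Definition missing (G : graph n) : graph n := EP :\: G.

Hypotheses (n0 : (0 < n)%N) (r0 : (1 < r)%N) (c0 : 0 < c)
  (hc : forall i, c * nR <= #|part P i|%:R)
  (hW : forall G, G \in gs -> #|missing G|%:R <= bb * nR ^+ 2)
  (hb1 : bb <= (c1 / 4) ^+ r) (hb2 : bb <= c ^+ r.-1 / 2)
  (hell : 3 <= ell * (c1 / 4))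
  (hs : forall G, G \in gs -> #|missing G|%:R <= expR (- ell) * (N%:R - #|missing G|%:R)).

Lemma nR_gt0 : 0 < nR. Proof. by rewrite ltr0n. Qed.

(** Fixing two entries leaves [n^(r-2)] tuples. Here and below, powers of [n] are moved to the left
    to avoid truncated exponents. *)
Lemma valid_pair_count (f : {set 'I_n}) : f \in EP ->
  (#|[set tau : {ffun 'I_r -> 'I_n} | valid P tau && (f \subset im tau)]| * n ^ 2 <= n ^ r)%N.
Proof.
move=> /[dup] fE; rewrite inE => /andP[/cards2P[x [y [xy fxy]]] _].
have Pxy : P x != P y by rewrite -pair_EP -fxy.
set D := ~: [set P x; P y].
have D2 : (#|D| + 2 = r)%N.
  have h := cardsC [set P x; P y]; rewrite cards2 Pxy card_ord in h.
  by rewrite addnC.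
have -> : (n ^ r = n ^ #|D| * n ^ 2)%N by rewrite -expnD D2.
rewrite leq_mul2r; apply/orP; right.
rewrite -[X in (_ <= X ^ _)%N]card_ord.
apply: leq_trans (card_ffun_fixed D (fun j => if j == P x then x else y)).
apply/subset_leq_card/subsetP => tau; rewrite !inE fxy subUset !sub1set.
move=> /and3P[transv /imsetP[i _ xi] /imsetP[j _ yj]].
apply/forallP => k; apply/implyP; rewrite !inE negbK => /orP[]/eqP->.
  by rewrite eqxx xi (validE _ transv).
by rewrite [P y == P x]eq_sym (negPf Pxy) yj (validE _ transv).
Qed.

(** By (B), a vertex of inner degree [dg] has [dg] neighbours in each part, hence [dg ^ r] tuples of
    neighbours. Each contains a missing pair, and a missing pair lies in at most [n^(r-2)] of them;
    so [dg ^ r <= bb * n ^ r]. *)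
Lemma dense_degree G v : G \in gs -> (degT (inner P G) v)%:R <= c1 / 4 * nR.
Proof.
move=> Gg; have [gG kf _ cB _] := bad_graphsP Gg; rewrite leNgt; apply/negP => hlt.
set dg := degT (inner P G) v in hlt.
have hA j : (dg <= deg G v (part P j))%N.
  have [->|ji] := eqVneq j (P v); first by rewrite -(deg_inner _ _ gG).
  rewrite /dg (deg_inner _ _ gG).
  have /forall_inP := forallP cB (P v); move/(_ v).
  by rewrite inE eqxx => /(_ isT) /forallP /(_ j); rewrite ji.
pose A j := [set u in part P j | [set v; u] \in G].
have h1 : (dg ^ r <= \sum_(f in missing G) #|[set tau : {ffun 'I_r -> 'I_n} | valid P tau && (f \subset im tau)]|)%N.
  apply: (@leq_trans #|[set tau in family (fun j => mem (A j))]|).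
    rewrite cardsE card_family foldrE big_map big_enum /= -[X in (_ ^ X)%N]card_ord -prod_nat_const.
    by apply: leq_prod => j _; exact: hA.
  apply: card_le_cover => tau; rewrite inE => /familyP ht.
  have transv : valid P tau.
    by apply/forallP => j; have := ht j; rewrite !inE => /andP[].
  have hv j : [set v; tau j] \in G by have := ht j; rewrite inE => /andP[].
  have /subsetPn[f] := Kfree_nbhd gG kf transv hv.
  rewrite inE => /andP[fE fs] fG; exists f; first by rewrite /missing in_setD fG.
  by rewrite inE transv fs.
have h2 : (dg ^ r * n ^ 2 <= #|missing G| * n ^ r)%N.
  apply: leq_trans (leq_mul h1 (leqnn _)) _; rewrite big_distrl /= -sum_nat_const.
  by apply: leq_sum => f; rewrite /missing in_setD => /andP[_ /valid_pair_count].
have n2 : 0 < nR ^+ 2 by rewrite exprn_gt0 // nR_gt0.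
have c10 : 0 <= c1 / 4 by rewrite !divr_ge0 ?exprn_ge0 ?(ltW c0).
have : dg%:R ^+ r * nR ^+ 2 <= bb * nR ^+ 2 * nR ^+ r.
  apply: le_trans (ler_wpM2r (exprn_ge0 r (ltW nR_gt0)) (hW Gg)).
  by rewrite -!natrX -!natrM ler_nat.
rewrite mulrAC ler_pM2r // => h3.
have : (c1 / 4 * nR) ^+ r < dg%:R ^+ r.
  by rewrite ltr_pXn2r ?nnegrE ?(ltnW r0) // mulr_ge0 ?(ltW nR_gt0).
rewrite exprMn ltNge; apply/negP; rewrite negbK; apply: le_trans h3 _.
by rewrite ler_wpM2r ?exprn_ge0 ?(ltW nR_gt0).
Qed.

Definition tau_at (u : 'I_n) := [set tau : {ffun 'I_r -> 'I_n} | valid P tau && (tau (P u) == u)].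

Lemma card_tau_at u : (c * nR) ^+ r.-1 <= #|tau_at u|%:R.
Proof.
pose F j : {set 'I_n} := if j == P u then [set u] else part P j.
have -> : #|tau_at u| = (\prod_j #|F j|)%N.
  transitivity #|family (fun j => mem (F j))|; last by rewrite card_family foldrE big_map big_enum.
  apply: eq_card => tau; rewrite inE; apply/andP/familyP => [[transv /eqP tu] j|h].
    by rewrite /F; case: eqP => [->|_]; rewrite inE ?tu // (validE _ transv).
  split; last by have := h (P u); rewrite /F eqxx inE.
  apply/forallP => j; have := h j; rewrite /F; case: eqP => [->|_]; rewrite inE => // /eqP->.
  exact: eqxx.
rewrite natr_prod (bigD1 (P u)) //= {1}/F eqxx cards1 mul1r.
have <- : \prod_(j < r | j != P u) (c * nR) = (c * nR) ^+ r.-1.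
  by rewrite prodr_const; congr (_ ^+ _); rewrite (eq_card (B := [set~ P u])) ?cardsC1 ?card_ord // => j;
    rewrite !inE.
apply: ler_prod => j ju; rewrite mulr_ge0 ?(ltW c0) //=.
by rewrite /F (negPf ju) hc.
Qed.

Lemma tau_at_touch u x (ux : P x != P u) :
  (#|[set tau in tau_at u | x \in im tau]| * n <= n ^ r.-1)%N.
Proof.
set D := ~: [set P u; P x].
have D2 : (#|D|.+1 = r.-1)%N.
  have h := cardsC [set P u; P x]; rewrite cards2 eq_sym ux card_ord in h.
  by rewrite -[in RHS]h -/D.
rewrite -D2 expnSr leq_mul2r; apply/orP; right.
rewrite -[X in (_ <= X ^ _)%N]card_ord.
apply: leq_trans (card_ffun_fixed D (fun j => if j == P u then u else x)).
apply/subset_leq_card/subsetP => tau; rewrite !inE => /andP[/andP[transv /eqP tu] /imsetP[i _ xi]].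
apply/forallP => k; apply/implyP; rewrite !inE negbK => /orP[]/eqP->.
  by rewrite eqxx tu.
by rewrite (negPf ux) xi (validE _ transv).
Qed.

Lemma tau_at_pair u x y : P x != P y -> P x != P u -> P y != P u ->
  (#|[set tau in tau_at u | [set x; y] \subset im tau]| * n ^ 2 <= n ^ r.-1)%N.
Proof.
move=> xy xu yu.
set D := ~: [set P u; P x; P y].
have D2 : (#|D| + 2 = r.-1)%N.
  have h := cardsC [set P u; P x; P y]; rewrite card_ord -setUA cardsU1 cards2 xy in h.
  have h2 : P u \notin [set P x; P y] by rewrite !inE negb_or ![P u == _]eq_sym xu yu.
  have h3 : r = (3 + #|D|)%N by rewrite -[LHS]h h2 /D -setUA.
  by have := congr1 predn h3 => /= ->; rewrite addnC.
rewrite -D2 expnD leq_mul2r; apply/orP; right.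
rewrite -[X in (_ <= X ^ _)%N]card_ord.
apply: leq_trans (card_ffun_fixed D (fun j => if j == P u then u else if j == P x then x else y)).
apply/subset_leq_card/subsetP => tau; rewrite inE [tau \in _]inE subUset !sub1set.
move=> /andP[/andP[transv /eqP tu] /andP[/imsetP[i _ xi] /imsetP[j _ yj]]].
rewrite inE; apply/forallP => k; apply/implyP; rewrite !inE negbK => /orP[/orP[]|]/eqP->.
- by rewrite eqxx tu.
- by rewrite (negPf xu) eqxx xi (validE _ transv).
by rewrite (negPf yu) [P y == P x]eq_sym (negPf xy) yj (validE _ transv).
Qed.

(** Each of the [(c n)^(r-1)] tuples through [u] needs a missing cross pair in its copy. Missing
    pairs away from [u] and [v] lie in [n^(r-3)] copies each and, by [hb2], account for at most half
    of the tuples. Those at [u] or [v] lie in at most [n^(r-2)] copies each, so there are linearly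
    many. *)
Lemma dense_edge G u v : G \in gs -> [set u; v] \in inner P G ->
  c ^+ r.-1 / 2 * nR <= (degT (missing G) u)%:R + (degT (missing G) v)%:R.
Proof.
move=> Gg eT; have [gG kf _ _ _] := bad_graphsP Gg.
have eI := subsetP (inner_sub P gG) _ eT.
have eG : [set u; v] \in G by move: eT; rewrite /inner in_setD => /andP[].
have Puv : P u = P v by apply: (IPP eI); rewrite !inE eqxx ?orbT.
have nn : 0 < nR := nR_gt0.
pose cnt (f : {set 'I_n}) := #|[set tau in tau_at u | f \subset Kf [set u; v] tau]|.
have h1 : (#|tau_at u| <= \sum_(f in missing G) cnt f)%N.
  apply: card_le_cover => tau tt; have := tt; rewrite inE => /andP[transv /eqP tu].
  have te : tau (P u) \in [set u; v] by rewrite tu !inE eqxx.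
  have /subsetPn[f] := Kfree_edge kf eI eG transv te.
  rewrite inE => /andP[fE fs] fG; exists f; first by rewrite /missing in_setD fG.
  by rewrite inE tt fs.
have h2 (f : {set 'I_n}) : f \in missing G -> (cnt f)%:R <= nR ^+ r.-1 / nR ^+ 2 + ((u \in f)%:R + (v \in
  f)%:R) * (nR ^+ r.-1 / nR).
  move=> fW; have fE : f \in EP by move: fW; rewrite /missing in_setD => /andP[].
  have [x [y [xy fxy]]] : exists x y, P x != P y /\ f = [set x; y].
    have := fE; rewrite inE => /andP[/cards2P[x [y [_ fxy]]] _].
    by exists x, y; rewrite -pair_EP -fxy.
  have p1 : 0 <= nR ^+ r.-1 / nR ^+ 2 by rewrite divr_ge0 ?exprn_ge0 ?(ltW nn).
  have p2 : 0 <= nR ^+ r.-1 / nR by rewrite divr_ge0 ?exprn_ge0 ?(ltW nn).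
  have inK tau z : tau \in tau_at u -> z \in Kf [set u; v] tau -> z != u -> z != v -> z \in im tau.
    by move=> _; rewrite in_setU in_set2 => /orP[/orP[]/eqP->|//]; rewrite eqxx.
  have touchcase z z' : f = [set z; z'] -> P z != P z' -> (z == u) || (z == v) ->
      (cnt f)%:R <= nR ^+ r.-1 / nR.
    move=> fz zz zuv; rewrite ler_pdivlMr // -natrX -natrM ler_nat.
    have Pz : P z = P u by case/orP: zuv => /eqP->.
    have ux : P z' != P u by rewrite -Pz eq_sym.
    apply: leq_trans (tau_at_touch ux); rewrite leq_mul2r; apply/orP; right.
    apply/subset_leq_card/subsetP => tau; rewrite inE => /andP[tt /subsetP fs].
    rewrite inE tt /=; apply: (inK tau) => //.
    - by apply: fs; rewrite fz !inE eqxx orbT.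
    - by apply: contraNneq ux => ->.
    - by rewrite Puv in ux; apply: contraNneq ux => ->.
  have [xuv|xuv] := boolP ((x == u) || (x == v)).
    apply: le_trans (touchcase x y fxy xy xuv) _; apply: ler_wpDl => //.
    have : 1 <= (u \in f)%:R + (v \in f)%:R :> R.
      by move: xuv; rewrite fxy !inE ![_ == x]eq_sym => /orP[]->; rewrite ?orbT /= ?lerDl ?lerDr.
    by move=> h; rewrite -[leLHS]mul1r ler_wpM2r.
  have [yuv|yuv] := boolP ((y == u) || (y == v)).
    rewrite eq_sym in xy; apply: le_trans (touchcase y x _ xy yuv) _; first by rewrite setUC.
    apply: ler_wpDl => //.
    have : 1 <= (u \in f)%:R + (v \in f)%:R :> R.
      by move: yuv; rewrite fxy !inE ![_ == y]eq_sym => /orP[]->; rewrite ?orbT /= ?lerDl ?lerDr.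
    by move=> h; rewrite -[leLHS]mul1r ler_wpM2r.
  apply: ler_wpDr; first by rewrite mulr_ge0 // addr_ge0.
  rewrite ler_pdivlMr ?exprn_gt0 // -!natrX -natrM ler_nat.
  move: xuv yuv; rewrite !negb_or => /andP[xu xv] /andP[yu yv].
  have inP' tau : tau \in [set tau in tau_at u | f \subset Kf [set u; v] tau] ->
      [/\ tau \in tau_at u, x \in im tau & y \in im tau].
    rewrite inE => /andP[tt /subsetP fs]; split=> //.
      by apply: (inK tau) => //; apply: fs; rewrite fxy !inE eqxx.
    by apply: (inK tau) => //; apply: fs; rewrite fxy !inE eqxx orbT.
  have [t0|/set0Pn[tau0 /inP'[]]] := eqVneq [set tau in tau_at u | f \subset Kf [set u; v] tau] set0.
    by rewrite /cnt t0 cards0.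
  rewrite inE => /andP[vt0 /eqP tu0] /imsetP[i _ xi] /imsetP[j _ yj].
  have xPu : P x != P u.
    by apply: contraNneq xu => h; rewrite xi -tu0; apply/eqP; congr (tau0 _); rewrite -h xi (validE _ vt0).
  have yPu : P y != P u.
    by apply: contraNneq yu => h; rewrite yj -tu0; apply/eqP; congr (tau0 _); rewrite -h yj (validE _ vt0).
  apply: leq_trans (tau_at_pair xy xPu yPu); rewrite leq_mul2r; apply/orP; right.
  apply/subset_leq_card/subsetP => tau /inP'[tt h3 h4].
  by rewrite inE tt subUset !sub1set h3 h4.
have h3 : (c * nR) ^+ r.-1 <= #|missing G|%:R * (nR ^+ r.-1 / nR ^+ 2) +
    ((degT (missing G) u)%:R + (degT (missing G) v)%:R) * (nR ^+ r.-1 / nR).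
  apply: le_trans (card_tau_at u) _.
  apply: (@le_trans _ _ (\sum_(f in missing G) (nR ^+ r.-1 / nR ^+ 2 + ((u \in f)%:R + (v \in f)%:R) * (nR ^+
    r.-1 / nR)))).
    apply: (@le_trans _ _ (\sum_(f in missing G) cnt f)%:R); first by rewrite ler_nat.
    by rewrite natr_sum; apply: ler_sum => f; exact: h2.
  have dE w : (degT (missing G) w)%:R = \sum_(f in missing G) (w \in f)%:R :> R.
    rewrite /degT -sum1dep_card natr_sum big_mkcondr; apply: eq_bigr => f _.
    by case: (w \in f).
  by rewrite big_split /= sumr_const -mulr_suml big_split /= -!dE mulr_natl.
have h4 : #|missing G|%:R * (nR ^+ r.-1 / nR ^+ 2) <= bb * nR ^+ r.-1.
  apply: le_trans (ler_wpM2r _ (hW Gg)) _; first by rewrite divr_ge0 ?exprn_ge0 ?(ltW nn).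
  by rewrite le_eqVlt; apply/orP; left; apply/eqP; field; rewrite gt_eqF.
have {}h3 := le_trans h3 (lerD h4 (lexx _)).
have pw : 0 < nR ^+ r.-1 by rewrite exprn_gt0.
have h5 : c ^+ r.-1 * nR <= bb * nR + ((degT (missing G) u)%:R + (degT (missing G) v)%:R).
  rewrite -(ler_pM2r pw) -(ler_pM2r (_ : 0 < nR^-1)) ?invr_gt0 //.
  move: h3; rewrite exprMn; set A := nR ^+ r.-1; set B := (degT (missing G) u)%:R + (degT (missing G) v)%:R;
    set C := c ^+ _ => h3.
  have -> : C * nR * A / nR = C * A by field; rewrite gt_eqF.
  have -> : (bb * nR + B) * A / nR = bb * A + B * (A / nR) by field; rewrite gt_eqF.
  exact: h3.
have := ler_wpM2r (ltW nn) hb2; lra.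
Qed.

Definition poor (G : graph n) : {set 'I_n} := [set v | c1 * nR <= (degT (missing G) v)%:R].

Lemma poor_cover G e : G \in gs -> e \in inner P G -> ~~ [disjoint e & poor G].
Proof.
move=> Gg eT; have [gG _ _ _ _] := bad_graphsP Gg.
have eG : e \in G by move: eT; rewrite /inner in_setD => /andP[].
have /cards2P[a [b [_ eab]]] : #|e| == 2%N by apply: (forall_inP gG).
have := dense_edge (G := G) (u := a) (v := b) Gg; rewrite -eab => /(_ eT) h.
rewrite -setI_eq0; apply/set0Pn.
have [ha|ha] := boolP (a \in poor G); first by exists a; rewrite in_setI ha eab !inE eqxx.
have [hb|hb] := boolP (b \in poor G); first by exists b; rewrite in_setI hb eab !inE eqxx orbT.
move: ha hb; rewrite !inE -!ltNge => ha hb; exfalso.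
have := lt_le_trans (ltrD ha hb) (le_trans _ h); move: ha hb h.
have -> : c ^+ r.-1 / 2 * nR = c1 * nR + c1 * nR by field.
move=> ha hb h; have := le_lt_trans h (ltrD ha hb); by rewrite ltxx.
Qed.

Definition touch_cross (X : {set 'I_n}) : graph n := [set e in EP | ~~ [disjoint e & X]].

Lemma card_cross_edge e : e \in EP -> #|e| = 2.
Proof. by rewrite inE => /andP[/eqP]. Qed.

Lemma card_touch_cross X : (#|touch_cross X| <= #|X| * n)%N.
Proof. exact: card_touch_gen card_cross_edge. Qed.

Lemma card_inner_poor G : G \in gs -> #|inner P G|%:R <= c1 / 4 * nR * #|poor G|%:R.
Proof.
move=> Gg; apply: (@le_trans _ _ (\sum_(v in poor G) degT (inner P G) v)%:R).
  rewrite ler_nat; apply: leq_trans (card_touching _ _).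
  by apply/subset_leq_card/subsetP => e eT; rewrite inE eT (poor_cover Gg).
rewrite natr_sum [leRHS]mulrC mulr_natl -sumr_const; apply: ler_sum => v _; exact: dense_degree.
Qed.

Lemma card_missing_poor G : G \in gs -> c1 / 2 * nR * #|poor G|%:R <= #|missing G :&: touch_cross (poor G)|%:R.
Proof.
move=> Gg.
have h1 : (\sum_(v in poor G) degT (missing G) v <= 2 * #|missing G :&: touch_cross (poor G)|)%N.
  rewrite sum_degT (bigID (mem (touch_cross (poor G)))) /= [X in (_ + X)%N]big1 ?addn0; last first.
    move=> e /andP[eW]; rewrite inE; have -> : e \in EP by move: eW; rewrite /missing in_setD => /andP[].
    by rewrite /= negbK -setI_eq0 => /eqP->; rewrite cards0.
  rewrite mulnC -sum_nat_const.
  rewrite [leqRHS](eq_bigl (fun e => (e \in missing G) && (e \in touch_cross (poor G)))); last by move=> e;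
    rewrite in_setI.
  apply: leq_sum => e /andP[+ _]; rewrite /missing in_setD => /andP[_ /card_cross_edge e2].
  by apply: leq_trans (subset_leq_card (subsetIl _ _)) _; rewrite e2.
have h2 : c1 * nR * #|poor G|%:R <= 2 * #|missing G :&: touch_cross (poor G)|%:R.
  apply: (@le_trans _ _ (\sum_(v in poor G) degT (missing G) v)%:R).
    rewrite natr_sum mulrC mulr_natl -sumr_const; apply: ler_sum => v; by rewrite inE.
  by rewrite -natrM ler_nat.
lra.
Qed.

Lemma card_missing G : G \in gs -> (#|missing G| + m = N + #|inner P G|)%N.
Proof.
move=> Gg; have [_ _ Gm _ _] := bad_graphsP Gg; rewrite -Gm.
by rewrite -(cardsID EP G) addnA -/(inner P G) finset.setIC [(#|missing G| + _)%N]addnC cardsID.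
Qed.

(** The missing pairs at [X] exceed the inner edges by at least [c1 / 4 * n * #|X|]. With both sets
    fixed, the other missing pairs are that many fewer than [N - m], so by [hs] and [hell] the
    binomial drops by [expR (- 3 n #|X|)]. Choosing the two sets costs at most [expR (2 n #|X|)]. *)
Lemma poor_class_bound (X : {set 'I_n}) :
  #|[set G in gs | poor G == X]|%:R <= 'C(N, m)%:R * expR (- (nR * #|X|%:R)).
Proof.
set GG := [set G in gs | _].
set x := #|X|%:R : R.
pose w0 := c1 / 2 * nR * x; pose t0 := c1 / 4 * nR * x.
have c1p : 0 < c1 by rewrite divr_gt0 // exprn_gt0.
have ell0 : 0 < ell.
  have : 0 < ell * (c1 / 4) by apply: lt_le_trans hell; rewrite ltr0n.
  by rewrite pmulr_lgt0 // divr_gt0.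
have key (T1 W1 : graph n) : T1 \subset touch P X -> W1 \subset touch_cross X ->
   #|[set G in GG | (inner P G == T1) && (missing G :&: touch_cross X == W1)]|%:R <=
   'C(N, m)%:R * expR (- (3 * nR * x)) .
  move=> T1s W1s; set GR := [set G in GG | _].
  have GRP G : G \in GR -> [/\ G \in gs, poor G = X, inner P G = T1 & missing G :&: touch_cross X = W1].
    by rewrite in_set [G \in GG]in_set => /andP[/andP[-> /eqP->] /andP[/eqP-> /eqP->]].
  have [->|/set0Pn[G0 /GRP[G0g X0 T0 W0]]] := eqVneq GR set0.
    by rewrite cards0 mulr_ge0 // expR_ge0.
  have hT := card_inner_poor G0g; have hWc := card_missing_poor G0g.
  rewrite X0 T0 -/x -/t0 in hT; rewrite X0 W0 -/x -/w0 in hWc.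
  have hE := card_missing G0g; rewrite T0 in hE.
  set s := #|missing G0| in hE.
  have W1l : (#|W1| <= s)%N by rewrite -W0 subset_leq_card ?subsetIl.
  have tw0 : w0 - t0 = c1 / 4 * nR * x by rewrite /w0 /t0; field.
  have c14 : 0 <= c1 / 4 by rewrite divr_ge0 // ltW.
  have tw1 : 0 <= c1 / 4 * nR * x by rewrite mulr_ge0 // mulr_ge0.
  have tw : (#|T1| <= #|W1|)%N by rewrite -(ler_nat R); lra.
  have tl := leq_trans tw W1l.
  have mN : (m <= N)%N by move: hE tl; clear; lia.
  have sN : (s - #|T1| = N - m)%N by move: hE tl; clear; lia.
  apply: (@le_trans _ _ 'C(N, s - #|W1|)%:R).
    rewrite ler_nat -cards_draws -[#|GR|](card_in_imset (f := fun G => missing G :\: touch_cross X)).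
      apply/subset_leq_card/subsetP => _ /imsetP[G /GRP[Gg _ TG WG] ->].
      rewrite in_set; apply/andP; split.
        by apply: subset_trans (subsetDl _ _) _; rewrite /missing subsetDl.
      have := card_missing Gg; rewrite TG -hE => /eqP; rewrite eqn_add2r => /eqP sG.
      by rewrite -sG -(cardsID (touch_cross X) (missing G)) WG addKn.
    move=> G G' /GRP[Gg _ TG WG] /GRP[Gg' _ TG' WG'] h.
    have eW : missing G = missing G' by rewrite -(setID (missing G) (touch_cross X)) -(setID (missing G')
      (touch_cross X)) WG WG' h.
    apply/setP => e; have [eE|eE] := boolP (e \in EP).
      by have := congr1 (fun A : graph n => e \in A) eW; rewrite /missing /= !in_setD eE !andbT => /negb_inj.
    have := congr1 (fun A : graph n => e \in A) TG; rewrite -TG' /inner /= !in_setD eE //.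
  have hsig := hs G0g; rewrite -/s in hsig.
  have sig : (N - m)%:R <= expR (- ell) * (N - (N - m))%:R :> R.
    rewrite -sN; apply: (@le_trans _ _ s%:R); first by rewrite ler_nat leq_subr.
    have sl : (s <= N)%N by rewrite subset_leq_card // /missing subsetDl.
    apply: le_trans hsig _; rewrite ler_wpM2l ?expR_ge0 // -natrB // ler_nat.
    by rewrite leq_sub2l // leq_subr.
  have jl : (s - #|W1| <= N - m)%N by rewrite -sN leq_sub2l.
  apply: le_trans (bin_ratio jl (leq_subr _ _) (expR_ge0 _) sig) _.
  rewrite bin_sub // mulrC ler_wpM2l // -expRM_natr ler_expR mulNr lerN2.
  have -> : (N - m - (s - #|W1|) = #|W1| - #|T1|)%N by rewrite -sN; move: tw W1l; clear; lia.
  rewrite natrB //; apply: (@le_trans _ _ (ell * (c1 / 4 * nR * x))).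
    have := ler_wpM2r (mulr_ge0 (ler0n R n) (ler0n R #|X|)) hell; rewrite -/x; lra.
  rewrite ler_wpM2l ?(ltW ell0) //; lra.
apply: (@le_trans _ _ (\sum_(T1 : graph n | T1 \subset touch P X) \sum_(W1 : graph n | W1 \subset touch_cross X)
   'C(N, m)%:R * expR (- (3 * nR * x)))).
  rewrite -sum1_card natr_sum.
  rewrite (partition_big (fun G => inner P G) (fun T1 : graph n => T1 \subset touch P X)) /=; last first.
    move=> G; rewrite inE => /andP[Gg /eqP XG]; have [gG _ _ _ _] := bad_graphsP Gg.
    apply/subsetP => e eT; rewrite inE (subsetP (inner_sub P gG)) //= -XG; exact: poor_cover.
  apply: ler_sum => T1 T1s.
  rewrite (partition_big (fun G => missing G :&: touch_cross X) (fun W1 : graph n => W1 \subset touch_cross X))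
    /=; last first.
    by move=> G _; exact: subsetIr.
  apply: ler_sum => W1 W1s; apply: le_trans (key _ _ T1s W1s).
  rewrite -natr_sum ler_nat sum1_card.
  apply/subset_leq_card/subsetP => G h; rewrite in_set andbA; exact: h.
have two (U : graph n) : (#|U| <= #|X| * n)%N -> \sum_(T1 : graph n | T1 \subset U) (1 : R) <= expR (nR * x).
  move=> hU; have := @sum_subset_expr_le R _ U 1 ler01.
  under eq_bigr do rewrite expr1n.
  move=> h; apply: le_trans h _; rewrite ler_expR mul1r /x -natrM ler_nat mulnC; exact: hU.
set c3 := 'C(N, m)%:R * _.
have c30 : 0 <= c3 by rewrite mulr_ge0 // expR_ge0.
have E1 : \sum_(T1 : graph n | T1 \subset touch P X) \sum_(W1 : graph n | W1 \subset touch_cross X) c3 =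
   c3 * ((\sum_(T1 : graph n | T1 \subset touch P X) 1) * (\sum_(W1 : graph n | W1 \subset touch_cross X) 1)).
  rewrite mulr_suml mulr_sumr; apply: eq_bigr => T1 _.
  by rewrite mul1r mulr_sumr; apply: eq_bigr => W1 _; rewrite mulr1.
rewrite E1; apply: (@le_trans _ _ (c3 * (expR (nR * x) * expR (nR * x)))).
  rewrite ler_wpM2l // ler_pM ?sumr_ge0 ?two ?card_touch ?card_touch_cross //.
rewrite /c3 -mulrA ler_wpM2l // -!expRD ler_expR; lra.
Qed.

Lemma dense_case : #|gs|%:R <= 'C(N, m)%:R * (expR (nR * expR (- nR)) - 1).
Proof.
rewrite -sum1_card natr_sum.
rewrite (partition_big poor (fun X : {set 'I_n} => X != set0)) /=; last first.
  move=> G Gg; have [gG _ _ _ /set0Pn[e eT]] := bad_graphsP Gg.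
  have := poor_cover Gg eT; apply: contraNneq => ->; by rewrite -setI_eq0 finset.setI0.
apply: (@le_trans _ _ (\sum_(X : {set 'I_n} | X != set0) 'C(N, m)%:R * expR (- (nR * #|X|%:R)))).
  apply: ler_sum => X _; apply: le_trans (poor_class_bound X).
  rewrite -natr_sum ler_nat sum1_card.
  by apply/subset_leq_card/subsetP => G h; rewrite in_set; exact: h.
rewrite -mulr_sumr ler_wpM2l // lerBrDr; apply: le_trans (sum_sets_exp n nR).
by rewrite [leRHS](bigD1 set0) //= cards0 mulr0 oppr0 expR0 addrC.
Qed.

End Dense.

(** * Edge counts of the complete multipartite graph *)

Section Counts.
Variables (R : realType) (n r : nat) (P : labelling n r).
Local Notation EP := (EP P).

Lemma internal_inner G : is_graph G -> internal G P = #|inner P G|.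
Proof.
move=> gG; rewrite /internal /e_in.
have hI e : e \in G -> (e \in EP) || [exists i, e \subset part P i].
  move=> eG; have [//|eN] := boolP (e \in EP); apply/existsP.
  have eI : e \in IP P by rewrite inE eN andbT; exact: (forall_inP gG).
  have /card_gt0P[v ve] : (0 < #|e|)%N by rewrite (eqP (forall_inP gG _ eG)).
  by exists (P v); apply/subsetP => u ue; rewrite inE (IPP eI ue ve).
rewrite -sum1_card (eq_bigr (fun i => \sum_(e : {set 'I_n} | (e \in G) && (e \subset part P i)) 1)%N); last first.
  by move=> i _; rewrite sum1dep_card.
rewrite (exchange_big_dep (mem G)) /=; last by move=> i e _ /andP[].
rewrite [RHS]big_mkcond [LHS]big_mkcond; apply: eq_bigr => e _.
rewrite /inner in_setD; case: (boolP (e \in G)) => [eG|]; last by rewrite andbF.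
rewrite andbT (eq_bigl (fun i => e \subset part P i)) //.
have /cards2P[a [b [ab eab]]] := forall_inP gG _ eG.
have [eE|eN] := boolP (e \in EP); last first.
  have := hI _ eG; rewrite (negPf eN) /= => /existsP[i ei].
  rewrite (big_pred1 i) // => j /=; apply/idP/eqP => [ej|->//].
  have := subsetP ei a; have := subsetP ej a; rewrite eab !inE eqxx /= => /(_ isT)/eqP <- /(_ isT) /eqP //.
rewrite big1 // => i ei; move: eE; rewrite eab pair_EP.
have := subsetP ei a; have := subsetP ei b; rewrite eab !inE !eqxx orbT /=.
by move=> /(_ isT)/eqP-> /(_ isT)/eqP->; rewrite eqxx.
Qed.

Lemma card_EP_ge (c : R) : (1 < r)%N -> 0 <= c -> (forall i, c * n%:R <= #|part P i|%:R) ->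
  c ^+ 2 * n%:R ^+ 2 <= #|EP|%:R.
Proof.
move=> r1 c0 hc; pose i := Ordinal (ltnW r1); pose j := Ordinal r1.
have h : (#|part P i| * #|part P j| <= #|EP|)%N.
  rewrite -cardsX -(card_in_imset (f := fun x : 'I_n * 'I_n => [set x.1; x.2])).
    apply/subset_leq_card/subsetP => _ /imsetP[[u v] + ->] /=.
    by rewrite in_setX /= ![_ \in part _ _]inE => /andP[/eqP ui /eqP vj]; rewrite pair_EP ui vj.
  move=> [u v] [u' v']; rewrite !inE /= => /andP[/eqP ui /eqP vj] /andP[/eqP ui' /eqP vj'] e.
  have : u \in [set u'; v'] by rewrite -e !inE eqxx.
  have : v \in [set u'; v'] by rewrite -e !inE eqxx orbT.
  rewrite !inE => /orP[/eqP vu|/eqP->] /orP[/eqP->|/eqP uv] //.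
  - by move: vj; rewrite vu ui'.
  - by move: ui; rewrite uv vj'.
  - by move: ui; rewrite uv vj'.
apply: (@le_trans _ _ (#|part P i| * #|part P j|)%:R); last by rewrite ler_nat.
by rewrite natrM -exprMn expr2 ler_pM ?mulr_ge0.
Qed.

Lemma degT_EP v : (degT EP v + #|part P (P v)| <= n)%N.
Proof.
have -> : degT EP v = #|~: part P (P v)|; last by rewrite addnC cardsC card_ord.
rewrite /degT -(card_in_imset (f := fun u => [set v; u])); last first.
  move=> u u'; rewrite !inE => uv uv' h.
  have : u \in [set v; u'] by rewrite -h !inE eqxx orbT.
  by rewrite !inE => /orP[/eqP uu|/eqP//]; rewrite uu eqxx in uv.
apply: eq_card => e; apply/idP/imsetP.
  rewrite in_set => /andP[eE]; have /eqP/cards2P[a [b [ab eab]]] := card_cross_edge eE.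
  move: eE; rewrite eab pair_EP in_set2 => abP /orP[]/eqP->.
    by exists b; rewrite // !inE eq_sym.
  by exists a; rewrite 1?setUC // !inE.
by move=> [u]; rewrite in_setC [u \in _]inE => uv ->; rewrite in_set pair_EP eq_sym uv in_set2 eqxx.
Qed.

Lemma card_EP_le (c : R) : (forall i, c * n%:R <= #|part P i|%:R) ->
  2 * #|EP|%:R <= (1 - c) * n%:R ^+ 2.
Proof.
move=> hc.
have -> : 2 * #|EP|%:R = \sum_(v in [set: 'I_n]) (degT EP v)%:R :> R.
  rewrite -natrM -natr_sum sum_degT mulnC -sum_nat_const; congr (_%:R).
  by apply: eq_bigr => e eE; rewrite finset.setIT (card_cross_edge eE).
apply: (@le_trans _ _ (\sum_(v in [set: 'I_n]) ((1 - c) * n%:R))).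
  apply: ler_sum => v _; have := degT_EP v; rewrite -(ler_nat R) natrD.
  have := hc (P v); lra.
by rewrite sumr_const cardsT card_ord -[leLHS]mulr_natl expr2 mulrCA.
Qed.

End Counts.

(** * Powers of the density and elementary estimates *)

Section Powers.
Variables (R : realType).

Lemma bin2_double k : ('C(k.+1, 2) * 2 = k.+1 * k)%N.
Proof. by rewrite bin_ffact ffactnS ffactn1. Qed.

Variables (x z : R) (r : nat).
Hypotheses (z0 : 0 < z) (z1 : z <= 1) (x0 : 0 <= x) (hQ1 : 1 <= x * z ^+ r.+1).

Lemma pow_mono j : (j <= r.+1)%N -> x * z ^+ r.+1 <= x * z ^+ j.
Proof. by move=> jr; rewrite ler_wpM2l // ler_wiXn2l // ltW. Qed.

Lemma pow_base j : (j <= r.+1)%N -> 1 <= x * z ^+ j.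
Proof. by move=> jr; exact: le_trans (pow_mono jr). Qed.

(** With [x = n] and [z] the square root of the density, the half-integral exponents ['C(k, 2) / k]
    become integral. Counts of partial copies factor into powers of [x * z ^+ i] with [i <= r.+1],
    all at least 1 by [hQ1]. *)
Lemma pow_step j : x * (z ^+ 2) * (x * z ^+ j.+3) ^+ j = x ^+ j.+1 * (z ^+ 2) ^+ 'C(j.+2, 2).
Proof.
have -> : (z ^+ 2) ^+ 'C(j.+2, 2) = z ^+ 2 * z ^+ (j.+3 * j).
  by rewrite -exprM mulnC bin2_double -exprD; congr (_ ^+ _); lia.
by rewrite [(x * _) ^+ j]exprMn exprM [x ^+ j.+1]exprS; move: (z ^+ j.+3 ^+ j) => u; ring.
Qed.

Lemma pow_clique_le k : (0 < k)%N -> (k + 1 <= r)%N -> x * z ^+ 2 <= x ^+ k * (z ^+ 2) ^+ 'C(k.+1, 2).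
Proof.
case: k => // j _ jr; rewrite -pow_step ler_peMr ?mulr_ge0 ?exprn_ge0 ?(ltW z0) //.
by apply: exprn_ege1; apply: pow_base; lia.
Qed.

Lemma pow_tuple_le k : (2 <= k)%N -> (k <= r)%N -> x ^+ 2 * z ^+ 2 <= x ^+ k * (z ^+ 2) ^+ 'C(k, 2).
Proof.
case: k => [|[|j]] // _ jr; rewrite [x ^+ j.+2]exprS -mulrA -pow_step expr2 -mulrA ler_wpM2l //.
rewrite ler_peMr ?mulr_ge0 ?exprn_ge0 ?(ltW z0) //.
by apply: exprn_ege1; apply: pow_base; lia.
Qed.

Lemma pow_two_common_le k : (0 < k)%N -> (k + 2 <= r)%N ->
  x * z ^+ r.+1 <= x ^+ k * (z ^+ 2) ^+ ('C(k.+2, 2).-1).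
Proof.
move=> k0 kr.
have -> : x ^+ k * (z ^+ 2) ^+ ('C(k.+2, 2).-1) = (x * z ^+ k.+3) ^+ k.
  rewrite [RHS]exprMn -[z ^+ 2 ^+ _]exprM -[z ^+ k.+3 ^+ k]exprM; congr (_ * _ ^+ _).
  have := bin2_double k.+1; move: ('C(_, _)) => c; nia.
have k3 : (k.+3 <= r.+1)%N by lia.
apply: le_trans (pow_mono k3) _.
have := pow_base k3; set y := x * _ => y1; rewrite -(prednK k0) exprS.
by apply: ler_peMr; [exact: le_trans y1|exact: exprn_ege1].
Qed.

(* The number [d] of indices is only of the order of [x z^2], hence the weaker bound [d Qo]
   instead of that of [pow_tuple_le]. *)
Lemma pow_index_le (d Qo : R) c : 1 <= Qo -> Qo <= d * z ^+ r.-1 -> 0 <= d -> (2 <= c)%N -> (c < r)%N ->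
  d * Qo <= d ^+ c * (z ^+ 2) ^+ 'C(c, 2).
Proof.
move=> Qo1 hd d0; case: c => [|[|j]] // _ jr.
have -> : d ^+ j.+2 * (z ^+ 2) ^+ 'C(j.+2, 2) = d * (d * z ^+ j.+2) ^+ j.+1.
  rewrite -[z ^+ 2 ^+ _]exprM mulnC bin2_double [(d * _) ^+ _]exprMn -[z ^+ _ ^+ _]exprM [d ^+ j.+2]exprS
    -mulrA; congr (_ * (_ * _ ^+ _)).
rewrite ler_wpM2l //.
have h : Qo <= d * z ^+ j.+2.
  apply: le_trans hd _; rewrite ler_wpM2l // ler_wiXn2l // ?ltW //; lia.
have h1 : 1 <= d * z ^+ j.+2 by exact: le_trans h.
rewrite [(d * _) ^+ _]exprS; apply: le_trans h _; apply: ler_peMr; first exact: le_trans h1.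
exact: exprn_ege1.
Qed.

End Powers.

Section Misc.
Variable R : realType.

Lemma nat_floor (x : R) : 0 <= x -> exists k : nat, k%:R <= x /\ x < k%:R + 1.
Proof.
by move=> /truncn_itv /andP[h1 h2]; exists (Num.truncn x); rewrite natr1.
Qed.

Lemma nat_half_floor (x : R) : 1 <= x -> exists k : nat, [/\ (0 < k)%N, k%:R <= x & x / 2 <= k%:R].
Proof.
move=> x1; have [k [h1 h2]] := nat_floor (le_trans ler01 x1); exists k.
have k1 : (0 < k)%N by rewrite -(ltr_nat R) mulr0n; lra.
split=> //; have : 1 <= k%:R :> R by rewrite (ler_nat R 1 k). lra.
Qed.

Lemma fact_ge (d : nat) : (d%:R / expR 1) ^+ d <= d`!%:R :> R.
Proof.
case: d => [|d]; first by rewrite expr0 fact0.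
have e0 : 0 < expR 1 ^+ d.+1 :> R by rewrite exprn_gt0 // expR_gt0.
rewrite exprMn exprVn ler_pdivrMr // -expRM_natr mul1r.
have := @expR_ge1Dxn R d.+1%:R d (ler0n _ _).
have f0 : 0 < d.+1`!%:R :> R by rewrite ltr0n fact_gt0.
move=> h; rewrite mulrC -ler_pdivrMr //.
by apply: le_trans h; rewrite lerDr.
Qed.

Lemma expR_sub1_le (x : R) : 0 <= x -> x <= 1 -> expR x - 1 <= 3 * x.
Proof.
move=> x0 x1; have h := expR_ge1Dx (- (x / 2)).
have hx : expR x = (expR (- (x / 2)))^-1 ^+ 2.
  by rewrite -expRN opprK -expRM_natr; congr expR; field.
have e0 : 0 < 1 - x / 2 by lra.
have h2 : (expR (- (x / 2)))^-1 <= (1 - x / 2)^-1.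
  by rewrite lef_pV2 ?posrE ?expR_gt0 //; lra.
have h3 : (1 - x / 2)^-1 <= 1 + x.
  rewrite -[leLHS]mul1r ler_pdivrMr //; nra.
have h4 : 0 <= (expR (- (x / 2)))^-1 by rewrite invr_ge0 expR_ge0.
rewrite hx; nra.
Qed.

End Misc.

Lemma succ_pred k : (1 < k)%N -> (k.+1 = 2 + k.-1)%N.
Proof. lia. Qed.

Lemma pred_add j k : (0 < k)%N -> ((j + k).-1 = j + k.-1)%N.
Proof. lia. Qed.

Lemma agreeC (r : nat) (A : finType) (f h : {ffun 'I_r -> A}) : agree f h = agree h f.
Proof. by apply: eq_card => j; rewrite !inE eq_sym. Qed.

Lemma agree_full (r : nat) (A : finType) (f h : {ffun 'I_r -> A}) : f != h -> (agree f h < r)%N.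
Proof.
move=> fh; rewrite ltn_neqAle -ltnS agree_le andbT; apply: contra fh => /eqP e.
apply/eqP/ffunP => j.
have : [set j | f j == h j] == [set: 'I_r].
  by rewrite eqEcard finset.subsetT cardsT card_ord; exact: eq_leq (esym e).
by move=> /eqP/setP/(_ j); rewrite !inE => /eqP.
Qed.

Lemma exponent_arith (R : realType) (x1 x2 e X s0M G : R) :
  0 <= X -> x1 <= e / 32 -> x2 <= e / 32 -> e <= 2 * X -> 32 * s0M <= X -> 5 / 6 * X <= G ->
  s0M + x1 + x2 + x1 - G <= - (e / 8).
Proof. lra. Qed.

Lemma in_setIP (T : finType) (A : {set T}) (Q : pred T) x : x \in A -> (x \in [set y in A | Q y]) = Q x.
Proof. by rewrite inE => ->. Qed.

(** * The sparse regime *)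

Section Sparse.
Variables (R : realType) (n r m : nat) (P : labelling n r).
Local Notation EP := (EP P).
Local Notation IP := (IP P).
Local Notation N := (#|EP|).
Local Notation nR := (n%:R : R).
Local Notation mR := (m%:R : R).
Local Notation rR := (r%:R : R).
Local Notation C2 := ('C(r, 2)).
Local Notation Ee := ('C(r.+1, 2).-1).
Variables (zeta eta1 eta beta theta a s0 K dl c : R).
Variables (pm w p z mu mu0 L Q xi : R).
Local Notation rho := (pm / beta).
Local Notation lam := (4 * (K + ln 8)).
Local Notation kap := (expR (- lam)).
Local Notation B := (4 / a).
Local Notation A1 := (overlap_const r R * (2 * rR) ^+ r.-1).
(* [pm] is the density, [p] the slightly smaller density of the random set, [w] the average degree;
   [mu] is the mean number of copies closed by an edge and [mu0] its truncation at [16 L], where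
   [L = ln n]. The hypotheses [k_] constrain constants, the hypotheses [g_] hold for large [n]. *)
Hypotheses (r2 : (1 < r)%N) (n0 : (0 < n)%N) (m0 : (0 < m)%N) (N0 : (0 < N)%N).
Hypotheses (hpm : pm * N%:R = mR) (hmN : pm <= 1 - beta) (hw : w = nR * pm)
  (hp : p = (1 - zeta) ^+ 2 * pm) (hz : p = z ^+ 2) (z0 : 0 < z)
  (hmu : mu = (c * nR) ^+ r.-1 * p ^+ Ee) (hmu0L : L <= mu0) (hmu0mu : mu0 <= mu)
  (hmu016 : mu0 <= 16 * L) (L1 : 1 <= L) (hQ : Q = nR * z ^+ r.+1) (hxi : xi = expR (- theta)).
Hypotheses (c1 : (2 * rR)^-1 <= c) (c2 : c <= 1) (hc : forall i, c * nR <= #|part P i|%:R).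
Hypotheses (k1 : 0 < zeta) (k1' : zeta <= 2^-1) (k2 : 0 < eta1) (k2' : eta1 <= 6^-1)
  (k3 : A1 * (4 * rR + 7) * eta <= eta1) (k3' : 0 < eta) (k4 : 0 < beta) (k4' : beta <= 1)
  (k5 : 4 * xi * (theta + beta^-1) <= eta * eta1) (k5' : 0 <= theta)
  (k6 : a * (beta^-1 + 1) <= eta1) (k6' : 0 < a)
  (k7 : expR (- s0) * (4 * rR ^+ 2) / beta <= eta / 32) (k7' : 0 <= s0)
  (k8 : rR * ln (8 * expR 1 / (beta * xi)) + 16 * rR * (beta^-1 + B + 2) / xi <= K - 1) (k8' : 1 <= K)
  (k9 : 0 < dl) (k9' : dl * s0 <= eta / 32) (k9'' : dl * (32 * K * 2 ^+ r) <= kap)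
  (k9''' : dl * (1 + 2 * rR ^+ 3) <= zeta).
Hypotheses (g1 : 16 * L <= eta * Q) (g2 : 16 * L <= eta * w) (g3 : 2 * eta <= xi * mu0)
  (g4 : 32 * s0 <= mu0) (g5 : 8 <= xi * w) (g6 : 128 * K * 2 ^+ r <= xi * Q) (g6' : 1 <= Q)
  (g7 : 4 * K <= (xi / 8) ^+ r.-1 * mu) (g8 : xi <= dl * nR) (g9 : 1 <= c ^+ 2 * nR) (g10 : 1 <= w).

Lemma n_gt0_R : 0 < nR. Proof. by rewrite ltr0n. Qed.
Lemma r_ge2_R : 2 <= rR. Proof. by rewrite (ler_nat R 2). Qed.
Lemma xi_gt0 : 0 < xi. Proof. by rewrite hxi expR_gt0. Qed.
Lemma m_gt0_R : 0 < mR. Proof. by rewrite ltr0n. Qed.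
Lemma cross_gt0_R : 0 < N%:R :> R. Proof. by rewrite ltr0n. Qed.
Lemma pm_gt0 : 0 < pm.
Proof. by have := m_gt0_R; rewrite -hpm pmulr_lgt0 // cross_gt0_R. Qed.
Lemma zeta_compl_gt0 : 0 < 1 - zeta. Proof. by move: k1'; lra. Qed.
Lemma p_gt0 : 0 < p.
Proof. by rewrite hp mulr_gt0 ?exprn_gt0 ?zeta_compl_gt0 ?pm_gt0. Qed.
Lemma pm_le1 : pm <= 1. Proof. by move: hmN k4; lra. Qed.
Lemma p_le_pm : p <= pm.
Proof.
rewrite hp ler_piMl ?(ltW pm_gt0) // exprn_ile1 ?(ltW zeta_compl_gt0) //; by move: k1; lra.
Qed.
Lemma p_le1 : p <= 1. Proof. exact: le_trans p_le_pm pm_le1. Qed.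
Lemma pm_le_4p : pm <= 4 * p.
Proof.
rewrite hp mulrA ler_peMl ?(ltW pm_gt0) //.
have : (2^-1 : R) ^+ 2 <= (1 - zeta) ^+ 2.
  rewrite lerXn2r ?nnegrE ?(ltW zeta_compl_gt0) //; by move: k1'; lra.
rewrite exprVn; lra.
Qed.
Lemma z_le1 : z <= 1.
Proof. by have := p_le1; rewrite hz expr_le1 // ltW. Qed.
Lemma c_pos : 0 < c.
Proof. by apply: lt_le_trans c1; rewrite invr_gt0 mulr_gt0 // (lt_le_trans _ r_ge2_R). Qed.
Lemma mu0_gt0 : 0 < mu0. Proof. by move: hmu0L L1; lra. Qed.
Lemma mu_gt0 : 0 < mu. Proof. exact: lt_le_trans mu0_gt0 hmu0mu. Qed.
Lemma w_gt0 : 0 < w. Proof. by rewrite hw mulr_gt0 ?n_gt0_R ?pm_gt0. Qed.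
Lemma Q_gt0 : 0 < Q. Proof. exact: lt_le_trans ltr01 g6'. Qed.

Lemma cross_le_half_sq : 2 * N%:R <= nR ^+ 2.
Proof.
apply: le_trans (card_EP_le hc) _.
by rewrite ler_piMl ?exprn_ge0 ?(ltW n_gt0_R) //; have := c_pos; lra.
Qed.

Lemma sq_le_cross : nR ^+ 2 <= 4 * rR ^+ 2 * N%:R.
Proof.
have := card_EP_ge r2 (ltW c_pos) hc => h.
have h2 : (2 * rR)^-1 ^+ 2 <= c ^+ 2.
  by rewrite lerXn2r ?nnegrE ?(ltW c_pos) // invr_ge0 mulr_ge0.
have r0 : 0 < (2 * rR) ^+ 2 by rewrite exprn_gt0 // mulr_gt0 // (lt_le_trans _ r_ge2_R).
have := le_trans (ler_wpM2r (exprn_ge0 2 (ltW n_gt0_R)) h2) h.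
rewrite exprVn mulrC ler_pdivrMr // exprMn mulrC; congr (_ <= _); ring.
Qed.

Lemma w_le_m : w <= mR.
Proof.
rewrite hw -hpm mulrC ler_pM2l ?pm_gt0 //.
have := card_EP_ge r2 (ltW c_pos) hc; apply: le_trans.
by rewrite expr2 mulrA ler_peMl // ltW // n_gt0_R.
Qed.

Lemma nw_le_m : nR * w <= 4 * rR ^+ 2 * mR.
Proof.
rewrite hw -hpm mulrA -expr2 mulrC [leRHS]mulrCA ler_pM2l ?pm_gt0 //; exact: sq_le_cross.
Qed.

Lemma m_le_nw : 2 * mR <= nR * w.
Proof.
rewrite hw -hpm; have := ler_wpM2l (ltW pm_gt0) cross_le_half_sq; rewrite expr2; lra.
Qed.

Lemma m_le_cross : (m <= N)%N.
Proof. by rewrite -(ler_nat R) -hpm ler_piMl ?(ltW cross_gt0_R) // pm_le1. Qed.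

Lemma rho_gt0 : 0 < rho. Proof. by rewrite divr_gt0 ?pm_gt0. Qed.

Lemma bin_sub_le h : (h <= m)%N -> 'C(N, m - h)%:R <= rho ^+ h * 'C(N, m)%:R :> R.
Proof.
move=> hm; have := @bin_ratio R N m (m - h) rho (leq_subr _ _) m_le_cross (ltW rho_gt0).
rewrite subKn //; apply; rewrite natrB ?m_le_cross // -hpm mulrAC ler_pdivlMr //.
rewrite -mulrA ler_pM2l ?pm_gt0 //; have := ler_wpM2r (ltW cross_gt0_R) hmN; lra.
Qed.

Lemma rho_n : rho * nR = w / beta.
Proof. by rewrite hw mulrAC [nR * _]mulrC. Qed.

Section Choices.
Variables (D M : nat).
Hypotheses (D0 : (0 < D)%N) (D1 : D%:R <= eta * w / mu0) (D2 : eta * w / mu0 / 2 <= D%:R)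
  (M0 : (0 < M)%N) (M1 : M%:R <= eta * mR / mu0) (M2 : eta * mR / mu0 / 2 <= M%:R).
Variable hd : {set 'I_n} -> 'I_n.
Hypothesis hdP : forall e, e \in IP -> hd e \in e.
Local Notation q1 := (mu0 / mu).
Local Notation g := (mu0 * (1 - eta1)).

(** The bias [mu0 / mu] reduces the mean per edge to [mu0]. The sizes [D] and [M] are
    [eta * w / mu0] and [eta * m / mu0] up to rounding, precisely so that each of the three overlap
    terms times [mu0] is of order [eta]. *)
Lemma Psi_cliques_le (T' : graph n) : T' \subset IP -> (forall v, degT T' v <= D)%N -> (#|T'| <= M)%N ->
  Psi EP p q1 (clique_list P hd T') <= expR (- (g * #|T'|%:R)).
Proof.
move=> TI' TD TM.
have mu00 := mu0_gt0; have mup := mu_gt0; have cp := c_pos; have pp := p_gt0; have nn := n_gt0_R.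
have q10 : 0 <= q1 by rewrite divr_ge0 ?ltW.
have q11 : q1 <= 1 by rewrite ler_pdivrMr // mul1r.
have hQ1 : 1 <= nR * z ^+ r.+1 by rewrite -hQ.
have Q0 := Q_gt0.
have := @Psi_clique_list_le n r P R p q1 p_gt0 p_le1 q10 q11 hd hdP T' D Q TI' TD n0 Q0.
have E1 : (c * nR) ^+ r.-1 * q1 * p ^+ Ee = mu0.
  rewrite mulrAC -hmu mulrCA divff ?mulr1 // gt_eqF //.
move=> H.
have := H _ _ _ ((c * nR) ^+ r.-1) eta1; rewrite E1 => {}H.
have -> : - (g * #|T'|%:R) = - (#|T'|%:R * mu0 * (1 - eta1)) by ring.
apply: H.
- move=> k k0 kr; rewrite hQ hz; by apply: (@pow_two_common_le R nR z r) => //; exact: z_le1.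
- move=> k k0 kr; rewrite hz; by apply: (@pow_clique_le R nR z r) => //; exact: z_le1.
- move=> k k0 kr; rewrite hz; by apply: (@pow_tuple_le R nR z r) => //; exact: z_le1.
- move=> e eT; apply: (card_tau_at cp hc).
- by move: k2'; lra.
- by rewrite exprn_ge0 // mulr_ge0 // ltW.
have CC0 : 0 <= overlap_const r R by rewrite exprn_ge0.
have A10 : 0 <= A1 by rewrite mulr_ge0 // exprn_ge0 // mulr_ge0.
have E2 : q1 * (nR ^+ r.-1 * p ^+ Ee) <= (2 * rR) ^+ r.-1 * mu0.
  have -> : q1 * (nR ^+ r.-1 * p ^+ Ee) = (c^-1) ^+ r.-1 * mu0.
    rewrite -[in RHS]E1; move: q1 => q; rewrite exprMn exprVn.
    have x0 : c ^+ r.-1 != 0 by rewrite expf_neq0 // gt_eqF.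
    move: (c ^+ _) (nR ^+ _) (p ^+ _) x0 => x y u x0.
    by field.
  rewrite ler_wpM2r ?(ltW mu00) // lerXn2r ?nnegrE ?invr_ge0 ?(ltW cp) ?mulr_ge0 //.
  by rewrite -[leRHS]invrK lef_pV2 ?posrE ?invr_gt0 // mulr_gt0 // (lt_le_trans _ r_ge2_R).
have E3 : mu0 * Q^-1 <= eta.
  by rewrite ler_pdivrMr //; apply: le_trans hmu016 _.
have E4 : mu0 * (r.+1%:R * D%:R / (nR * p)) <= 4 * (rR + 1) * eta.
  rewrite mulrA ler_pdivrMr ?mulr_gt0 //.
  have h1 : mu0 * D%:R <= eta * w by move: D1; rewrite ler_pdivlMr // mulrC.
  have h2 : w <= 4 * (nR * p) by rewrite hw mulrCA ler_pM2l // pm_le_4p.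
  rewrite -natr1 [mu0 * _]mulrCA; apply: (@le_trans _ _ ((rR + 1) * (eta * w))).
    by rewrite ler_wpM2l // addr_ge0.
  have -> : 4 * (rR + 1) * eta * (nR * p) = (rR + 1) * (eta * (4 * (nR * p))) by ring.
  by rewrite ler_wpM2l ?addr_ge0 // ler_wpM2l // ltW.
have E5 : mu0 * (#|T'|%:R / (nR ^+ 2 * p)) <= 2 * eta.
  rewrite mulrA ler_pdivrMr ?mulr_gt0 ?exprn_gt0 //.
  have h1 : mu0 * #|T'|%:R <= eta * mR.
    apply: (@le_trans _ _ (mu0 * M%:R)); first by rewrite ler_wpM2l ?(ltW mu00) // ler_nat.
    by move: M1; rewrite ler_pdivlMr // mulrC.
  have h2 : mR <= 2 * (nR ^+ 2 * p).
    have := m_le_nw; rewrite hw mulrA -expr2 => h3.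
    have := ler_wpM2l (exprn_ge0 2 (ltW nn)) pm_le_4p; lra.
  apply: le_trans h1 _; have := ler_wpM2l (ltW k3') h2; lra.
set S := Q^-1 + _ + _.
have S0 : 0 <= S by rewrite !addr_ge0 ?invr_ge0 ?(ltW Q0) // divr_ge0 ?mulr_ge0 ?exprn_ge0 // ltW.
have E6 : mu0 * S <= (4 * rR + 7) * eta by rewrite /S !mulrDr; lra.
apply: (@le_trans _ _ ((2 * rR) ^+ r.-1 * mu0 * overlap_const r R * S)).
  by rewrite !ler_wpM2r.
have mul4 (x y u v : R) : x * y * u * v = u * x * (y * v) by ring.
by rewrite mul4; apply: le_trans k3; rewrite -[leRHS]mulrA ler_wpM2l.
Qed.

Variables (d' ymax : nat).
Local Notation d := d'.+1.
Local Notation dm := (dl * mR).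
Local Notation Yth := (xi * w).
Local Notation q2 := (4 * K * d%:R / (d%:R ^+ r * p ^+ C2)).
Local Notation Qo := (xi * Q / 8).
Local Notation O0 := (2 ^+ r * d%:R ^+ r * p ^+ C2 / (d%:R * Qo)).
Local Notation G0 := (2 ^+ r * p ^+ C2 * (ymax * d ^ r)%:R / (kap * (nR ^+ 2 * p))).
Local Notation u2 := ((nR ^+ r) ^+ d * (2 * expR (- (K * d%:R)))).
Local Notation b := (2 * rR * (beta^-1 + B + 2) * w).
Hypotheses (d1 : d%:R <= xi * w / 4) (d2 : xi * w / 8 <= d%:R)
  (y0 : (0 < ymax)%N) (y1 : 2 * dm <= ymax%:R * Yth) (y2 : ymax%:R <= 2 * dl * nR / xi).

Lemma d_ge1 : 1 <= d%:R :> R. Proof. by rewrite (ler_nat R 1). Qed.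
Lemma Qo_ge1 : 1 <= Qo.
Proof.
have h : 1 <= (2 : R) ^+ r by rewrite exprn_ege1 // ler1n.
rewrite ler_pdivlMr // mul1r; apply: le_trans g6.
have : 1 <= K * 2 ^+ r by rewrite -[leLHS]mulr1 ler_pM.
lra.
Qed.

Lemma xi_np_le_d : xi / 8 * (nR * z ^+ 2) <= d%:R.
Proof.
apply: le_trans d2; rewrite -hz hw mulrAC ler_pM2r // !ler_wpM2l ?(ltW xi_gt0) ?(ltW n_gt0_R) //.
exact: p_le_pm.
Qed.

Lemma Qo_le_dz : Qo <= d%:R * z ^+ r.-1.
Proof.
have := ler_wpM2r (exprn_ge0 r.-1 (ltW z0)) xi_np_le_d; apply: le_trans.
have -> : Q = nR * (z ^+ 2 * z ^+ r.-1) by rewrite hQ -exprD; congr (_ * _ ^+ _); exact: succ_pred.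
by move: (z ^+ 2) (z ^+ r.-1) => x y; rewrite le_eqVlt; apply/orP; left; apply/eqP; field.
Qed.

Lemma pC2_gt0 : 0 < p ^+ C2. Proof. by rewrite exprn_gt0 // p_gt0. Qed.

Lemma Ee_split : Ee = (C2 + r.-1)%N.
Proof. by rewrite binS bin1 pred_add // ltnW. Qed.

(** Makes [q2] at most 1: as [d] is of order [n p], the product [d ^+ r.-1 * p ^+ C2] is of the
    order of [mu]. *)
Lemma q2_num_le : 4 * K * d%:R <= d%:R ^+ r * p ^+ C2.
Proof.
have d0 : 0 < d%:R :> R by exact: lt_le_trans d_ge1.
have dE : d%:R ^+ r = d%:R * d%:R ^+ r.-1 :> R by rewrite -exprS prednK // ltnW.
rewrite dE mulrC -mulrA ler_pM2l //; apply: le_trans g7 _.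
have muE : mu = (c * (nR * p)) ^+ r.-1 * p ^+ C2.
  rewrite hmu Ee_split exprD !exprMn; move: (c ^+ _) (nR ^+ _) (p ^+ _) (p ^+ _) => x1 x2 x3 x4; ring.
rewrite muE mulrA -exprMn ler_pM2r ?pC2_gt0 // lerXn2r ?nnegrE ?(ltW d0) //.
  by rewrite mulr_ge0 ?divr_ge0 ?mulr_ge0 ?(ltW xi_gt0) ?(ltW c_pos) ?(ltW n_gt0_R) ?(ltW p_gt0).
apply: le_trans xi_np_le_d; rewrite -hz; apply: ler_wpM2l; first by rewrite divr_ge0 // (ltW xi_gt0).
by rewrite ler_piMl // mulr_ge0 ?(ltW n_gt0_R) ?(ltW p_gt0).
Qed.

Lemma q2_01 : 0 <= q2 <= 1.
Proof.
have dp : 0 < d%:R ^+ r * p ^+ C2 by rewrite mulr_gt0 ?pC2_gt0 // exprn_gt0 // ltr0n.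
have K0 : 0 <= K by apply: le_trans k8'.
apply/andP; split; first by rewrite divr_ge0 ?(ltW dp) // !mulr_ge0.
by rewrite ler_pdivrMr // mul1r q2_num_le.
Qed.

Lemma kap_gt0 : 0 < kap. Proof. exact: expR_gt0. Qed.

Lemma G0_gt0 : 0 < G0.
Proof.
apply: divr_gt0; last by rewrite mulr_gt0 ?kap_gt0 // mulr_gt0 ?p_gt0 // exprn_gt0 // n_gt0_R.
apply: mulr_gt0; last by rewrite ltr0n muln_gt0 y0 expn_gt0.
by rewrite mulr_gt0 ?pC2_gt0 // exprn_gt0.
Qed.

Lemma own_overlap_le (k : {ffun 'I_r -> 'I_d}) :
  \sum_(k' | (k' != k) && (2 <= agree k k')%N) p ^+ (C2 - 'C(agree k k', 2)) <= O0.
Proof.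
have d0 : 0 < d%:R :> R by exact: lt_le_trans d_ge1.
have Qo0 : 0 < Qo by apply: lt_le_trans Qo_ge1.
have hQ1 : 1 <= nR * z ^+ r.+1 by rewrite -hQ.
have H := @agree_sum R r 'I_d p p_gt0 k (fun c => (2 <= c) && (c < r))%N (d%:R * Qo).
rewrite card_ord in H; apply: le_trans (H _ _); last 2 first.
- by rewrite mulr_gt0.
- by move=> x /andP[x2 xr] _; rewrite hz; exact: (pow_index_le z0 z_le1 (ltW n_gt0_R) hQ1 Qo_ge1 Qo_le_dz (ltW
  d0) x2 xr).
rewrite big_mkcond [leRHS]big_mkcond; apply: ler_sum => k' _.
case: ifP => [/andP[kk ag]|_]; last by case: ifP => // _; rewrite exprn_ge0 // ltW // p_gt0.
by rewrite agreeC in ag *; rewrite ag agree_full.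
Qed.

Lemma mean_overlap_le (t' : {ffun 'I_r -> 'I_n}) :
  \sum_(t | (2 <= agree t t')%N) p ^+ (C2 - 'C(agree t t', 2)) * (ymax * d ^ r)%:R <=
  kap * G0 * nR ^+ r.
Proof.
have kk := kap_gt0; have pp := p_gt0; have nn := n_gt0_R; have hQ1 : 1 <= nR * z ^+ r.+1 by rewrite -hQ.
rewrite -mulr_suml.
have H := @agree_sum R r 'I_n p p_gt0 t' (fun c => (2 <= c))%N (nR ^+ 2 * p).
rewrite card_ord in H; apply: le_trans (ler_wpM2r _ (H _ _)) _ => //.
- by rewrite mulr_gt0 // exprn_gt0.
- by move=> x x2 xr; rewrite hz; apply: (@pow_tuple_le R nR z r) => //; exact: z_le1.
rewrite le_eqVlt; apply/orP; left; apply/eqP.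
have e1 : kap != 0 by rewrite gt_eqF.
have e2 : nR != 0 by rewrite gt_eqF.
have e3 : p != 0 by rewrite gt_eqF.
move: kap e1 ((ymax * d ^ r)%:R : R) (2 ^+ r : R) (nR ^+ r) (p ^+ C2) => k e1 x1 x2 x3 x4.
by field; rewrite e1 e2 e3.
Qed.

(** Overlaps within one array are small because [Q] is large; those with earlier arrays because
    there are at most [2 * dl * n / xi] heavy vertices. Here [dl] has to be small compared with
    [kap]. *)
Lemma overlap_le_half : q2 * (O0 + G0) <= 2^-1.
Proof.
have kk := kap_gt0; have pp := p_gt0; have nn := n_gt0_R; have xx := xi_gt0; have QQ := Q_gt0.
have d0 : 0 < d%:R :> R by exact: lt_le_trans d_ge1.
have dr : 0 < d%:R ^+ r :> R by rewrite exprn_gt0.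
have p2 := pC2_gt0; have K0 : 0 < K by apply: lt_le_trans k8'.
have e1 : kap != 0 by rewrite gt_eqF.
have e2 : nR != 0 by rewrite gt_eqF.
have e3 : p != 0 by rewrite gt_eqF.
have e4 : xi != 0 by rewrite gt_eqF.
have e5 : Q != 0 by rewrite gt_eqF.
have e6 : d%:R != 0 :> R by rewrite gt_eqF.
have h1 : q2 * O0 = 32 * K * 2 ^+ r / (xi * Q).
  have e7 : d%:R ^+ r != 0 :> R by rewrite gt_eqF.
  have e8 : p ^+ C2 != 0 by rewrite gt_eqF.
  move: (d%:R ^+ r : R) (p ^+ C2) (d%:R : R) (2 ^+ r : R) e6 e7 e8 => x1 x2 x3 x4 e6 e7 e8.
  by field; rewrite e4 e5 e6 e7 e8.
have h2 : q2 * G0 = 4 * K * 2 ^+ r * d%:R * ymax%:R / (kap * (nR ^+ 2 * p)).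
  rewrite natrM natrX.
  have e7 : d%:R ^+ r != 0 :> R by rewrite gt_eqF.
  have e8 : p ^+ C2 != 0 by rewrite gt_eqF.
  move: kap e1 (d%:R ^+ r : R) (p ^+ C2) (d%:R : R) (2 ^+ r : R) e6 e7 e8 => k e1 x1 x2 x3 x4 e6 e7 e8.
  by field; rewrite e1 e2 e3 e7 e8.
rewrite mulrDr h1 h2.
have b1 : 32 * K * 2 ^+ r / (xi * Q) <= 4^-1.
  rewrite ler_pdivrMr ?mulr_gt0 //; move: g6; lra.
have b2 : 4 * K * 2 ^+ r * d%:R * ymax%:R / (kap * (nR ^+ 2 * p)) <= 4^-1.
  rewrite ler_pdivrMr ?mulr_gt0 ?exprn_gt0 //.
  have f1 : d%:R <= xi * (nR * p).
    apply: le_trans d1 _; rewrite hw; have := ler_wpM2l (ltW (mulr_gt0 xx nn)) pm_le_4p; lra.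
  have f2 : d%:R * ymax%:R <= xi * (nR * p) * (2 * dl * nR / xi) by apply: ler_pM.
  have f3 : xi * (nR * p) * (2 * dl * nR / xi) = 2 * dl * (nR ^+ 2 * p) by field.
  rewrite f3 in f2.
  have K4 : 0 <= 4 * K * 2 ^+ r by rewrite !mulr_ge0 ?exprn_ge0 ?(ltW K0).
  have f4 := ler_wpM2l K4 f2.
  have n2p : 0 <= nR ^+ 2 * p by rewrite mulr_ge0 ?exprn_ge0 ?(ltW nn) ?(ltW pp).
  have f5 := ler_wpM2r n2p k9''.
  rewrite -mulrA; apply: le_trans f4 _; move: f5; move: (nR ^+ 2 * p) (2 ^+ r : R) kap => x1 x2 x3; lra.
lra.
Qed.

Lemma sum_Psi_greedy_le y : (y <= ymax)%N ->
  \sum_(t : y.-tuple {ffun 'I_r -> {ffun 'I_d -> 'I_n}} | all (valid_array P) t)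
    Psi EP p q2 (map (cross_edges P) (greedy p G0 t)) <= u2 ^+ y.
Proof.
move=> yl; have /andP[q20 q21] := q2_01.
have ln8 : 0 <= ln 8 :> R by rewrite ln_ge0 // ler1n.
have lam0 : 0 <= lam by move: k8'; lra.
have H := @greedy_sum R n r d' P p q2 p_gt0 p_le1 q20 q21 G0 O0 own_overlap_le overlap_le_half ymax kap lam
  G0_gt0 lam0 (ltW kap_gt0) mean_overlap_le.
apply: le_trans (H y (leqW yl)) _.
rewrite lerXn2r ?nnegrE ?greedy_factor_ge0 ?(ltW kap_gt0) //.
rewrite /greedy_factor; apply: ler_wpM2l; first by rewrite !exprn_ge0.
have d0 : d%:R ^+ r != 0 :> R by rewrite expf_neq0 // pnatr_eq0.
have -> : q2 * d%:R ^+ r * p ^+ C2 / 4 = K * d%:R.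
  have e1 : p ^+ C2 != 0 by rewrite gt_eqF // pC2_gt0.
  move: (d%:R ^+ r : R) (p ^+ C2) d0 e1 => x1 x2 e1 e2; field; by rewrite e1 e2.
(* The choice [lam = 4 * (K + ln 8)] and [kap = expR (- lam)] bounds the proportion of bad arrays by
   [4 * (expR (- K) / 4) ^+ d], no more than the gain [expR (- K * d)] of a good one. *)
have -> : 1 + kap * expR lam = 2 by rewrite -expRD addNr expR0.
have -> : expR (- (lam / 4)) * 2 = 4^-1 * expR (- K).
  have -> : - (lam / 4) = - K + (- ln 8) by field.
  rewrite expRD [expR (- ln 8)]expRN lnK ?posrE //; move: (expR _) => x; by field.
have -> : expR (- (K * d%:R)) = expR (- K) ^+ d by rewrite -expRM_natr mulNr.
rewrite exprMn [leRHS]mulr_natl mulr2n lerD2l mulrA ler_piMl ?exprn_ge0 ?expR_ge0 //.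
rewrite exprS mulrA divff ?mul1r ?exprn_ile1 // ?invf_le1 ?ler1n //.
Qed.

(** Since [d >= xi * w / 8] and [d! >= (d / e) ^ d], weighted arrays modulo orderings number at most
    a constant to the power [r * d]; by [k8] the factor [expR (- K * d)] beats this and [expR b]. *)
Lemma greedy_vs_arrays : rho ^+ (r * d) * u2 <= expR (- b) * (d`! ^ r)%:R.
Proof.
have nn := n_gt0_R; have ww := w_gt0; have xx := xi_gt0; have rr := r_ge2_R.
set y : R := 8 * expR 1 / (beta * xi).
have yp : 0 < y by rewrite divr_gt0 ?mulr_gt0 ?expR_gt0.
have -> : rho ^+ (r * d) * u2 = (w / beta) ^+ (r * d) * (2 * expR (- (K * d%:R))).
  by rewrite -rho_n [(rho * nR) ^+ _]exprMn [nR ^+ (r * d)]exprM mulrA.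
have h1 : w / beta <= y * (d%:R / expR 1).
  have -> : y * (d%:R / expR 1) = (8 * d%:R / xi) / beta.
    by rewrite /y; field; rewrite !gt_eqF // expR_gt0.
  rewrite ler_pM2r ?invr_gt0 // ler_pdivlMr //; move: d2; lra.
have h2 : (w / beta) ^+ (r * d) <= y ^+ (r * d) * (d`! ^ r)%:R.
  apply: le_trans (_ : (y * (d%:R / expR 1)) ^+ (r * d) <= _).
    have i1 : 0 <= w / beta by rewrite divr_ge0 ?(ltW ww) ?(ltW k4).
    by rewrite lerXn2r ?nnegrE // (le_trans i1 h1).
  rewrite exprMn ler_wpM2l ?exprn_ge0 ?(ltW yp) // natrX mulnC exprM lerXn2r ?nnegrE //.
  exact: fact_ge.
have F0 : 0 <= (d`! ^ r)%:R :> R by [].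
apply: (@le_trans _ _ (y ^+ (r * d) * (d`! ^ r)%:R * (2 * expR (- (K * d%:R))))).
  by rewrite ler_wpM2r // mulr_ge0 ?expR_ge0.
rewrite mulrAC ler_wpM2r //.
have -> : y ^+ (r * d) = expR (ln y * (r * d)%:R) by rewrite expRM_natr lnK ?posrE.
have h3 : 2 <= expR d%:R :> R by apply: le_trans (expR_ge1Dx _); have := d_ge1; lra.
apply: (@le_trans _ _ (expR (ln y * (r * d)%:R) * (expR d%:R * expR (- (K * d%:R))))).
  by rewrite ler_wpM2l ?expR_ge0 // ler_wpM2r ?expR_ge0.
rewrite -!expRD ler_expR natrM.
have S0 : 0 <= beta^-1 + B + 2 by rewrite !addr_ge0 ?invr_ge0 ?(ltW k4) ?divr_ge0 ?(ltW k6').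
have h4 : b <= 16 * rR * (beta^-1 + B + 2) / xi * d%:R.
  have h : w <= 8 / xi * d%:R by rewrite mulrAC ler_pdivlMr //; move: d2; lra.
  have S1 : 0 <= 2 * rR * (beta^-1 + B + 2) by rewrite !mulr_ge0.
  apply: le_trans (ler_wpM2l S1 h) _.
  by rewrite le_eqVlt; apply/orP; left; apply/eqP; move: B => B'; field; rewrite !gt_eqF.
have h5 := ler_wpM2r (ler0n R d) k8; rewrite -/y in h5.
move: h4 h5; move: (ln y) (16 * _ * _ / _) => x1 x2; lra.
Qed.

Lemma density_margin : N%:R * p <= (1 - zeta) * (mR - dm - (ymax * r * d)%:R).
Proof.
have xx := xi_gt0; have nn := n_gt0_R.
(* One factor [1 - zeta] of [p] serves Markov's inequality in the transfer, the other makes room for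
   inner and array edges. *)
have -> : N%:R * p = (1 - zeta) * ((1 - zeta) * mR) by rewrite hp -hpm; ring.
rewrite ler_pM2l ?zeta_compl_gt0 // !natrM.
have h1 : ymax%:R * d%:R <= 2 * dl * nR / xi * (xi * w / 4) by apply: ler_pM.
have e1 : 2 * dl * nR / xi * (xi * w / 4) = dl / 2 * (nR * w) by field; rewrite gt_eqF.
rewrite e1 in h1.
have h2 : ymax%:R * d%:R <= dl / 2 * (4 * rR ^+ 2 * mR).
  by apply: le_trans h1 _; rewrite ler_wpM2l ?nw_le_m // divr_ge0 // ltW.
have h3 := ler_wpM2r (ler0n R r) h2.
have h4 := ler_wpM2r (ltW m_gt0_R) k9'''.
have h5 : ymax%:R * rR * d%:R = ymax%:R * d%:R * rR by ring.
rewrite h5; move: h3 h4; rewrite [rR ^+ 3]exprS; move: (rR ^+ 2) (ymax%:R * d%:R) => x1 x2; lra.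
Qed.

Lemma sat_cost_le : sat_cost n rho theta Yth D <= eta1 * mu0.
Proof.
have ww := w_gt0; have xx := xi_gt0; have mm0 := mu0_gt0.
have dp : 0 < D%:R :> R by rewrite ltr0n.
rewrite /sat_cost -hxi -[xi * rho * nR]mulrA rho_n ler_pdivrMr //.
have h := ler_wpM2l (ltW (mulr_gt0 k2 mm0)) D2; apply: le_trans h.
have -> : eta1 * mu0 * (eta * w / mu0 / 2) = eta * eta1 * w / 2 by field; rewrite gt_eqF.
have := ler_wpM2r (ltW ww) k5; move: (beta^-1) => x; lra.
Qed.

Lemma sparse_bound_choices :
  #|bad_graphs P m dm|%:R <= zeta^-1 * 'C(N, m)%:R *
    (expR (- (eta * mR / 8)) +
     (expR (nR * expR (- w)) * (expR (rho * expR (- (mu0 * (1 - 3 * eta1))) * (n * n)%:R) - 1) +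
      2 * expR (rho * expR (- (mu0 * (1 - 3 * eta1))) * (n * n)%:R) * (expR (nR * expR (- w)) - 1))).
Proof.
have nn := n_gt0_R; have ww := w_gt0; have xx := xi_gt0; have rr := r_ge2_R; have mm0 := mu0_gt0.
have mup := mu_gt0; have zz : zeta <= 1 by move: k1'; lra.
have cst0 : 0 <= zeta^-1 * 'C(N, m)%:R by rewrite mulr_ge0 // invr_ge0 ltW.
have q10 : 0 <= q1 by rewrite divr_ge0 ?ltW.
have q11 : q1 <= 1 by rewrite ler_pdivrMr // mul1r.
have /andP[q20 q21] := q2_01.
have rho0 := ltW rho_gt0.
have B0 : 0 <= B by rewrite divr_ge0 // ltW.
have Yth0 : 0 < Yth by rewrite mulr_gt0.
have a10 : 0 <= a * mu0 by rewrite mulr_ge0 // ltW.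
have hYD : (d.*2 + D)%:R <= Yth.
  rewrite natrD -muln2 natrM.
  have h : eta * w / mu0 <= xi * w / 2.
    rewrite ler_pdivrMr //; have := ler_wpM2r (ltW ww) g3; lra.
  move: D1 d1; lra.
have u20 : 0 <= u2 by rewrite mulr_ge0 ?exprn_ge0 ?mulr_ge0 ?expR_ge0.
have hL (s : seq {ffun 'I_r -> {ffun 'I_d -> 'I_n}}) t : t \in greedy p G0 s -> exists2 a, a \in s & exists k,
  t = tup a k by exact: greedyP.
have hb : rho * nR + B * w + 1 + w <= b / (2 * rR).
  have -> : b / (2 * rR) = (beta^-1 + B + 2) * w.
    by move: B => B'; field; rewrite !gt_eqF // (lt_le_trans _ rr).
  rewrite rho_n [w / beta]mulrC; move: g10 B => g B'; lra.
have r0 : (0 < r)%N by exact: ltnW r2.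
have C1 := large_core_bound hdP p_gt0 p_le1 q10 q11 k1 zz rho0 k7' m_le_cross bin_sub_le density_margin
  Psi_cliques_le k7'.
have C2a := few_heavy_bound hdP p_gt0 p_le1 q10 q11 k1 zz rho0 k5' m_le_cross bin_sub_le density_margin Yth0 D0
  M0 ww Psi_cliques_le (a * mu0).
have C2b := @many_heavy_bound R n r m P p q2 zeta rho theta dm Yth w D M ymax d' p_gt0 p_le1 q20 q21 k1 zz rho0
  k5' m_le_cross bin_sub_le density_margin Yth0 y1 D0 ww (a * mu0) a10 hYD r0 (greedy p G0) u2 b B hL u20
    sum_Psi_greedy_le greedy_vs_arrays B0 hb.
set Z := rho * expR (- (mu0 * (1 - 3 * eta1))) * (n * n)%:R.
have hX := sat_cost_le.
have n2 : 0 <= (n * n)%:R :> R by [].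
(* The loss [3 * eta1] has three equal sources: overlaps of copies, edges at saturated vertices, and
   edges at heavy vertices. *)
have Za : rho * expR (sat_cost n rho theta Yth D + a * mu0 * (rho * nR + w) / w - g) * (n * n)%:R <= Z.
  rewrite ler_wpM2r // ler_wpM2l // ler_expR rho_n.
  have -> : a * mu0 * (w / beta + w) / w = mu0 * (a * (beta^-1 + 1)) by field; rewrite !gt_eqF.
  have := ler_wpM2l (ltW mm0) k6; move: (beta^-1) hX => x; lra.
have Zb : rho * expR (sat_cost n rho theta Yth D - B * (a * mu0)) * (n * n)%:R <= Z.
  rewrite ler_wpM2r // ler_wpM2l // ler_expR.
  have -> : B * (a * mu0) = 4 * mu0 by field; rewrite gt_eqF.
  have := mulr_gt0 mm0 k2; move: hX; lra.
(* The gain [g * M] is a constant multiple of [eta * m]; both tilts are [s0], taken so large that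
   the free choices cost less, and [dl] and [mu0] absorb the terms with [s0] itself. *)
have E1 : s0 * M%:R + expR (- s0) * rho * (n * n)%:R + s0 * dm + expR (- s0) * rho * (n * n)%:R - g * M%:R <= -
  (eta * mR / 8).
  have f1 : expR (- s0) * rho * (n * n)%:R <= eta * mR / 32.
    rewrite -mulrA natrM [rho * _]mulrA rho_n mulrAC.
    have := ler_wpM2r (ltW m_gt0_R) k7; rewrite [leRHS]mulrAC; apply: le_trans.
    have -> : expR (- s0) * (4 * rR ^+ 2) / beta * mR = expR (- s0) * (4 * rR ^+ 2 * mR / beta) by ring.
    by rewrite ler_wpM2l ?expR_ge0 // ler_wpM2r ?invr_ge0 ?(ltW k4) // mulrC nw_le_m.
  have f2 : dl * s0 * mR <= eta * mR / 32 by rewrite [leRHS]mulrAC ler_wpM2r.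
  have f3 : eta * mR <= 2 * (mu0 * M%:R).
    have -> : 2 * (mu0 * M%:R) = M%:R * 2 * mu0 by ring.
    by move: M2; rewrite ler_pdivrMr // ler_pdivrMr.
  have f4 : 32 * (s0 * M%:R) <= mu0 * M%:R by rewrite mulrA ler_wpM2r.
  have f5 : g * M%:R >= 5 / 6 * (mu0 * M%:R).
    have := ler_wpM2r (mulr_ge0 (ltW mm0) (ler0n R M)) k2'; lra.
  move: f1 f2 f3 f4 f5; rewrite [s0 * (dl * _)]mulrA [s0 * dl]mulrC.
  by apply: exponent_arith; rewrite mulr_ge0 // ltW.
have GS : bad_graphs P m dm \subset
   [set G in bad_graphs P m dm | #|core D M (inner P G)| == M] :|:
   ([set G in bad_graphs P m dm | (#|core D M (inner P G)| < M)%N && (w * #|heavy P Yth G|%:R <= a * mu0 *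
     #|core D M (inner P G)|%:R)] :|:
   [set G in bad_graphs P m dm | (#|core D M (inner P G)| < M)%N && ~~ (w * #|heavy P Yth G|%:R <= a * mu0 *
     #|core D M (inner P G)|%:R)]).
  apply/subsetP => G Gg; rewrite in_setU in_setU.
  rewrite !(in_setIP _ Gg); have [/and3P[_ sM _] _] := coreP D M (inner P G).
  by case: (ltngtP #|core D M (inner P G)| M) sM => //= _ _; rewrite orbN.
have c1' := leq_trans (subset_leq_card GS) (leq_card_setU _ _).1.
have {c1' GS} := leq_trans c1' (leq_add (leqnn _) (leq_card_setU _ _).1).
rewrite -(ler_nat R) !natrD => /le_trans; apply; rewrite mulrDr; apply: lerD; last first; last first.
  by apply: le_trans C1 _; rewrite ler_wpM2l // ler_expR.
rewrite mulrDr; apply: lerD.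
- by apply: le_trans C2a _; rewrite ler_wpM2l // ler_wpM2l ?expR_ge0 // lerB // ler_expR.
- apply: le_trans C2b _; apply: ler_wpM2l => //; apply: ler_wpM2r.
  + by rewrite subr_ge0 -[leLHS]expR0 ler_expR mulr_ge0 ?expR_ge0.
  + by rewrite ler_wpM2l // ler_expR.
Qed.

End Choices.

Lemma sparse_bound :
  #|bad_graphs P m (dl * mR)|%:R <= zeta^-1 * 'C(N, m)%:R *
    (expR (- (eta * w / 8)) +
     (expR (nR * expR (- w)) * (expR (rho * expR (- (mu0 * (1 - 3 * eta1))) * (n * n)%:R) - 1) +
      2 * expR (rho * expR (- (mu0 * (1 - 3 * eta1))) * (n * n)%:R) * (expR (nR * expR (- w)) - 1))).
Proof.
have ww := w_gt0; have mm0 := mu0_gt0; have xx := xi_gt0; have nn := n_gt0_R.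
have hD : 1 <= eta * w / mu0.
  by rewrite ler_pdivlMr // mul1r; apply: le_trans hmu016 _.
have hM : 1 <= eta * mR / mu0.
  by apply: le_trans hD _; rewrite ler_pM2r ?invr_gt0 // ler_pM2l // w_le_m.
have [D [D0 D1 D2]] := nat_half_floor hD.
have [M [M0 M1 M2]] := nat_half_floor hM.
have hd1 : 1 <= xi * w / 4 by move: g5; lra.
have [[|d'] [d0 d1 d2]] := nat_half_floor hd1; first by [].
have hy : 0 <= 2 * (dl * mR) / (xi * w).
  by rewrite divr_ge0 ?mulr_ge0 // ltW.
have [y [y1 y2]] := nat_floor hy.
pose hd (e : {set 'I_n}) := odflt (Ordinal n0) [pick x in e].
have hdP e : e \in IP -> hd e \in e.
  rewrite inE => /andP[/eqP e2 _]; rewrite /hd; case: pickP => //= e0.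
  by move: e2; rewrite (eq_card0 e0).
have e1 : expR (- (eta * mR / 8)) <= expR (- (eta * w / 8)).
  by rewrite ler_expR lerN2 ler_pM2r ?invr_gt0 // ler_pM2l // w_le_m.
have cst0 : 0 <= zeta^-1 * 'C(N, m)%:R by rewrite mulr_ge0 // invr_ge0 ltW.
apply: le_trans (ler_wpM2l cst0 (lerD e1 (lexx _))).
(* Rounding up: [ymax] has to be positive and at least [2 * dm / Yth]. *)
apply: (sparse_bound_choices D0 D1 D2 M0 M1 M2 hdP (d' := d') (ymax := y.+1)) => //.
- by move: d2; lra.
- by move: y2; rewrite ltr_pdivrMr ?mulr_gt0 // natr1 => /ltW.
- rewrite -natr1.
  have h1 : 2 * (dl * mR) / (xi * w) <= dl * nR / xi.
    rewrite ler_pdivrMr ?mulr_gt0 //.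
    have -> : dl * nR / xi * (xi * w) = dl * (nR * w) by field; rewrite gt_eqF.
    have := ler_wpM2l (ltW k9) m_le_nw; lra.
  have h2 : 1 <= dl * nR / xi by rewrite ler_pdivlMr // mul1r.
  have -> : 2 * dl * nR / xi = dl * nR / xi + dl * nR / xi by ring.
  by apply: lerD h2; apply: le_trans h1.
Qed.

End Sparse.

(** * The threshold and the choice of the constants *)

Section Growth.
Variable R : realType.
Implicit Types (x X z L : R) (r : nat).

Lemma expR_quad x : 0 <= x -> x ^+ 2 / 2 <= expR x.
Proof.
move=> x0; have := @expR_ge1Dxn R x 1 x0; have -> : (2`!) = 2%N by [].
lra.
Qed.

Lemma expR_cub x : 0 <= x -> x ^+ 3 / 6 <= expR x.
Proof.
move=> x0; have := @expR_ge1Dxn R x 2 x0; have -> : (3`!) = 6%N by [].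
lra.
Qed.

Lemma expRN_le_inv x : 0 < x -> expR (- x) <= x^-1.
Proof.
move=> x0; rewrite expRN lef_pV2 ?posrE ?expR_gt0 //.
by apply: le_trans (expR_ge1Dx _); lra.
Qed.

Lemma mul2_Ee r : (1 < r)%N -> ('C(r.+1, 2).-1 * 2 = r.+2 * r.-1)%N.
Proof.
case: r => [|[|j]] // _; have := bin2_double j.+2; move: ('C(_, _)) => c.
by rewrite /=; nia.
Qed.

Lemma Ee_gt0 r : (1 < r)%N -> (0 < 'C(r.+1, 2).-1)%N.
Proof. by move=> r1; have := mul2_Ee r1; case: r r1 => [|[|j]] //= _; case: ('C(_, _).-1). Qed.

Lemma bin_Ee r : (1 < r)%N -> 'C(r.+1, 2)%:R - 1 = ('C(r.+1, 2).-1)%:R :> R.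
Proof.
move=> r1; have c0 : (0 < 'C(r.+1, 2))%N by rewrite bin_gt0; move: r1; clear; lia.
by rewrite -{1}(prednK c0) -natr1 addrK.
Qed.

(** As [2 E = (r - 1)(r + 2)], the hypothesis reads [(X * z ^+ r.+2) ^+ r.-1 >= 1]. So at the
    threshold [Q] is at least [n^(1/(r+2))], and the overlap terms vanish polynomially. *)
Lemma Q_lower r X z : (1 < r)%N -> 0 <= X -> 0 < z ->
  1 <= X ^+ r.-1 * (z ^+ 2) ^+ ('C(r.+1, 2).-1) -> X <= (X * z ^+ r.+1) ^+ r.+2.
Proof.
move=> r1 X0 z0; rewrite -exprM mulnC mul2_Ee // exprM -exprMn => h.
have y0 : 0 <= X * z ^+ r.+2 by rewrite mulr_ge0 // exprn_ge0 // ltW.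
have h1 : 1 <= X * z ^+ r.+2.
  rewrite leNgt; apply/negP => /exprn_ilt1 hlt.
  by move: h; rewrite leNgt hlt // -lt0n; case: (r) r1 => [|[]].
have -> : (X * z ^+ r.+1) ^+ r.+2 = X * (X * z ^+ r.+2) ^+ r.+1.
  have e : z ^+ r.+1 ^+ r.+2 = z ^+ r.+2 ^+ r.+1 by rewrite -[LHS]exprM -[RHS]exprM mulnC.
  rewrite [LHS]exprMn e [(X * z ^+ r.+2) ^+ _]exprMn [X ^+ r.+2]exprS.
  by rewrite mulrA.
by rewrite ler_peMr // exprn_ege1.
Qed.

Lemma root_le (u Y : R) k : (0 < k)%N -> 1 <= Y -> u ^+ k <= Y -> u <= Y.
Proof.
move=> k0 Y1; apply: contraLR; rewrite -!ltNge => h; apply: (lt_le_trans h).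
by apply: ler_eXnr => //; exact: le_trans (ltW h).
Qed.

(* With [E = 'C(r.+1, 2) - 1 = (r - 1)(r + 2)/2], the [E]-th power of the threshold density
   clears all the exponents in [m_r]. *)
Lemma theta_pow r X L : (1 < r)%N -> 0 < X -> 0 < L ->
  let E := 'C(r.+1, 2).-1 in
  (2 * theta R r * X `^ (- (2 / (r%:R + 2))) * L `^ (E%:R^-1)) ^+ E * X ^+ r.-1 =
  ((1 - r%:R^-1) ^+ E) * (r%:R ^+ r.-1 * ((2 * r%:R + 2) / (r%:R + 2))) * L.
Proof.
move=> r1 X0 L0 E.
have rp : 0 < r%:R :> R by rewrite ltr0n ltnW.
have r20 : 0 < r%:R + 2 :> R by rewrite addr_gt0.
have E0 : E%:R != 0 :> R by rewrite pnatr_eq0 -lt0n Ee_gt0.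
have r10 : r.-1%:R != 0 :> R by rewrite pnatr_eq0 -lt0n -subn1 subn_gt0.
have hE : 2 / (r%:R + 2) * E%:R = r.-1%:R :> R.
  have : (E * 2)%:R = (r.+2 * r.-1)%:R :> R by rewrite mul2_Ee.
  rewrite !natrM -[r.+2]addn2 natrD => h.
  by rewrite mulrAC [2 * E%:R]mulrC h [X in X / _]mulrC mulfK // gt_eqF.
have kp : 0 < (2 * r%:R + 2) / (r%:R + 2) :> R by rewrite divr_gt0 // addr_gt0 // mulr_gt0.
have r1E : r%:R - 1 = r.-1%:R :> R by rewrite -{1}(prednK (ltnW r1)) -natr1 addrK.
have powE (Y a : R) : 0 <= Y -> (Y `^ a) ^+ E = Y `^ (a * E%:R).
  by move=> Y0; rewrite -powR_mulrn ?powR_ge0 // powRrM.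
rewrite /theta r1E; set kk := (_ + 2) / _; set Y := r%:R * _.
have Yp : 0 <= Y by rewrite mulr_ge0 // powR_ge0.
have -> : 2 * (r.-1%:R / (2 * r%:R) * Y `^ (2 / (r%:R + 2))) = (1 - r%:R^-1) * Y `^ (2 / (r%:R + 2)).
  rewrite -r1E; move: (Y `^ _) => y; field; rewrite gt_eqF //.
rewrite [(_ * L `^ _) ^+ E]exprMn [(_ * X `^ _) ^+ E]exprMn [(_ * Y `^ _) ^+ E]exprMn.
rewrite !powE // ?(ltW X0) ?(ltW L0) // mulNr hE mulVf // powRr1 ?(ltW L0) //.
rewrite powRN !powR_mulrn ?(ltW X0) //.
have -> : Y ^+ r.-1 = r%:R ^+ r.-1 * kk.
  rewrite /Y exprMn -[kk `^ _ ^+ _]powR_mulrn ?powR_ge0 // -powRrM mulVf // powRr1 // ltW //.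
have : X ^+ r.-1 != 0 by rewrite expf_neq0 // gt_eqF.
move: (X ^+ _) (r%:R ^+ _) (_ ^+ E) => x1 x2 x3 x10; by field.
Qed.

Lemma bernoulli (x : R) k : 0 <= x -> x <= 1 -> 1 - k%:R * x <= (1 - x) ^+ k.
Proof.
move=> x0 x1; elim: k => [|k IH]; first by rewrite expr0; lra.
have x1' : 0 <= 1 - x by lra.
rewrite exprS; apply: le_trans (ler_wpM2l x1' IH).
have := mulr_ge0 (ler0n R k) (mulr_ge0 x0 x0); rewrite -natr1; lra.
Qed.

Lemma slack_arith (A B e K : R) : 0 <= A -> 0 <= B -> A + B <= e / 8 -> 0 < e -> e <= 1 -> 0 <= K ->
  (1 + 3 / 4 * e) * K <= (1 - A) * ((1 - B) * (1 + e)) * K.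
Proof.
move=> A0 B0 AB e0 e1 K0; rewrite ler_wpM2r //.
have h1 : 0 <= A * B * (1 + e) by rewrite !mulr_ge0 //; lra.
have h2 : (A + B) * (1 + e) <= e / 8 * (1 + e) by rewrite ler_wpM2r //; lra.
have h3 : e * e <= e by rewrite ler_piMr // ltW.
lra.
Qed.

(** Unequal parts and the reduced density cost powers of [1 - gam * r] and of
    [1 - 2 * gam - 2 * zeta]. By Bernoulli's inequality and the slack condition the loss is at most
    [e / 8], so [3/4] of the surplus [e] survives. *)
Lemma mu_lower r n m (N e eps gam zeta pm : R) : (1 < r)%N -> (1 < n)%N ->
  let E := 'C(r.+1, 2).-1 in let c := r%:R^-1 - gam in
  0 < e -> e <= eps -> e <= 1 -> 0 <= gam -> 0 <= zeta ->
  gam * (r%:R ^+ 2 + 2 * E%:R) + 2 * E%:R * zeta <= e / 8 ->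
  2 * N <= (1 - c) * n%:R ^+ 2 -> 0 < N -> pm * N = m%:R -> (1 + eps) * m_r R n r <= m%:R ->
  (1 + 3 / 4 * e) * ((2 * r%:R + 2) / (r%:R + 2) * ln n%:R) <=
    (c * n%:R) ^+ r.-1 * ((1 - zeta) ^+ 2 * pm) ^+ E.
Proof.
move=> r1 n1 E c e0 ee e1 gam0 zeta0 hs hN N0 hpm hm.
have E0 : (0 < E)%N by exact: Ee_gt0.
have E1 : 1 <= E%:R :> R by rewrite (ler_nat R 1).
have r2 : 2 <= r%:R :> R by rewrite (ler_nat R 2).
have rp : 0 < r%:R :> R by lra.
have X0 : 0 < n%:R :> R by rewrite ltr0n ltnW.
have L0 : 0 < ln n%:R :> R by rewrite ln_gt0 // ltr1n.
set L := ln n%:R in L0 *; set X := n%:R in X0 hN *; set kk := (2 * _ + 2) / _.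
have kk0 : 0 < kk by rewrite divr_gt0 //; lra.
have g1 : 2 * E%:R * gam + 2 * E%:R * zeta <= e / 8.
  have := mulr_ge0 gam0 (exprn_ge0 2 (ltW rp)); lra.
have g2 : gam * r%:R ^+ 2 + E%:R * (2 * gam + 2 * zeta) <= e / 8 by lra.
have g3 : 2 * gam + 2 * zeta <= 1.
  have : 1 * (2 * gam + 2 * zeta) <= E%:R * (2 * gam + 2 * zeta) by rewrite ler_wpM2r //; lra.
  have := mulr_ge0 gam0 (exprn_ge0 2 (ltW rp)); lra.
have g4 : gam * r%:R <= 1.
  have : gam * r%:R <= gam * r%:R ^+ 2 by rewrite ler_wpM2l // expr2 ler_peMl //; lra.
  have := mulr_ge0 (ler0n R E) (addr_ge0 gam0 zeta0); lra.
(* Here [t = 2 * m_r / n^2]. *)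
pose t := 2 * theta R r * X `^ (- (2 / (r%:R + 2))) * L `^ (E%:R^-1).
have ht : t ^+ E * X ^+ r.-1 = ((1 - r%:R^-1) ^+ E) * (r%:R ^+ r.-1 * kk) * L.
  exact: theta_pow.
have th0 : 0 <= theta R r by rewrite /theta mulr_ge0 ?powR_ge0 // divr_ge0 //; lra.
have t0 : 0 <= t.
  apply: mulr_ge0; last exact: powR_ge0.
  by apply: mulr_ge0; [apply: mulr_ge0|exact: powR_ge0].
have mt : 2 * m_r R n r = X ^+ 2 * t.
  rewrite /m_r bin_Ee // -/E -/X -/L powRD; last by rewrite (gt_eqF X0) implybT.
  rewrite powR_mulrn ?(ltW X0) // /t; move: (X `^ _) (L `^ _) (X ^+ 2) => x1 x2 x3; ring.
have b0 : 2^-1 <= 1 - r%:R^-1 :> R.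
  have : r%:R^-1 <= 2^-1 :> R by rewrite lef_pV2 ?posrE.
  lra.
set b := 1 - r%:R^-1 in b0 ht *.
have pm0 : 0 <= pm.
  have : 0 <= pm * N by rewrite hpm.
  by rewrite pmulr_lge0.
have h1 : (1 + e) * t <= pm * (b + gam).
  rewrite -(ler_pM2r (exprn_gt0 2 X0)).
  have i1 : (1 + e) * (X ^+ 2 * t) <= 2 * (pm * N).
    rewrite hpm -mt.
    have mr0 : 0 <= m_r R n r.
      by apply: mulr_ge0; [apply: mulr_ge0 => //|]; exact: powR_ge0.
    have := ler_wpM2r mr0 ee; lra.
  have i2 := ler_wpM2l pm0 hN; rewrite /c in i2; rewrite /b; lra.
have h2 : (1 + e) * (1 - 2 * gam) * t <= pm * b.
  have i1 : b + gam <= b * (1 + 2 * gam) by have := ler_wpM2l gam0 b0; lra.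
  have i2 := ler_wpM2l pm0 i1.
  have i3 : 0 <= 1 - 2 * gam by lra.
  have i4 := ler_wpM2l i3 (le_trans h1 i2).
  have i5 : 0 <= gam * gam * (pm * b) by rewrite !mulr_ge0 //; lra.
  lra.
have h3 : (1 - (2 * gam + 2 * zeta)) * (1 + e) * t <= (1 - zeta) ^+ 2 * pm * b.
  have i1 : 1 - 2 * zeta <= (1 - zeta) ^+ 2 by have := bernoulli 2 zeta0; apply; lra.
  have i2 : (1 - (2 * gam + 2 * zeta)) <= (1 - 2 * zeta) * (1 - 2 * gam).
    have := mulr_ge0 gam0 zeta0; lra.
  have et : 0 <= (1 + e) * t by rewrite mulr_ge0 //; lra.
  have i3 := ler_wpM2r et i2.
  have i4 : 0 <= 1 - 2 * zeta by lra.
  have i5 := ler_wpM2l i4 h2.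
  have pb0 : 0 <= pm * b by rewrite mulr_ge0 //; lra.
  have i6 := ler_wpM2r pb0 i1; lra.
set v := 1 - (2 * gam + 2 * zeta) in h3 *.
have v0 : 0 <= v by rewrite /v; lra.
have bp : 0 < b by lra.
have bE : 0 < b ^+ E by rewrite exprn_gt0.
have h4 : (v * (1 + e)) ^+ E * t ^+ E <= ((1 - zeta) ^+ 2 * pm) ^+ E * b ^+ E.
  have s0 : 0 <= 1 + e by lra.
  have s1 := mulr_ge0 (mulr_ge0 v0 s0) t0.
  by rewrite -exprMn -[leRHS]exprMn lerXn2r ?nnegrE // (le_trans s1 h3).
have c0 : 0 <= c by rewrite /c subr_ge0 -[r%:R^-1]mul1r ler_pdivlMr.
have h5 : c ^+ r.-1 * r%:R ^+ r.-1 * ((v * (1 + e)) ^+ E) * (kk * L) <=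
    (c * X) ^+ r.-1 * ((1 - zeta) ^+ 2 * pm) ^+ E.
  rewrite -(ler_pM2r bE) -[leRHS]mulrA.
  have cX0 : 0 <= (c * X) ^+ r.-1 by rewrite exprn_ge0 // mulr_ge0 // ltW.
  apply: le_trans (ler_wpM2l cX0 h4).
  have -> : (c * X) ^+ r.-1 = c ^+ r.-1 * X ^+ r.-1 by rewrite exprMn.
  have -> : c ^+ r.-1 * X ^+ r.-1 * ((v * (1 + e)) ^+ E * t ^+ E) =
     c ^+ r.-1 * (v * (1 + e)) ^+ E * (t ^+ E * X ^+ r.-1).
    by move: (X ^+ _) (t ^+ _) (_ ^+ E) (c ^+ _) => x1 x2 x3 x4; ring.
  rewrite ht le_eqVlt; apply/orP; left; apply/eqP.
  by move: (_ ^+ E) (c ^+ _) (r%:R ^+ _) (b ^+ E) => x1 x2 x3 x4; ring.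
apply: le_trans h5.
have kL : 0 <= kk * L by rewrite mulr_ge0 // ltW.
have cr : c * r%:R = 1 - gam * r%:R by rewrite /c mulrBl mulVf // gt_eqF.
rewrite -exprMn cr.
have j1 : 1 - gam * r%:R ^+ 2 <= (1 - gam * r%:R) ^+ r.-1.
  apply: le_trans (bernoulli r.-1 (mulr_ge0 gam0 (ltW rp)) g4).
  rewrite lerD2l lerN2 expr2 mulrCA ler_wpM2l // ?ler_wpM2r ?(ltW rp) //.
  by rewrite ler_nat leq_pred.
have j2 : (1 - E%:R * (2 * gam + 2 * zeta)) * (1 + e) <= (v * (1 + e)) ^+ E.
  have u0 : 0 <= 2 * gam + 2 * zeta by lra.
  have j3 : 1 - E%:R * (2 * gam + 2 * zeta) <= v ^+ E by exact: bernoulli.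
  have j4 : 1 + e <= (1 + e) ^+ E by apply: ler_eXnr => //; lra.
  rewrite [(v * _) ^+ _]exprMn; apply: ler_pM => //; lra.
have u0 : 0 <= E%:R * (2 * gam + 2 * zeta) by rewrite mulr_ge0 //; lra.
have w0 : 0 <= gam * r%:R ^+ 2 by rewrite mulr_ge0 // exprn_ge0 // ltW.
apply: le_trans (slack_arith w0 u0 g2 e0 e1 kL) _.
have s0 : 0 <= 1 + e by lra.
have s2 : 0 <= 1 - E%:R * (2 * gam + 2 * zeta) by lra.
apply: ler_wpM2r => //; apply: ler_pM => //; last exact: mulr_ge0.
lra.
Qed.

End Growth.

Section Bounds.
Variable R : realType.

(** If the mean is not truncated, then [p] is at most [n^(- 2/(r+2))] up to a factor of order
    [ln n]. *)
Lemma p_upper r (c p L : R) : (1 < r)%N -> (2 * r%:R)^-1 <= c -> 1 <= L -> 0 <= p ->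
  (c * expR L) ^+ r.-1 * p ^+ ('C(r.+1, 2).-1) <= 16 * L ->
  p * expR (2 / (r%:R + 2) * L) <= 16 * L * (2 * r%:R) ^+ r.-1.
Proof.
move=> r1 hc L1 p0 h.
have r2 : 2 <= r%:R :> R by rewrite (ler_nat R 2).
have rr : 1 <= (2 * r%:R) ^+ r.-1 :> R by rewrite exprn_ege1 //; lra.
apply: (root_le (Ee_gt0 r1)).
  by rewrite -[leLHS]mulr1 ler_pM //; lra.
have e1 : expR (2 / (r%:R + 2) * L) ^+ ('C(r.+1, 2).-1) = expR L ^+ r.-1.
  have : ('C(r.+1, 2).-1 * 2)%:R = (r.+2 * r.-1)%:R :> R by rewrite mul2_Ee.
  rewrite !natrM -[r.+2]addn2 natrD => hE.
  rewrite -!expRM_natr; congr expR.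
  have r20 : r%:R + 2 != 0 :> R by rewrite gt_eqF //; lra.
  have -> : 2 / (r%:R + 2) * L * 'C(r.+1, 2).-1%:R = L * ('C(r.+1, 2).-1%:R * 2) / (r%:R + 2).
    by move: ('C(r.+1, 2).-1%:R) => x; field.
  by rewrite hE; move: (r.-1%:R) => x; field.
rewrite exprMn e1.
have c0 : 0 < c by apply: lt_le_trans hc; rewrite invr_gt0; lra.
have h2 : 1 <= (2 * r%:R * c) ^+ r.-1.
  rewrite exprn_ege1 // mulrC -ler_pdivrMr ?mul1r //; lra.
have h3 : 0 <= p ^+ 'C(r.+1, 2).-1 * expR L ^+ r.-1 by rewrite mulr_ge0 // exprn_ge0 // expR_ge0.
have rr0 : 0 <= (2 * r%:R) ^+ r.-1 :> R by lra.
apply: le_trans (ler_wpM2r rr0 h).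
apply: le_trans (_ : p ^+ 'C(r.+1, 2).-1 * expR L ^+ r.-1 * (2 * r%:R * c) ^+ r.-1 <= _).
  by rewrite ler_peMr.
rewrite [(_ * c) ^+ _]exprMn [(c * _) ^+ _]exprMn le_eqVlt; apply/orP; left; apply/eqP.
by move: (p ^+ _) (c ^+ _) (expR L ^+ _) ((2 * r%:R) ^+ _) => x1 x2 x3 x4; ring.
Qed.

(** Where the threshold is decisive. A truncated mean [16 L] beats [n^2] easily. Otherwise [p * n^2]
    is about [n^(kk)] with [kk = 2 - 2/(r+2)], while [mu] exceeds [kk * L] by a factor that stays
    above [1 + e / 2] after the loss [3 * (e / 24)]. *)
Lemma Z_bound r (c p pm beta e mu mu0 L : R) : (1 < r)%N -> (2 * r%:R)^-1 <= c -> 1 <= L ->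
  0 <= p -> 0 <= pm -> pm <= 1 -> pm <= 4 * p -> 0 < beta -> 0 < e -> e <= 1 ->
  mu = (c * expR L) ^+ r.-1 * p ^+ ('C(r.+1, 2).-1) ->
  mu0 = Num.min mu (16 * L) ->
  (1 + 3 / 4 * e) * ((2 * r%:R + 2) / (r%:R + 2) * L) <= mu ->
  beta^-1 <= L -> 64 * 48 * (2 * r%:R) ^+ r.-1 / (beta * e ^+ 3) <= L ->
  pm / beta * expR (- (mu0 * (1 - 3 * (e / 24)))) * expR L ^+ 2 <= L^-1.
Proof.
move=> r1 hc L1 p0 pm0 pm1 pmp b0 e0 e1 hmu hmu0 hlow hb hbig.
have r2 : 2 <= r%:R :> R by rewrite (ler_nat R 2).
have L0 : 0 < L by lra.
have X2 : expR L ^+ 2 = expR (2 * L) by rewrite -expRM_natr mulrC.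
rewrite X2 -mulrA -expRD.
have [hm|hm] := leP (16 * L) mu.
  have -> : mu0 = 16 * L by rewrite hmu0; apply/min_idPr.
  have h1 : pm / beta <= L.
    by apply: le_trans hb; rewrite ler_piMl // invr_ge0 ltW.
  have h2 : expR (- (16 * L * (1 - 3 * (e / 24))) + 2 * L) <= expR (- (6 * L)).
    rewrite ler_expR; have := ler_wpM2l (ltW L0) e1; lra.
  have h3 : L ^+ 2 <= expR (6 * L).
    have i6 : 0 <= 6 * L by lra.
    apply: le_trans (expR_quad i6); rewrite [(6 * L) ^+ 2]exprMn.
    have := exprn_ge0 2 (ltW L0); lra.
  have pb : 0 <= pm / beta by rewrite divr_ge0 // ltW.
  apply: le_trans (ler_pM pb (expR_ge0 _) h1 h2) _.
  by rewrite expRN ler_pdivrMr ?expR_gt0 // mulrC ler_pdivlMr.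
have -> : mu0 = mu by rewrite hmu0; apply/min_idPl; exact: ltW.
have hp : p * expR (2 / (r%:R + 2) * L) <= 16 * L * (2 * r%:R) ^+ r.-1.
  by apply: (p_upper r1 hc L1 p0); rewrite -hmu ltW.
set kk := (2 * r%:R + 2) / (r%:R + 2) in hlow *.
have kE : 2 - 2 / (r%:R + 2) = kk by rewrite /kk; field; rewrite gt_eqF //; lra.
have k1 : 1 <= kk by rewrite /kk ler_pdivlMr; lra.
set T := (2 * r%:R) ^+ r.-1 in hp hbig *.
have T0 : 0 <= T by rewrite exprn_ge0 //; lra.
have h1 : - (mu * (1 - 3 * (e / 24))) + 2 * L <= 2 / (r%:R + 2) * L - e / 2 * L.
  have e3 : 0 <= 1 - 3 * (e / 24) by lra.
  have i1 := ler_wpM2r e3 hlow.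
  have i2 : (1 + e / 2) * (kk * L) <= (1 + 3 / 4 * e) * (kk * L) * (1 - 3 * (e / 24)).
    have -> : (1 + 3 / 4 * e) * (kk * L) * (1 - 3 * (e / 24)) = ((1 + 3 / 4 * e) * (1 - 3 * (e / 24))) * (kk *
      L) by ring.
    apply: (ler_wpM2r (mulr_ge0 (le_trans ler01 k1) (ltW L0))).
    have := ler_wpM2l (ltW e0) e1; lra.
  have i3 : (2 - 2 / (r%:R + 2)) * L + e / 2 * L <= (1 + e / 2) * (kk * L).
    rewrite kE; have eL : 0 <= e * L by rewrite mulr_ge0 // ltW.
    have := ler_wpM2l eL k1; lra.
  move: (2 / (r%:R + 2)) i1 i2 i3 => y; lra.
have h2 : pm * expR (2 / (r%:R + 2) * L) <= 64 * L * T.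
  have := ler_wpM2r (expR_ge0 (2 / (r%:R + 2) * L)) pmp; lra.
(* A cubic lower bound suffices: one power of [L] cancels the logarithm in [h2], one gives [L^-1],
   one absorbs the constants. *)
have h3 : (e / 2 * L) ^+ 3 / 6 <= expR (e / 2 * L).
  by apply: expR_cub; rewrite mulr_ge0 // ?ltW // divr_gt0.
have eL3 : 0 < (e / 2 * L) ^+ 3 / 6 by rewrite divr_gt0 // exprn_gt0 // mulr_gt0 // divr_gt0.
apply: (@le_trans _ _ (64 * L * T / beta * ((e / 2 * L) ^+ 3 / 6)^-1)).
  apply: (@le_trans _ _ (pm / beta * (expR (2 / (r%:R + 2) * L) * expR (- (e / 2 * L))))).
    rewrite ler_wpM2l ?divr_ge0 ?(ltW b0) // -expRD ler_expR; lra.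
  have -> : pm / beta * (expR (2 / (r%:R + 2) * L) * expR (- (e / 2 * L))) =
     (pm * expR (2 / (r%:R + 2) * L)) / beta * expR (- (e / 2 * L)).
    by move: (expR _) (expR _) => x1 x2; ring.
  apply: ler_pM; rewrite ?expR_ge0 ?divr_ge0 ?mulr_ge0 ?expR_ge0 ?(ltW b0) //.
    by rewrite ler_wpM2r // invr_ge0 ltW.
  by rewrite expRN lef_pV2 ?posrE ?expR_gt0.
have -> : 64 * L * T / beta * ((e / 2 * L) ^+ 3 / 6)^-1 = 64 * 48 * T / (beta * e ^+ 3) / L * L^-1.
  by move: T hbig hp h2 T0 => T' _ _ _ _; field; rewrite !gt_eqF.
have hx : 64 * 48 * T / (beta * e ^+ 3) / L <= 1 by rewrite ler_pdivrMr // mul1r.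
by rewrite -[leRHS]mul1r; apply: ler_wpM2r hx; rewrite invr_ge0 ltW.
Qed.

End Bounds.

(** * The dense and the sparse regime with explicit constants *)

Section Regimes.
Variables (R : realType) (n r m : nat) (P : labelling n r).
Local Notation EP := (EP P).
Local Notation N := (#|EP|).
Local Notation nR := (n%:R : R).
Local Notation rR := (r%:R : R).
Local Notation Ee := ('C(r.+1, 2).-1).
Local Notation L := (ln nR).
Variables (c dl beta : R).
Hypotheses (r1 : (1 < r)%N) (n1 : (1 < n)%N)
  (c1 : (2 * rR)^-1 <= c) (c2 : c <= 1) (hc : forall i, c * nR <= #|part P i|%:R).

Lemma natr_expR_ln : nR = expR L.
Proof. by rewrite lnK // posrE ltr0n ltnW. Qed.

Lemma c_gt0 : 0 < c.
Proof. by apply: lt_le_trans c1; rewrite invr_gt0 mulr_gt0 // ltr0n ltnW. Qed.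

Lemma N_gt0 : 0 < N%:R :> R.
Proof.
apply: lt_le_trans (card_EP_ge r1 (ltW c_gt0) hc).
by rewrite mulr_gt0 // exprn_gt0 ?c_gt0 // ltr0n ltnW.
Qed.

Lemma dense_regime (ell : R) : 0 < dl -> dl <= beta / 2 -> 0 < beta -> beta <= 4^-1 ->
  beta <= (c ^+ r.-1 / 4 / 4) ^+ r -> beta <= c ^+ r.-1 / 2 -> 3 <= ell * (c ^+ r.-1 / 4 / 4) ->
  2 * beta <= expR (- ell) / 2 -> (1 - beta) * N%:R <= m%:R ->
  #|bad_graphs P m (dl * m%:R)|%:R <= 'C(N, m)%:R * (expR (nR * expR (- nR)) - 1).
Proof.
move=> dl0 dlb b0 b4 h1 h2 h3 h4 hm.
have NR := N_gt0.
(* The missing pairs number [N - m] plus the inner edges: at most [beta * N] for the former, and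
   [dl * m <= beta * N] for the latter since [m <= 2 * N]. *)
have key G : G \in bad_graphs P m (dl * m%:R) -> #|missing P G|%:R <= 2 * beta * N%:R.
  move=> Gg; have hW := card_missing Gg; move: Gg; rewrite inE => /andP[_ ht].
  have hW' : #|missing P G|%:R + m%:R = N%:R + #|inner P G|%:R :> R by rewrite -!natrD hW.
  have mm : 0 <= m%:R :> R by [].
  have W0 : 0 <= #|missing P G|%:R :> R by [].
  have hm2 : m%:R <= 2 * N%:R :> R.
    have i1 : dl * m%:R <= 8^-1 * m%:R by rewrite ler_wpM2r //; lra.
    lra.
  have i2 := ler_wpM2l (ltW dl0) hm2.
  have i3 := ler_wpM2r (ltW NR) dlb.
  lra.
have n0 : (0 < n)%N by exact: ltnW.
apply: (@dense_case R n r m P (dl * m%:R) beta c ell n0 r1 c_gt0 hc) => //.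
- move=> G /key; move/le_trans; apply; rewrite mulrAC -mulrA.
  have hN : 2 * N%:R <= nR ^+ 2.
    apply: le_trans (card_EP_le hc) _.
    by rewrite ler_piMl ?exprn_ge0 //; have := c_gt0; lra.
  have := ler_wpM2l (ltW b0) hN; lra.
- move=> G /key hk; apply: (le_trans hk).
  have i1 := ler_wpM2r (ltW NR) h4.
  have i2 : expR (- ell) / 2 * N%:R <= expR (- ell) * (N%:R - #|missing P G|%:R).
    rewrite -mulrA ler_wpM2l ?expR_ge0 //.
    have i3 := ler_wpM2r (ltW NR) b4; lra.
  lra.
Qed.

(** The constant is [37 = 1 + 4 * 3 + 8 * 3], with [expR v <= 4], [2 * expR Z <= 8] and the
    differences at most [3 * x]. *)
Lemma total_bound (x Z v C : R) : 0 <= C -> 0 <= x -> x <= 1 -> 0 <= Z -> Z <= x -> 0 <= v -> v <= x ->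
  forall y, y <= x ->
  C * (y + (expR v * (expR Z - 1) + 2 * expR Z * (expR v - 1))) <= C * (37 * x).
Proof.
move=> C0 x0 x1 Z0 Zx v0 vx y yx; rewrite ler_wpM2l //.
have h1 := expR_sub1_le Z0 (le_trans Zx x1).
have h2 := expR_sub1_le v0 (le_trans vx x1).
have e1 : expR v <= 4 by lra.
have e2 : 2 * expR Z <= 8 by lra.
have p1 : 0 <= expR Z - 1 by rewrite subr_ge0 -[leLHS]expR0 ler_expR.
have p2 : 0 <= expR v - 1 by rewrite subr_ge0 -[leLHS]expR0 ler_expR.
have f1 := ler_pM (expR_ge0 v) p1 e1 h1.
have q0 : 0 <= 2 * expR Z by rewrite mulr_ge0 // expR_ge0.
have f2 := ler_pM q0 p2 e2 h2.
lra.
Qed.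

Variables (zeta e eta theta a s0 K Cq : R).
Local Notation eta1 := (e / 24).
Local Notation xi := (expR (- theta)).
Local Notation lam := (4 * (K + ln 8)).
Local Notation kap := (expR (- lam)).
Local Notation B := (4 / a).
Local Notation A1 := (overlap_const r R * (2 * rR) ^+ r.-1).
Hypotheses (e0 : 0 < e) (e1 : e <= 1) (k1 : 0 < zeta) (k1' : zeta <= 2^-1)
  (k3 : A1 * (4 * rR + 7) * eta <= eta1) (k3' : 0 < eta) (k4 : 0 < beta) (k4' : beta <= 1)
  (k5 : 4 * xi * (theta + beta^-1) <= eta * eta1) (k5' : 0 <= theta)
  (k6 : a * (beta^-1 + 1) <= eta1) (k6' : 0 < a)
  (k7 : expR (- s0) * (4 * rR ^+ 2) / beta <= eta / 32) (k7' : 0 <= s0)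
  (k8 : rR * ln (8 * expR 1 / (beta * xi)) + 16 * rR * (beta^-1 + B + 2) / xi <= K - 1) (k8' : 1 <= K)
  (k9 : 0 < dl) (k9' : dl * s0 <= eta / 32) (k9'' : dl * (32 * K * 2 ^+ r) <= kap)
  (k9''' : dl * (1 + 2 * rR ^+ 3) <= zeta).
Hypotheses (q1 : 16 <= eta * Cq) (q2 : 8 <= xi * Cq) (q3 : 128 * K * 2 ^+ r <= xi * Cq) (q4 : 2 <= Cq)
  (l0 : 1 <= L) (l1 : 2 * Cq * (rR + 2) ^+ 2 <= L) (l2 : 2 * eta <= xi * L) (l3 : 32 * s0 <= L)
  (l4 : 4 * K <= (xi / 8) ^+ r.-1 * L) (l5 : xi <= dl * L) (l6 : 4 * rR ^+ 2 <= L)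
  (l7 : beta^-1 <= L) (l8 : 64 * 48 * (2 * rR) ^+ r.-1 / (beta * e ^+ 3) <= L).

Lemma sparse_regime : m%:R <= (1 - beta) * N%:R ->
  (1 + 3 / 4 * e) * ((2 * rR + 2) / (rR + 2) * L) <=
    (c * nR) ^+ r.-1 * ((1 - zeta) ^+ 2 * (m%:R / N%:R)) ^+ Ee ->
  #|bad_graphs P m (dl * m%:R)|%:R <= zeta^-1 * 'C(N, m)%:R * (37 * L^-1).
Proof.
move=> hm hmu.
have NR := N_gt0; have cp := c_gt0.
have r2 : 2 <= rR by rewrite (ler_nat R 2).
set pm := m%:R / N%:R in hmu; set p := (1 - zeta) ^+ 2 * pm in hmu; set mu := (c * nR) ^+ r.-1 * _ in hmu.
have hpm : pm * N%:R = m%:R by rewrite /pm divfK // gt_eqF.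
have pm0 : 0 <= pm by rewrite divr_ge0 // ltW.
have pmb : pm <= 1 - beta by rewrite ler_pdivrMr.
have L0 : 0 < L := lt_le_trans ltr01 l0.
have [h0 h1 h2 h3 h4] : [/\ 0 < e, 0 < zeta, zeta <= 2^-1, 0 < beta & 1 <= L] by [].
have h5 := q4.
have Lmu : L <= mu.
  apply: le_trans hmu.
  have i1 : 1 <= (2 * rR + 2) / (rR + 2) by rewrite ler_pdivlMr; lra.
  have i2 : L <= (2 * rR + 2) / (rR + 2) * L by rewrite ler_peMl // ltW.
  apply: le_trans i2 _; rewrite ler_peMl //; [|lra].
  by rewrite mulr_ge0 ?(ltW L0) //; lra.
have p0 : 0 <= p by rewrite mulr_ge0 // exprn_ge0 //; lra.
have pp : 0 < p.
  rewrite lt_neqAle p0 andbT; apply/negP => /eqP pz.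
  move: Lmu; rewrite /mu -pz expr0n gtn_eqF ?Ee_gt0 // mulr0; lra.
have pmp : 0 < pm.
  rewrite lt_neqAle pm0 andbT; apply/negP => /eqP pz.
  by move: pp; rewrite /p -pz mulr0 ltxx.
have m0 : (0 < m)%N by rewrite -(ltr_nat R) -hpm mulr_gt0.
have pm1 : pm <= 1 by lra.
have ppm : p <= pm.
  rewrite /p ler_piMl // exprn_ile1 //; lra.
have pm4 : pm <= 4 * p.
  rewrite /p mulrA ler_peMl //.
  have : (2^-1 : R) ^+ 2 <= (1 - zeta) ^+ 2 by rewrite lerXn2r ?nnegrE //; lra.
  rewrite exprVn; lra.
pose z := Num.sqrt p.
have hz : p = z ^+ 2 by rewrite sqr_sqrtr.
have z0 : 0 < z by rewrite sqrtr_gt0.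
have z1 : z <= 1 by rewrite -(expr_le1 (n := 2)) ?(ltW z0) // -hz; lra.
pose Q := nR * z ^+ r.+1.
have n0 : 0 < nR by rewrite ltr0n ltnW.
have QX : nR <= Q ^+ r.+2.
  apply: Q_lower => //.
  apply: le_trans (le_trans l0 Lmu) _; rewrite -hz /mu ler_wpM2r ?exprn_ge0 //.
  rewrite lerXn2r ?nnegrE ?mulr_ge0 ?(ltW cp) ?(ltW n0) // ler_piMl // ltW.
have Q0 : 0 < Q by rewrite mulr_gt0 // exprn_gt0.
(* [Q >= expR (L / (r + 2))], which by a quadratic lower bound and [l1] exceeds [Cq * L]. *)
have QL : Cq * L <= Q.
  have rp : 0 < rR + 2 by lra.
  have h6 : expR (L / (rR + 2)) <= Q.
    rewrite -(@ler_pXn2r _ r.+2) ?nnegrE ?expR_ge0 ?(ltW Q0) //.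
    apply: le_trans QX; rewrite -expRM_natr -[r.+2]addn2 natrD divfK ?gt_eqF // -natr_expR_ln //.
  apply: le_trans h6.
  have h7 : 0 <= L / (rR + 2) by rewrite divr_ge0 ?ltW.
  apply: le_trans (expR_quad h7).
  rewrite [(L / _) ^+ 2]exprMn exprVn ler_pdivlMr // ler_pdivlMr ?exprn_gt0 //.
  have := ler_wpM2r (ltW L0) l1; rewrite [L ^+ 2]expr2; lra.
pose w := nR * pm.
have Qw : Q <= w.
  rewrite /Q /w ler_wpM2l ?(ltW n0) //; apply: le_trans ppm; rewrite hz.
  by rewrite ler_wiXn2l ?(ltW z0) // ltnW.
pose mu0 := Num.min mu (16 * L).
have Lmu0 : L <= mu0 by rewrite /mu0 le_min Lmu /=; lra.
have nL : L <= nR by rewrite [leRHS]natr_expR_ln; apply: le_trans (expR_ge1Dx _); lra.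
have xi0 : 0 < xi by exact: expR_gt0.
have CqL : Cq <= Q by apply: le_trans QL; rewrite ler_peMr //; lra.
have LQ : 2 * L <= Q by apply: le_trans QL; rewrite ler_wpM2r // ltW.
have Nn : (0 < N)%N by rewrite -(ltr_nat R).
have eQ : 16 * L <= eta * Q.
  have := ler_wpM2l (ltW k3') QL; have := ler_wpM2r (ltW L0) q1; lra.
have xQ : xi * Cq <= xi * Q by rewrite ler_wpM2l // ltW.
have xw : xi * Q <= xi * w by rewrite ler_wpM2l // ltW.
apply: le_trans.
  apply: (@sparse_bound R n r m P zeta eta1 eta beta theta a s0 K dl c pm w p z mu mu0 L Q xi) => //.
  - exact: ltnW.
  - by rewrite /mu0 ge_min lexx.
  - by rewrite /mu0 ge_min lexx orbT.
  - by rewrite divr_gt0.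
  - by move: e1; lra.
  - by apply: (le_trans eQ); rewrite ler_wpM2l // ltW.
  - by apply: (le_trans l2); rewrite ler_wpM2l // ltW.
  - exact: le_trans l3 Lmu0.
  - exact: le_trans q2 (le_trans xQ xw).
  - exact: le_trans q3 xQ.
  - by lra.
  - by apply: (le_trans l4); rewrite ler_wpM2l // exprn_ge0 // divr_ge0 // ltW.
  - by apply: (le_trans l5); rewrite ler_wpM2l // ltW.
  - have i1 : (2 * rR)^-1 ^+ 2 <= c ^+ 2 by rewrite lerXn2r ?nnegrE ?invr_ge0 ?mulr_ge0 ?(ltW cp).
    have i2 : (2 * rR)^-1 ^+ 2 * (4 * rR ^+ 2) = 1 by field; rewrite gt_eqF //; lra.
    have r0 : 0 <= 4 * rR ^+ 2 by rewrite mulr_ge0 // exprn_ge0.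
    have i0 : 0 <= (2 * rR)^-1 ^+ 2 by rewrite exprn_ge0 // invr_ge0 mulr_ge0.
    by have := ler_pM i0 r0 i1 (le_trans l6 nL); rewrite i2.
  - by lra.
have Z0 : 0 <= pm / beta * expR (- (mu0 * (1 - 3 * eta1))) * (n * n)%:R.
  by rewrite !mulr_ge0 ?expR_ge0 ?invr_ge0 // ltW.
have Li1 : L^-1 <= 1 by rewrite invf_le1.
have Li0 : 0 <= L^-1 by rewrite invr_ge0 ltW.
have cst0 : 0 <= zeta^-1 * 'C(N, m)%:R by rewrite mulr_ge0 // invr_ge0 ltW.
apply: total_bound => //.
- rewrite natrM -expr2 [X in _ * X ^+ 2]natr_expR_ln.
  apply: (@Z_bound R r c p pm beta e mu mu0 L) => //; by rewrite /mu {1}natr_expR_ln.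
- rewrite [X in X * _]natr_expR_ln -expRD; apply: le_trans (expRN_le_inv L0); rewrite ler_expR; lra.
- apply: le_trans (expRN_le_inv L0); rewrite ler_expR lerN2 ler_pdivlMr //.
  have := ler_wpM2l (ltW k3') Qw; lra.
Qed.

End Regimes.

Section Constants.
Variable R : realType.

Lemma ex_max (s : seq R) : exists M, all (fun x => x <= M) s.
Proof.
elim: s => [|x s [M h]]; first by exists 0.
exists (Num.max x M); rewrite /= le_max lexx /=; apply: sub_all h => y yM.
by rewrite le_max yM orbT.
Qed.

Lemma ex_min (s : seq R) : all (fun x => 0 < x) s -> exists2 d, 0 < d & all (fun x => d <= x) s.
Proof.
elim: s => [|x s IH] /=; first by exists 1.
move=> /andP[x0 /IH[d d0 h]]; exists (Num.min x d); first by rewrite lt_min x0.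
rewrite ge_min lexx /=; apply: sub_all h => y yM.
by rewrite ge_min yM orbT.
Qed.

Lemma ex_theta (y b : R) : 0 < y -> 0 < b -> exists2 th, 0 <= th & 4 * expR (- th) * (th + b) <= y.
Proof.
move=> y0 b0; pose th := 4 * (2 + b) / y.
have t0 : 0 < th by rewrite divr_gt0 //; lra.
exists th; first exact: ltW.
have h1 := expR_quad (ltW t0); have h2 := expR_ge1Dx th.
have e0 := expR_gt0 th.
have ty : th * y = 4 * (2 + b) by rewrite /th divfK // gt_eqF.
rewrite expRN mulrAC ler_pdivrMr //.
rewrite -(ler_pM2l t0) [leRHS]mulrA ty.
have h3 : th * b <= b * expR th by rewrite mulrC ler_wpM2l // ?ltW //; lra.
have h4 : th * th <= 2 * expR th by move: h1; rewrite expr2; lra.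
have := ler_wpM2l (ltW b0) h2; lra.
Qed.

Lemma ex_decay (y A : R) : 0 < y -> 0 < A -> exists2 s, 0 <= s & expR (- s) * A <= y.
Proof.
move=> y0 A0; have s0 : 0 < A / y by rewrite divr_gt0.
exists (A / y); first exact: ltW.
apply: le_trans (ler_wpM2r (ltW A0) (expRN_le_inv s0)) _.
by rewrite invf_div divfK // gt_eqF.
Qed.

(** All conditions are monotone in [c], so it is enough to meet them at [c = (2 r)^-1]; thus [beta]
    does not depend on the partition. *)
Lemma ex_dense (r : nat) : (1 < r)%N -> exists beta ell : R, [/\ 0 < beta, beta <= 4^-1,
  2 * beta <= expR (- ell) / 2 &
  forall c, (2 * r%:R)^-1 <= c -> [/\ beta <= (c ^+ r.-1 / 4 / 4) ^+ r, beta <= c ^+ r.-1 / 2 &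
    3 <= ell * (c ^+ r.-1 / 4 / 4)]].
Proof.
move=> r1; pose i : R := (2 * r%:R)^-1; pose k := i ^+ r.-1 / 4 / 4.
have rp : 0 < r%:R :> R by rewrite ltr0n ltnW.
have i0 : 0 < i by rewrite invr_gt0 mulr_gt0.
have i1 : i <= 1.
  by rewrite invf_le1 ?mulr_gt0 // -natrM (ler_nat R 1) muln_gt0 /= ltnW.
have p0 : 0 < i ^+ r.-1 by rewrite exprn_gt0.
have p1 : i ^+ r.-1 <= 1 by rewrite exprn_ile1 // ltW.
have k0 : 0 < k by rewrite /k; lra.
have k1 : k <= 1 by rewrite /k; lra.
have kr : k ^+ r <= k by rewrite -[leRHS]expr1 ler_wiXn2l ?(ltW k0) // ltnW.
have kr0 : 0 < k ^+ r by rewrite exprn_gt0.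
have ap : all (fun x => 0 < x) [:: 4^-1; k ^+ r; expR (- (3 / k)) / 4].
  by rewrite /= kr0 invr_gt0 divr_gt0 ?expR_gt0 //= ltr0n.
have [beta b0 /and4P[hb1 hb2 hb3 _]] := ex_min ap.
exists beta, (3 / k); split=> //; first by lra.
move=> c hc; have ck : i ^+ r.-1 <= c ^+ r.-1.
  by rewrite lerXn2r ?nnegrE ?(ltW i0) // (le_trans (ltW i0)).
have kc : k <= c ^+ r.-1 / 4 / 4 by rewrite /k; lra.
split.
- by apply: le_trans hb2 _; rewrite lerXn2r ?nnegrE ?(ltW k0) // (le_trans (ltW k0)).
- by apply: le_trans hb2 (le_trans kr _); apply: le_trans kc _; lra.
- have := ler_wpM2l (ltW (divr_gt0 (ltr0Sn R 2) k0)) kc; rewrite divfK // gt_eqF //.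
Qed.

End Constants.

(** * Reduction to bad graphs and conclusion *)

Lemma Fstar_sub (R : realType) n m r (delta gamma dm : R) (P : labelling n r) :
  delta * m%:R <= dm -> Fstar n m r delta gamma P \subset bad_graphs P m dm.
Proof.
move=> h; apply/subsetP => G; rewrite [G \in Fstar _ _ _ _ _ _]inE /condA.
move=> /andP[/[!inE] /andP[/and3P[gG kf cG] _] /and3P[hA hB hI]].
rewrite (internal_inner P gG) in hA hI.
by rewrite gG kf cG hB -card_gt0 hI (le_trans hA h).
Qed.

(** Crudely [m <= 2 ^ n], so (A) leaves less than one inner edge while the family requires one. This
    disposes of small [n]. *)
Lemma Fstar_eq0 (R : realType) n m r (delta gamma : R) (P : labelling n r) :
  delta * (2 ^ n)%:R < 1 -> 0 < delta -> Fstar n m r delta gamma P = set0.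
Proof.
move=> h d0; apply/setP => G; rewrite in_set0; apply/negP.
rewrite [G \in Fstar _ _ _ _ _ _]inE /condA.
move=> /andP[/[!inE] /andP[/and3P[gG kf /eqP cG] _] /and3P[hA hB hI]].
have mle : (m <= 2 ^ n)%N.
  have <- : #|powerset [set: 'I_n]| = (2 ^ n)%N by rewrite card_powerset cardsT card_ord.
  rewrite -cG subset_leq_card //.
  by apply/subsetP => x _; rewrite powersetE finset.subsetT.
have : 1 <= (internal G P)%:R :> R by rewrite (ler_nat R 1).
have := ler_wpM2l (ltW d0) (_ : m%:R <= (2 ^ n)%:R :> R); rewrite ler_nat => /(_ mle); lra.
Qed.

Theorem theorem6p3 (R : realType) (r : nat) (eps : R) :
  (2 <= r)%N -> 0 < eps ->
  exists gamma : R, 0 < gamma /\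
  exists omega : nat -> R,
    (forall M : R, exists N : nat, forall n : nat, (N <= n)%N -> M < omega n) /\
    exists delta0 : R, 0 < delta0 /\
    forall delta : R, 0 < delta -> delta <= delta0 ->
    forall n m : nat, (1 + eps) * m_r R n r <= m%:R ->
    forall P : labelling n r, inP gamma P ->
      (#|Fstar n m r delta gamma P|)%:R <= (omega n)^-1 * (binomial (ePi P) m)%:R.
Proof.
move=> r1 eps0; pose E := 'C(r.+1, 2).-1.
have r2 : 2 <= r%:R :> R by rewrite (ler_nat R 2).
have [e [e0 e1 ee]] : exists e : R, [/\ 0 < e, e <= 1 & e <= eps].
  by exists (Num.min 1 eps); rewrite lt_min ltr01 eps0 !ge_min !lexx orbT.
have D0 : 0 < r%:R ^+ 2 + 4 * E%:R :> R by rewrite ltr_wpDr ?mulr_ge0 // exprn_gt0 //; lra.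
have zp : 0 < e / (32 * (r%:R ^+ 2 + 4 * E%:R)) by rewrite divr_gt0 // mulr_gt0.
(* [zeta] also serves as [gamma]: the second entry keeps every part at size at least [n / (2 r)],
   the third provides the slack for [mu_lower]. *)
have ap : all (fun x : R => 0 < x) [:: 2^-1; (2 * r%:R)^-1; e / (32 * (r%:R ^+ 2 + 4 * E%:R))].
  by rewrite /= zp !invr_gt0 mulr_gt0 //= ltr0n ltnW.
have [zeta zeta0 /and4P[zeta2 zetar zetae _]] := ex_min ap.
have hslack : zeta * (r%:R ^+ 2 + 2 * E%:R) + 2 * E%:R * zeta <= e / 8.
  move: zetae; rewrite invfM mulrA ler_pdivlMr //; lra.
have [beta [ell [b0 b4 bell bc]]] := ex_dense R r1.
have A10 : 0 < overlap_const r R * (2 * r%:R) ^+ r.-1 by rewrite mulr_gt0 // exprn_gt0 // mulr_gt0 // ltr0n ltnW.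
have A20 : 0 < overlap_const r R * (2 * r%:R) ^+ r.-1 * (4 * r%:R + 7) by rewrite mulr_gt0 //; lra.
have e24 : 0 < e / 24 by rewrite divr_gt0.
have [eta eta0 k3] : exists2 eta : R, 0 < eta & overlap_const r R * (2 * r%:R) ^+ r.-1 * (4 * r%:R + 7) * eta
  <= e / 24.
  by exists (e / 24 / (overlap_const r R * (2 * r%:R) ^+ r.-1 * (4 * r%:R + 7)));
    [rewrite divr_gt0|rewrite mulrC divfK // gt_eqF].
have bi0 : 0 < beta^-1 by rewrite invr_gt0.
have [theta th0 k5] := ex_theta (mulr_gt0 eta0 e24) bi0.
have [a a0 k6] : exists2 a : R, 0 < a & a * (beta^-1 + 1) <= e / 24.
  by exists (e / 24 / (beta^-1 + 1)); [rewrite divr_gt0 // addr_gt0|rewrite divfK // gt_eqF // addr_gt0].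
have r4 : 0 < 4 * r%:R ^+ 2 / beta by rewrite divr_gt0 // mulr_gt0 // exprn_gt0 //; lra.
have eta32 : 0 < eta / 32 by rewrite divr_gt0.
have [s0 s00 k7] := ex_decay eta32 r4.
set xi := expR (- theta) in k5; have xi0 : 0 < xi by exact: expR_gt0.
have [K /and3P[K1 K2 _]] := @ex_max R [:: 1;
  r%:R * ln (8 * expR 1 / (beta * xi)) + 16 * r%:R * (beta^-1 + 4 / a + 2) / xi + 1].
have K0 : 0 < K by exact: lt_le_trans ltr01 K1.
pose kap := expR (- (4 * (K + ln 8))).
have kap0 : 0 < kap by exact: expR_gt0.
have p2 : 0 < 2 ^+ r :> R by rewrite exprn_gt0.
have ap2 : all (fun x : R => 0 < x) [:: eta / 32 / (s0 + 1); kap / (32 * K * 2 ^+ r);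
   zeta / (1 + 2 * r%:R ^+ 3); beta / 2].
  have r3 : 0 < 1 + 2 * r%:R ^+ 3 :> R by rewrite ltr_wpDr // mulr_ge0 // exprn_ge0.
  by rewrite /= !divr_gt0 // ?mulr_gt0 // ltr_wpDl.
have [dl dl0 /and5P[d1 d2 d3 d4 _]] := ex_min ap2.
have k9' : dl * s0 <= eta / 32.
  move: d1; rewrite ler_pdivlMr ?ltr_wpDl // => d1; apply: le_trans d1.
  by rewrite ler_wpM2l ?(ltW dl0) // lerDl.
have k9'' : dl * (32 * K * 2 ^+ r) <= kap by move: d2; rewrite ler_pdivlMr // !mulr_gt0.
have k9''' : dl * (1 + 2 * r%:R ^+ 3) <= zeta.
  by move: d3; rewrite ler_pdivlMr // ltr_wpDr // mulr_ge0 // exprn_ge0.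
have [Cq /and5P[C1 C2 C3 C4 _]] := @ex_max R [:: 16 / eta; 8 / xi; 128 * K * 2 ^+ r / xi; 2].
have q1 : 16 <= eta * Cq by move: C1; rewrite ler_pdivrMr // mulrC.
have q2 : 8 <= xi * Cq by move: C2; rewrite ler_pdivrMr // mulrC.
have q3 : 128 * K * 2 ^+ r <= xi * Cq by move: C3; rewrite ler_pdivrMr // [leRHS]mulrC.
have x8 : 0 < (xi / 8) ^+ r.-1 by rewrite exprn_gt0 // divr_gt0.
(* All requirements that [n] be large are lower bounds on [ln n], in the order of the hypotheses
   [l0] to [l8]. *)
have [Lm hLm] := @ex_max R [:: 1; 2 * Cq * (r%:R + 2) ^+ 2; 2 * eta / xi; 32 * s0; 4 * K / (xi / 8) ^+ r.-1;
  xi / dl; 4 * r%:R ^+ 2; beta^-1; 64 * 48 * (2 * r%:R) ^+ r.-1 / (beta * e ^+ 3)].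
have [N0 [_ hN0]] := nat_floor (expR_ge0 Lm).
have hL n : (N0 < n)%N -> Lm <= ln n%:R.
  move=> hn; rewrite -[leLHS]expRK ler_ln ?posrE ?expR_gt0 ?ltr0n ?(leq_ltn_trans _ hn) //.
  by apply: le_trans (ltW hN0) _; rewrite natr1 ler_nat.
exists zeta; split=> //.
(* [zeta^-1] is the cost of the transfer and [37 / ln n] comes from [total_bound]. Up to [N0] the
   value is a placeholder: there the family is empty. *)
exists (fun n => if (n <= N0)%N then 1 else zeta / 37 * ln n%:R); split.
  move=> M; have [N1 [_ hN1]] := nat_floor (expR_ge0 (M / (zeta / 37))).
  exists (N0 + N1).+1 => n hn; rewrite leqNgt (_ : (N0 < n)%N) /=; last by apply: leq_trans hn; rewrite ltnS leq_addr.
  have n0 : (0 < n)%N by apply: leq_trans hn.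
  rewrite mulrC -ltr_pdivrMr ?divr_gt0 //.
  rewrite -[ltLHS]expRK ltr_ln ?posrE ?expR_gt0 ?ltr0n //.
  by apply: lt_le_trans hN1 _; rewrite natr1 ler_nat; apply: leq_trans hn; rewrite ltnS leq_addl.
(* Guarantees [delta * 2 ^ n < 1] for all [n <= N0]. *)
have pN : 0 < (2 * (2 ^ N0)%:R)^-1 :> R by rewrite invr_gt0 mulr_gt0 // ltr0n expn_gt0.
have ap3 : all (fun x : R => 0 < x) [:: dl; (2 * (2 ^ N0)%:R)^-1] by rewrite /= dl0 pN.
have [delta0 de0 /and3P[de1 de2 _]] := ex_min ap3.
exists delta0; split=> // delta dp dd n m hm P PP.
case: leqP => hn.
  rewrite (Fstar_eq0 m zeta P _ dp) ?cards0 ?invr1 ?mul1r //.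
  apply: (@le_lt_trans _ _ (delta * (2 ^ N0)%:R)).
    by rewrite ler_wpM2l ?(ltW dp) // ler_nat leq_exp2l.
  have y0 : 0 < (2 ^ N0)%:R :> R by rewrite ltr0n expn_gt0.
  have := ler_wpM2r (ltW y0) (le_trans dd de2); rewrite invfM divfK ?gt_eqF // => h.
  by apply: (le_lt_trans h); rewrite invf_lt1 // ltr1n.
have n1 : (1 < n)%N.
  rewrite ltnNge; apply/negP => nle.
  have : ln n%:R <= 0 :> R by rewrite ln_le0 // (ler_nat R n 1).
  by move: hLm => /andP[l0 _] /(le_trans (le_trans l0 (hL n hn))); rewrite ler10.
have : all (fun x => x <= ln n%:R) _ := sub_all (fun x (hx : x <= Lm) => le_trans hx (hL n hn)) hLm.
move=> /andP[l0 /andP[l1 /andP[l2 /andP[l3 /andP[l4 /andP[l5 /andP[l6 /andP[l7 /andP[l8 _]]]]]]]]].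
set L := ln n%:R in l0 l1 l2 l3 l4 l5 l6 l7 l8 *.
have L0 : 0 < L by exact: lt_le_trans ltr01 l0.
pose c := r%:R^-1 - zeta.
have c1 : (2 * r%:R)^-1 <= c.
  by rewrite /c; move: zetar; rewrite invfM; clear; lra.
have c2 : c <= 1.
  rewrite /c; have : r%:R^-1 <= 1 :> R by rewrite invf_le1 ?(lt_le_trans _ r2) // (le_trans _ r2) // ler1n.
  by move: zeta0; clear; lra.
have hc i : c * n%:R <= #|part P i|%:R by move: PP => /andP[_ /forallP/(_ i)/andP[]].
have sub : Fstar n m r delta zeta P \subset bad_graphs P m (dl * m%:R).
  by apply: Fstar_sub; rewrite ler_wpM2r // (le_trans dd de1).
have -> : ePi P = #|EP P| by [].
apply: (@le_trans _ _ #|bad_graphs P m (dl * m%:R)|%:R); first by rewrite ler_nat subset_leq_card.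
have zi : (zeta / 37 * L)^-1 = zeta^-1 * 37 * L^-1 by rewrite !invfM invrK.
have zi1 : 1 <= zeta^-1 by rewrite invf_ge1 // (le_trans zeta2) // invf_le1 // ler1n.
have Li0 : 0 < L^-1 by rewrite invr_gt0.
(* The dense alternative includes [m > N]. *)
have [hm2|/ltW hm2] := leP m%:R ((1 - beta) * #|EP P|%:R).
  have k8 : r%:R * ln (8 * expR 1 / (beta * xi)) + 16 * r%:R * (beta^-1 + 4 / a + 2) / xi <= K - 1 by rewrite lerBrDr.
  have l2' : 2 * eta <= xi * L by rewrite [leRHS]mulrC -ler_pdivrMr.
  have l4' : 4 * K <= (xi / 8) ^+ r.-1 * L by rewrite [leRHS]mulrC -ler_pdivrMr.
  have l5' : xi <= dl * L by rewrite [leRHS]mulrC -ler_pdivrMr.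
  have NN := N_gt0 r1 n1 c1 hc.
  have hmu : (1 + 3 / 4 * e) * ((2 * r%:R + 2) / (r%:R + 2) * L) <=
     (c * n%:R) ^+ r.-1 * ((1 - zeta) ^+ 2 * (m%:R / #|EP P|%:R)) ^+ 'C(r.+1, 2).-1.
    apply: (@mu_lower R r n m #|EP P|%:R e eps zeta zeta) => //; rewrite ?(ltW zeta0) //.
    - exact: card_EP_le.
    - by rewrite divfK // gt_eqF.
  have k7' : expR (- s0) * (4 * r%:R ^+ 2) / beta <= eta / 32 by rewrite -mulrA.
  have HS := (sparse_regime r1 n1 c1 c2 hc e0 e1 zeta0 zeta2 k3 eta0 b0 k5 th0 k6 a0 k7' s00
     k8 K1 dl0 k9' k9'' k9''' q1 q2 q3 C4 l0 l1 l2' l3 l4' l5' l6 l7 l8 hm2 hmu).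
  apply: (le_trans HS).
  by rewrite zi le_eqVlt; apply/orP; left; apply/eqP; move: ('C(_, _)%:R : R) => x; ring.
have [bc1 bc2 bc3] := bc c c1.
have HD := dense_regime r1 n1 c1 hc dl0 d4 b0 b4 bc1 bc2 bc3 bell hm2.
apply: (le_trans HD).
rewrite mulrC ler_wpM2r //.
have nE : n%:R = expR L := natr_expR_ln R n1.
have L4 : 4 <= L.
  have : 2 * 2 <= r%:R * r%:R :> R by rewrite ler_pM.
  by move: l6; rewrite expr2; clear; lra.
have nL : 2 * L <= n%:R.
  rewrite nE; apply: le_trans (expR_quad (ltW L0)); have := ler_wpM2r (ltW L0) L4; rewrite expr2; clear; lra.
have v1 : n%:R * expR (- n%:R) <= L^-1.
  rewrite [X in X * _]nE -expRD; apply: le_trans (expRN_le_inv L0); rewrite ler_expR; move: nL; clear; lra.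
have v0 : 0 <= n%:R * expR (- n%:R) :> R by rewrite mulr_ge0 // expR_ge0.
have Li1 : L^-1 <= 1 by rewrite invf_le1.
have := expR_sub1_le v0 (le_trans v1 Li1).
have : 37 * L^-1 <= zeta^-1 * 37 * L^-1 by rewrite -mulrA ler_peMl // mulr_ge0 // ltW.
rewrite zi; move: Li0 v1; clear; lra.
Qed.
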